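(* Suppose Assumptions 1, 2, 3 of the context hold. Let $\bar x_*$ be the output of the two-phase ZS-BCCG method (described in the context) applied to $\min_{x\in X}\{\Phi(x)=f(x)+\chi(x)\}$ with number of runs $S$, number $\tilde T$ of oracle calls per run, and post-optimization sample size $\mathcal T$. Let $$\mathbf C_{\tilde T}=\frac{8\sqrt{(n+4)(2M^2+\sigma^2)}}{\sqrt{\tilde T}}\Big(2\kappa_1\tilde D+\frac{\hat L^2D_\Phi^2+\hat L}{\tilde D}\Big)+\frac{[(16\kappa_2+1)L_f^2D_\Phi^2+8(\hat L^2D_\Phi^2+\hat L)](n+4)}{\tilde T},$$ $$\kappa_1=\max\Big\{\frac{\omega_L\sqrt{(n+4)(2M^2+\sigma^2)}}{\tilde D\sqrt{\tilde T}},1\Big\},\qquad\kappa_2=\max\Big\{\frac{\omega_L(n+4)}{\tilde T},1\Big\}.$$ Then for all $\lambda>0$, $$\mathrm{Prob}\Big\{\Big\|\mathcal P\Big(\bar x_*,\nabla f(\bar x_* ),\frac1{2\hat L}\Big)\Big\|^2\ge16b\omega_L\mathbf C_{\tilde T}+\frac{3D_\Phi^2L_f^2b(n+4)}{\tilde T}+\frac{32(n+4)\lambda}{\mathcal T}\Big[2M^2+\sigma^2+\frac{D_\Phi^2L_f^2b}{\tilde T}\Big]\Big\}\le\frac{S+1}\lambda+2^{-S}.$$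
   Context: Notation: $n=n_1+\dots+n_b$, $\mathcal B=\{1,\dots,b\}$, $U_s\in\mathbb R^{n\times n_s}$ with $(U_1,\dots,U_b)=I_n$; $x^{(s)}=U_s^Tx$, $\nabla_sf=U_s^T\nabla f$; $\|\cdot\|$, $\|\cdot\|_s$ are Euclidean norms on $\mathbb R^n$, $\mathbb R^{n_s}$. $X=X_1\times\cdots\times X_b$, each $X_s\subseteq\mathbb R^{n_s}$ closed convex. Problem: $\Phi=f+\chi$ with $f(x)=\mathbb E_\xi[F(x,\xi)]$ (possibly nonconvex), $\xi$ a random variable, $F$ Borel measurable and defined for all $x\in\mathbb R^n$; $\chi(x)=\sum_{s=1}^b\chi_s(x^{(s)})$ with $\chi_s:\mathbb R^{n_s}\to\mathbb R$ closed convex. $\Phi^*=\min_{x\in X}\Phi(x)$. Assumption 1: $\mathbb E[F(x,\xi)]=f(x)$ and $\mathbb E[\nabla F(x,\xi)]=\nabla f(x)$ for all $x$, and $\mathbb E[\|\nabla F(x,\xi)-\nabla f(x)\|^2]\le\sigma^2$ for all $x\in X$. Assumption 2: almost surely in $\xi$, $\|\nabla F(x,\xi)-\nabla F(y,\xi)\|\le L_f\|x-y\|$ for all $x,y$, and for each $s\in\mathcal B$, $\|\nabla_sF(x+U_sh,\xi)-\nabla_sF(x,\xi)\|_s\le L_s\|h\|_s$ for all $x$ and all $h\in\mathbb R^{n_s}$ ($L_f,L_s>0$). Assumption 3: $\|\nabla f(x)\|\le M$ for all $x\in X$. Constants: $\hat L=\max_sL_s$, $\check L=\min_sL_s$, $\omega_L=\hat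 L/\check L+2$, $D_\Phi=[(\Phi(x_1)-\Phi^* )/\hat L]^{1/2}$, and $\tilde D>0$ is a fixed parameter. Generalized gradient: $\phi_s:\mathbb R^{n_s}\to\mathbb R$ is differentiable and 1-strongly convex, $D_{\phi_s}(x,y)=\phi_s(x)-\phi_s(y)-\langle\nabla\phi_s(y),x-y\rangle$. For $\alpha>0$, $P_s(x^{(s)},g^{(s)},\alpha)=\arg\min_{y\in X_s}\{\langle g^{(s)},y\rangle+\frac1\alpha D_{\phi_s}(y,x^{(s)})+\chi_s(y)\}$, $\mathcal P_s(x,g,\alpha)=\frac1\alpha[x^{(s)}-P_s(x^{(s)},g^{(s)},\alpha)]$, and $\mathcal P(x,g,\alpha)=(\mathcal P_1(x,g,\alpha),\dots,\mathcal P_b(x,g,\alpha))$. Zeroth-order gradient: $G_\mu(x,\xi,u)=\frac{F(x+\mu u,\xi)-F(x,\xi)}{\mu}u$; each evaluation counts as one call to the stochastic zeroth-order oracle. Procedure $\mathrm{CndG}_{X_s}(x,g,\alpha,\delta)$ ($x\in X_s$, $g\in\mathbb R^{n_s}$, $\alpha,\delta>0$): start with $u_1=x$, $t=1$. Compute a minimizer $v_{t+1}$ over $u\in X_s$ of $V(u)=\langle g+\frac1\alpha(\nabla\phi_s(u_t)-\nabla\phi_s(x)),u-u_t\rangle+\chi_s(u)-\chi_s(u_t)$. If $V(v_{t+1})\ge-\delta$, return $u_t$; otherwise set $u_{t+1}=(1-\frac2{t+1})u_t+\frac2{t+1}v_{t+1}$, $t\leftarrow t+1$ and repeat. The procedure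 is understood to be well defined and to terminate. Approximate ZS-BCCG method: given $x_1\in X$, $\mu>0$, iteration count $T$, stepsizes $\alpha_k>0$, batch sizes $T_k\ge1$, approximating parameters $\delta_k>0$, probabilities $p_s$ with $\sum_sp_s=1$. Draw i.i.d. block indices $i_k$ with $\mathrm{Prob}\{i_k=s\}=p_s$ and $R\in\{1,\dots,T\}$ with probability mass function $P_R$. At step $k$ draw $u_{k,t}\sim N(0,I_n)$ and oracle samples $\xi_{k,t}$ distributed as $\xi$, $t=1,\dots,T_k$, set $\bar G_{\mu,k}^{(i_k)}=\frac1{T_k}\sum_{t=1}^{T_k}U_{i_k}^TG_\mu(x_k,\xi_{k,t},u_{k,t})$, $x_{k+1}^{(i_k)}=\mathrm{CndG}_{X_{i_k}}(x_k^{(i_k)},\bar G_{\mu,k}^{(i_k)},\alpha_k,\delta_k)$, and $x_{k+1}^{(s)}=x_k^{(s)}$ for $s\ne i_k$. Output $x_R$. All random quantities are mutually independent. Two-phase ZS-BCCG (2-ZS-BCCG): Optimization phase: for $i=1,\dots,S$ independently run approximate ZS-BCCG from the same $x_1$ with $p_s=1/b$, $\alpha_k=1/(2\hat L)$, batch sizes $T_k=T'=\lceil\min\{\max\{\frac{\omega_L\sqrt{(n+4)(2M^2+\sigma^2)\tilde T}}{\tilde D},\omega_L(n+4)\},\tilde T\}\rceil$, iteration limit $T=\lfloor\tilde T/T'\rfloor$, smoothing parameter $0<\mu\le\frac{D_\Phi}{n+4}\sqrt{b/\tilde T}$, $\delta_k=1/(3T)$, and $P_R(k)=\frac{\alpha_k\min_s\{p_s(1-L_s\alpha_k)\}}{\sum_{k=1}^T\alpha_k\min_s\{p_s(1-L_s\alpha_k)\}}$;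 let $\bar x_i$ be the output of run $i$. Post-optimization phase: with fresh independent samples $(\xi_k,u_k)$, $k=1,\dots,\mathcal T$, set $G_{\mu,\mathcal T}(x)=\frac1{\mathcal T}\sum_{k=1}^{\mathcal T}G_\mu(x,\xi_k,u_k)$ and output $\bar x_*\in\arg\min_{\bar x_1,\dots,\bar x_S}\|\mathcal P(\bar x_i,G_{\mu,\mathcal T}(\bar x_i),1/(2\hat L))\|$. *)

(* Defs.v *)
From HB Require Import structures.
From mathcomp Require Import all_boot all_order all_algebra.
From mathcomp Require Import all_classical all_reals all_analysis.

Set Implicit Arguments.
Unset Strict Implicit.
Unset Printing Implicit Defensive.

Import Order.TTheory GRing.Theory Num.Theory.
Import numFieldNormedType.Exports.

Local Open Scope classical_set_scope.
Local Open Scope ring_scope.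

(* R^m is 'cV[R]_m.  Its library norm `|x| is the sup norm; it induces the same
   topology, hence the same closed sets, Borel sets and differentiability, as
   the Euclidean norm [enorm]. *)
Section Euclidean.
Context {R : realType} {m : nat}.
Implicit Types (x y : 'cV[R]_m) (h : 'cV[R]_m -> R).

Definition dotv x y : R := (x^T *m y) 0 0.

Definition enorm x : R := Num.sqrt (dotv x x).

Definition grad h x : 'cV[R]_m := \col_i 'D_(delta_mx i 0) h x.

Definition argmin_on (A : set 'cV[R]_m) h : set 'cV[R]_m :=
  [set y | A y /\ forall z, A z -> h y <= h z].

Definition closed_convex_fun h : Prop :=
  closed [set p : 'cV[R]_m * R | h p.1 <= p.2] /\
  convex_function (E := 'cV[R]_m) setT h.

Definition strongly_convex1 h : Prop :=
  forall x y (t : R), 0 <= t <= 1 ->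
    h (t *: x + (1 - t) *: y) <=
      t * h x + (1 - t) * h y - t * (1 - t) / 2 * enorm (x - y) ^+ 2.

Definition bregman (phi : 'cV[R]_m -> R) x y : R :=
  phi x - phi y - dotv (grad phi y) (x - y).

(* [get A] is an element of [A] when [A] is nonempty; here the minimizer exists
   and is unique when [X] is nonempty closed convex, [chi] closed convex and
   [phi] differentiable and strongly convex. *)
Definition block_prox (X : set 'cV[R]_m) (phi chi : 'cV[R]_m -> R)
    x (g : 'cV[R]_m) (alpha : R) : 'cV[R]_m :=
  get (argmin_on X
    (fun y => dotv g y + alpha^-1 * bregman phi y x + chi y)).

Section CndG.
Variables (X : set 'cV[R]_m) (phi chi : 'cV[R]_m -> R).
Variables (x g : 'cV[R]_m) (alpha delta : R).

Definition cndg_gap (ut v : 'cV[R]_m) : R :=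
  dotv (g + alpha^-1 *: (grad phi ut - grad phi x)) (v - ut)
    + chi v - chi ut.

(* [cndg_from t ut y]: started at step [t] from the iterate [ut], the procedure
   can return [y]; any minimizer [v] may be picked at each step. *)
Inductive cndg_from : nat -> 'cV[R]_m -> 'cV[R]_m -> Prop :=
| cndg_stop t ut v :
    argmin_on X (cndg_gap ut) v -> cndg_gap ut v >= - delta ->
    cndg_from t ut ut
| cndg_step t ut v y :
    argmin_on X (cndg_gap ut) v -> cndg_gap ut v < - delta ->
    cndg_from t.+1 ((1 - 2 / t.+1%:R) *: ut + (2 / t.+1%:R) *: v) y ->
    cndg_from t ut y.

Definition cndg_output (y : 'cV[R]_m) : Prop := cndg_from 1 x y.

End CndG.
End Euclidean.

Notation borel V := (g_sigma_algebraType (@open V)).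

Notation blockvec R d := 'cV[R]_(\sum_s d s)%N.

Section Blocks.
Context {R : realType} {b : nat} (d : 'I_b -> nat).
Local Notation n := (\sum_(s < b) d s)%N.

Definition blockU (s : 'I_b) : 'M[R]_(n, d s) := submxrow 1%:M s.

Definition blk (s : 'I_b) (x : 'cV[R]_n) : 'cV[R]_(d s) := (blockU s)^T *m x.

Definition prod_set (X : forall s, set 'cV[R]_(d s)) : set 'cV[R]_n :=
  [set x | forall s, X s (blk s x)].

Definition block_sum (chi : forall s, 'cV[R]_(d s) -> R) (x : 'cV[R]_n) : R :=
  \sum_(s < b) chi s (blk s x).

Definition gen_grad (X : forall s, set 'cV[R]_(d s))
    (phi chi : forall s, 'cV[R]_(d s) -> R)
    (x g : 'cV[R]_n) (alpha : R) : 'cV[R]_n :=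
  \mxcol_(s < b) (alpha^-1 *:
    (blk s x - block_prox (X s) (phi s) (chi s) (blk s x) (blk s g) alpha)).

(* A deterministic implementation of the CndG procedure, i.e. one that chooses
   the minimizers as a function of the input.  Measurability of the output as a
   function of (x, g) is what makes the iterates random vectors. *)
Definition cndg_implementation (X : forall s, set 'cV[R]_(d s))
    (phi chi : forall s, 'cV[R]_(d s) -> R)
    (cndg : forall s, 'cV[R]_(d s) -> 'cV[R]_(d s) -> R -> R -> 'cV[R]_(d s)) :=
  forall s (alpha delta : R), 0 < alpha -> 0 < delta ->
    (forall x g, X s x ->
      cndg_output (X s) (phi s) (chi s) x g alpha delta
        (cndg s x g alpha delta)) /\
    measurable_fun (X s `*` setT : set (borel 'cV[R]_(d s) * borel 'cV[R]_(d s)))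
      (fun p : borel 'cV[R]_(d s) * borel 'cV[R]_(d s) =>
         cndg s p.1 p.2 alpha delta : borel 'cV[R]_(d s)).

Section ZerothOrder.
Context {dXi : measure_display} {Xi : measurableType dXi}.
Variable F : 'cV[R]_n -> Xi -> R.

Definition zo_grad (mu : R) (x : 'cV[R]_n) (z : Xi) (u : 'cV[R]_n) : 'cV[R]_n :=
  ((F (x + mu *: u) z - F x z) / mu) *: u.

Definition avg_zo_grad (mu : R) (m : nat) (z : nat -> Xi) (u : nat -> 'cV[R]_n)
    (x : 'cV[R]_n) : 'cV[R]_n :=
  m%:R^-1 *: \sum_(t < m) zo_grad mu x (z t) (u t).

(* Steps are numbered from 0: [zs_bccg 0 = x1] and [zs_bccg k] is the iterate
   usually written x_{k+1}. *)
Fixpoint zs_bccg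
    (cndg : forall s, 'cV[R]_(d s) -> 'cV[R]_(d s) -> R -> R -> 'cV[R]_(d s))
    (mu : R) (alpha delta : nat -> R) (batch : nat -> nat) (x1 : 'cV[R]_n)
    (idx : nat -> 'I_b) (z : nat -> nat -> Xi) (u : nat -> nat -> 'cV[R]_n)
    (k : nat) : 'cV[R]_n :=
  if k is k'.+1 then
    let x := zs_bccg cndg mu alpha delta batch x1 idx z u k' in
    let G := avg_zo_grad mu (batch k') (z k') (u k') x in
    \mxcol_(s < b) (if s == idx k'
                    then cndg s (blk s x) (blk s G) (alpha k') (delta k')
                    else blk s x)
  else x1.

Variables (D : probability Xi R) (f : 'cV[R]_n -> R).

Definition assumption1 (X : set 'cV[R]_n) (sigma : R) : Prop :=
  [/\ forall x, D.-integrable setT (fun z => (F x z)%:E) /\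
        ('E_D[F x])%E = (f x)%:E,
      forall x, differentiable f x /\
        forall i, D.-integrable setT (fun z => (grad (F^~ z) x i 0)%:E) /\
          ('E_D[fun z => (grad (F^~ z) x i 0)%R])%E = (grad f x i 0)%:E
    & forall x, X x ->
        ('E_D[fun z => (enorm (grad (F^~ z) x - grad f x) ^+ 2)%R]
           <= (sigma ^+ 2)%:E)%E].

Definition assumption2 (Lf : R) (L : 'I_b -> R) : Prop :=
  {ae D, forall z,
    [/\ forall x, differentiable (F^~ z) x,
        forall x y, enorm (grad (F^~ z) x - grad (F^~ z) y) <= Lf * enorm (x - y)
      & forall s x (h : 'cV[R]_(d s)),
          enorm (blk s (grad (F^~ z) (x + blockU s *m h))
                 - blk s (grad (F^~ z) x)) <= L s * enorm h]}.

Definition assumption3 (X : set 'cV[R]_n) (M : R) : Prop :=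
  forall x, X x -> enorm (grad f x) <= M.

End ZerothOrder.
End Blocks.

Section Probability.
Context {R : realType} {dO : measure_display} {Omega : measurableType dO}.
Variable P : probability Omega R.

Definition finite_law (I : finType) (X : Omega -> I) (p : I -> R) : Prop :=
  forall s, measurable (X @^-1` [set s]) /\ P (X @^-1` [set s]) = (p s)%:E.

Definition has_law (dT : measure_display) (T : measurableType dT)
    (X : Omega -> T) (D : probability T R) : Prop :=
  measurable_fun setT X /\ forall A, measurable A -> P (X @^-1` A) = D A.

(* N(0, I_m), the law whose coordinates are independent N(0, 1) variables.  The
   second parameter of [normal_prob] is the standard deviation. *)
Definition std_gaussian (m : nat) (X : Omega -> borel 'cV[R]_m) : Prop :=
  measurable_fun setT X /\
  forall A : 'I_m -> set (measurableTypeR R), (forall j, measurable (A j)) ->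
    P [set w | forall j, A j ((X w : 'cV[R]_m) j 0)] =
      (\prod_(j < m) normal_prob (0 : R) 1 (A j))%E.

(* The minimum over the (finite) block indices is the infimum of the range. *)
Definition out_weight (b : nat) (p L : 'I_b -> R) (alpha : nat -> R) (k : nat) : R :=
  alpha k * inf (range (fun s => p s * (1 - L s * alpha k))).

Definition out_pmf (b : nat) (p L : 'I_b -> R) (alpha : nat -> R) (T : nat)
    (k : 'I_T) : R :=
  out_weight p L alpha k / \sum_(j < T) out_weight p L alpha j.

Definition mutually_independent (J : finType) (G : J -> set (set Omega)) : Prop :=
  forall (K : {set J}) (A : J -> set Omega), (forall j, j \in K -> G j (A j)) ->
    P (\bigcap_(j in [set` K]) A j) = (\prod_(j in K) P (A j))%E.

Section TwoPhase.
Variables (S T B N b n : nat).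
Context {dXi : measure_display} {Xi : measurableType dXi}.
Variables (idx : 'I_S -> nat -> Omega -> 'I_b) (out : 'I_S -> Omega -> 'I_T).
Variables (z : 'I_S -> nat -> nat -> Omega -> Xi).
Variables (u : 'I_S -> nat -> nat -> Omega -> borel 'cV[R]_n).
Variables (zpost : nat -> Omega -> Xi) (upost : nat -> Omega -> borel 'cV[R]_n).

Local Notation generated X := (preimage_set_system setT X measurable).

(* The sigma-algebras generated by the block indices, the output indices, the
   oracle samples and Gaussian directions of the [S] runs ([T] iterations with
   batches of size [B]), and the [N] fresh pairs of the second phase. *)
Definition sample_sigma
    (j : ('I_S * 'I_T) + ('I_S + (('I_S * 'I_T * 'I_B) +
         (('I_S * 'I_T * 'I_B) + ('I_N + 'I_N))))) : set (set Omega) :=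
  match j with
  | inl (i, k) => preimage_set_system setT (idx i k) setT
  | inr (inl i) => preimage_set_system setT (out i) setT
  | inr (inr (inl (i, k, t))) => generated (z i k t)
  | inr (inr (inr (inl (i, k, t)))) => generated (u i k t)
  | inr (inr (inr (inr (inl k)))) => generated (zpost k)
  | inr (inr (inr (inr (inr k)))) => generated (upost k)
  end.

Definition samples_independent : Prop := mutually_independent sample_sigma.

End TwoPhase.
End Probability.

(* Main.v *)
Require Import Defs.
From HB Require Import structures.
From mathcomp Require Import all_boot all_order all_algebra.
From mathcomp Require Import all_classical all_reals all_analysis.
From mathcomp Require Import measurable_realfun ring lra.

Set Implicit Arguments.
Unset Strict Implicit.
Unset Printing Implicit Defensive.

Import Order.TTheory GRing.Theory Num.Theory.
Import numFieldNormedType.Exports.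

Local Open Scope classical_set_scope.
Local Open Scope ring_scope.

(* Given x, the zeroth-order gradient is <a, u> u + r u with a = grad F(x, xi) and
   |r| <= mu Lf |u|^2 / 2, so the Gaussian moments bound its second moment and the
   distance of its mean to grad f(x); averaging a batch divides the variance by
   the batch size.  Along a run, the objective decreases at every step by a
   multiple of the squared block gradient mapping, up to the squared block error
   and delta.  These inequalities telescope pathwise; since the block index is
   uniform and independent of the past and of the samples, taking expectations
   turns the sampled block into the full vector, and the uniform output gives
   E |P(xbar_i)|^2 <= 2 b omega C.  In the second phase,
   |P(xbar_star)|^2 <= 4 |P(xbar_j)|^2 + 2 e_star + 4 e_j for every j, where e_i is
   the squared error of the second-phase gradient estimate at xbar_i.  Hence the
   event forces either |P(xbar_j)|^2 >= 4 b omega C for all j, which has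
   probability at most 2^-S by Markov and independence, or a large e_i for some
   i, each of which has probability at most 1/lambda. *)

(** * Independent sigma-algebras *)

(** Iterates depend on everything drawn before. Conditioning takes the form of independence between
    groups of sample sigma-algebras: an iterate is measurable for one group, the fresh samples for a
    disjoint one, and Tonelli lets the iterate be frozen. Estimates on the zeroth-order gradient are
    therefore stated at a deterministic point. Its mean is compared with grad f directly, so the
    descent concerns Phi itself rather than a Gaussian smoothing of f; the bound on mu makes the
    squared bias of order 1 / Tt. The proximal point is given by a choice operator, so its existence
    and measurability must be earned: existence from termination of CndG at every precision,
    measurability from a Lipschitz dependence on alpha g - grad phi(x). In the constant, Q = 2 b
    omega C bounds the mean of one run, Markov is applied at 2 Q, and the factor 4 of the selection
    inequality gives 8 Q = 16 b omega C; the second-phase error enters with 6 = 2 + 4. That error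
    splits into a fluctuation, the only part that Markov and hence lambda multiply, and a bias,
    which yields the lambda-free term in 1 / Tt. *)

Definition mfun_of d1 d2 (T1 : measurableType d1) (T2 : measurableType d2)
    (X : T1 -> T2) (mX : measurable_fun setT X) : {mfun T1 >-> T2} :=
  HB.pack X (isMeasurableFun.Build _ _ _ _ X mX).

Section IndependentPair.
Local Open Scope ereal_scope.
Context {R : realType} {d d1 d2 : measure_display}.
Context {Omega : measurableType d} {T1 : measurableType d1} {T2 : measurableType d2}.
Variable P : probability Omega R.
Variables (X : Omega -> T1) (Y : Omega -> T2).
Hypotheses (mX : measurable_fun setT X) (mY : measurable_fun setT Y).
Hypothesis indep : forall A B, measurable A -> measurable B ->
  P (X @^-1` A `&` Y @^-1` B) = P (X @^-1` A) * P (Y @^-1` B).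

Let mXY : measurable_fun setT (fun w => (X w, Y w)).
Proof. exact: measurable_fun_pair. Qed.

Let PX : probability T1 R := distribution P (mfun_of mX).
Let PY : probability T2 R := distribution P (mfun_of mY).
Let PXY : probability (T1 * T2)%type R := distribution P (mfun_of mXY).

Let prodE A : measurable A -> (PX \x PY) A = PXY A.
Proof.
by move=> mA; apply: product_measure_unique => // B C mB mC; exact: indep.
Qed.

(** The joint law of an independent pair is the product of the two laws, so Tonelli applies on the
    image space and the iterated integral is pulled back to [Omega]. This plays the role of
    conditioning on [X]. *)
Lemma ge0_integral_indep (h : T1 * T2 -> \bar R) :
  measurable_fun setT h -> (forall p, 0 <= h p) ->
  \int[P]_w h (X w, Y w) = \int[P]_w \int[P]_v h (X w, Y v).
Proof.
move=> mh h0.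
have mhx x : measurable_fun setT (fun y => h (x, y)).
  by apply: measurableT_comp.
transitivity (\int[PXY]_p h p); first by rewrite ge0_integral_distribution.
rewrite (eq_measure_integral (PX \x PY)); last by move=> A mA _; apply/esym/prodE.
rewrite fubini_tonelli1//.
rewrite ge0_integral_distribution//; first last.
- by move=> x; apply: integral_ge0.
- exact: measurable_fun_fubini_tonelli_F.
apply: eq_integral => w _ /=.
by rewrite /fubini_F ge0_integral_distribution.
Qed.

End IndependentPair.

Section IndependentProduct.
Local Open Scope ereal_scope.
Context {R : realType} {d : measure_display} {Omega : measurableType d}.
Variable P : probability Omega R.
Variables X Y : Omega -> R.
Hypotheses (iX : P.-integrable setT (EFin \o X)) (iY : P.-integrable setT (EFin \o Y)).
Hypothesis indep : forall A B : set R, measurable A -> measurable B ->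
  P (X @^-1` A `&` Y @^-1` B) = P (X @^-1` A) * P (Y @^-1` B).

Let mX : measurable_fun setT X.
Proof. by apply/measurable_EFinP; exact: measurable_int iX. Qed.
Let mY : measurable_fun setT Y.
Proof. by apply/measurable_EFinP; exact: measurable_int iY. Qed.

Let mh : measurable_fun setT (fun p : R * R => (p.1 * p.2)%:E).
Proof. by apply/measurable_EFinP; exact: measurable_funM. Qed.

Lemma integrable_indepM : P.-integrable setT (fun w => (X w * Y w)%:E).
Proof.
apply/integrableP; split; first by apply/measurable_EFinP; exact: measurable_funM.
have -> : \int[P]_w `|(X w * Y w)%:E| = \int[P]_w \int[P]_v `|(X w * Y v)%:E|.
  apply: (ge0_integral_indep mX mY indep (h := fun p : R * R => `|(p.1 * p.2)%:E|)) => //.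
  exact: measurableT_comp.
under eq_integral => w _.
  under eq_integral => v _ do rewrite EFinM abseM.
  rewrite ge0_integralZl//; last first.
    by apply: measurableT_comp => //; exact/measurable_EFinP.
  over.
rewrite ge0_integralZr//; first last.
- exact: integral_ge0.
- by apply: measurableT_comp => //; exact/measurable_EFinP.
rewrite lte_mul_pinfty//; first exact: integral_ge0.
  case/integrableP: iX => _ iXf; rewrite ge0_fin_numE//; exact: integral_ge0.
by case/integrableP: iY.
Qed.

Lemma expectation_indepM :
  \int[P]_w (X w * Y w)%:E = \int[P]_w (X w)%:E * \int[P]_w (Y w)%:E.
Proof.
have mXY : measurable_fun setT (fun w => (X w, Y w)) by exact: measurable_fun_pair.
pose Z := mfun_of mXY.
pose PX : probability _ R := distribution P (mfun_of mX).
pose PY : probability _ R := distribution P (mfun_of mY).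
have prodE A : measurable A -> (PX \x PY) A = distribution P Z A.
  by move=> mA; apply: product_measure_unique => // B C mB mC; exact: indep.
have iXY : (PX \x PY).-integrable setT (fun p : R * R => (p.1 * p.2)%:E).
  apply/integrableP; split => //.
  rewrite (eq_measure_integral (distribution P Z)); last by move=> A mA _; exact: prodE.
  rewrite ge0_integral_distribution//; last exact: measurableT_comp.
  by case/integrableP: integrable_indepM.
transitivity (\int[distribution P Z]_p (p.1 * p.2)%:E).
  rewrite integral_distribution//; exact: integrable_indepM.
rewrite (eq_measure_integral (PX \x PY)); last by move=> A mA _; apply/esym/prodE.
rewrite -integral12_prod_meas1// /fubini_F /=.
under eq_integral => x _.
  rewrite (_ : (fun y => _) = fun y => (x%:E * y%:E)%E); last first.
    by apply/funext => y; rewrite EFinM.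
  rewrite integralZl//; last exact: integrable_pushforward.
  over.
have -> : \int[PY]_y y%:E = \int[P]_w (Y w)%:E.
  rewrite (integral_distribution (f := EFin)) //.
have /fineK <- : \int[P]_w (Y w)%:E \is a fin_num by exact: integrable_fin_num.
rewrite integralZr//; last exact: integrable_pushforward.
by rewrite (integral_distribution (f := EFin)).
Qed.

End IndependentProduct.

(** * Independence of groups of sigma-algebras *)

Section Grouping.
Local Open Scope ereal_scope.
Context {R : realType} {d : measure_display} {Omega : measurableType d}.
Variable P : probability Omega R.

(** The restriction of [P] to [F] and the multiple of [P] by [P F] are finite measures that agree on
    the pi-system [G], hence on the sigma-algebra it generates. *)
Lemma indep_g_sigma (G : set (set Omega)) (F : set Omega) :
  setI_closed G -> G setT -> G `<=` measurable -> measurable F ->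
  (forall E, G E -> P (E `&` F) = P E * P F) ->
  forall E, <<s G >> E -> P (E `&` F) = P E * P F.
Proof.
move=> GI GT Gm mF GF E sE.
have PF0 : (0 <= fine (P F))%R by rewrite fine_ge0.
have scaleE A : mscale (NngNum PF0) P A = P F * P A.
  by rewrite /mscale -[X in _ = X * _]fineK ?fin_num_measure.
have H := @g_sigma_algebra_measure_unique _ R Omega G Gm (fun=> setT) (fun=> GT).
have {H} := H _ (mrestr P mF) (mscale (NngNum PF0) P) GI.
rewrite /mrestr => H; rewrite muleC -scaleE; apply: H => //.
- by rewrite -subTset => x _; exists O.
- move=> A GA; exact: etrans (GF A GA) (etrans (muleC _ _) (esym (scaleE A))).
- move=> _; suff : P (setT `&` F) < +oo by [].
  by rewrite setTI -ge0_fin_numE// fin_num_measure.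
Qed.

Variables (J : finType) (G : J -> set (set Omega)).
Hypotheses (GI : forall j, setI_closed (G j)) (GT : forall j, G j setT).
Hypothesis Gm : forall j, G j `<=` measurable.

Definition joint (A : {set J}) : set (set Omega) := \bigcup_(j in [set` A]) G j.

Lemma joint_measurable (A : {set J}) : <<s joint A >> `<=` measurable.
Proof.
apply: smallest_sub; first exact: sigma_algebra_measurable.
by move=> E [j _]; exact: Gm.
Qed.

Lemma sub_joint (A B : {set J}) : A \subset B -> <<s joint A >> `<=` <<s joint B >>.
Proof.
move=> /fintype.subsetP AB; apply: sub_sigma_algebra2 => E [j /= /AB jB GE].
by exists j.
Qed.

(** Unlike [joint A], finite intersections with one member per index form a pi-system, and they
    still generate the sigma-algebra of the group. *)
Let box (A : {set J}) : set (set Omega) :=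
  [set E | exists2 e : J -> set Omega, (forall j, G j (e j)) &
           E = \bigcap_(j in [set` A]) e j].

Let boxI (A : {set J}) : setI_closed (box A).
Proof.
move=> _ _ [e eG ->] [f fG ->]; exists (fun j => e j `&` f j).
  by move=> j; exact: GI.
by rewrite bigcapI.
Qed.

Let boxT (A : {set J}) : box A setT.
Proof. by exists (fun=> setT) => //; rewrite bigcapT. Qed.

Let box_measurable (A : {set J}) : box A `<=` measurable.
Proof.
move=> _ [e eG ->]; apply: fin_bigcap_measurable => [|j _]; last exact/Gm/eG.
exact: finite_finset.
Qed.

Let joint_box (A : {set J}) : <<s joint A >> `<=` <<s box A >>.
Proof.
apply: sub_sigma_algebra2 => E [j jA GE].
exists (fun i => if i == j then E else setT).
  by move=> i; case: eqP => // ->.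
apply/seteqP; split => [x Ex i _ /=|x /(_ j jA)]; first by case: eqP.
by rewrite eqxx.
Qed.

(** Independence is extended from boxes to sigma-algebras one factor at a time, the other factor
    being held fixed. *)
Lemma joint_indep (A B : {set J}) :
  mutually_independent P G -> (forall j, j \in A -> j \notin B) ->
  forall E F, <<s joint A >> E -> <<s joint B >> F -> P (E `&` F) = P E * P F.
Proof.
move=> indG AB E F EA FB.
apply: (@indep_g_sigma (box A)); try exact: joint_box EA; try exact: joint_measurable FB.
- exact: boxI.
- exact: boxT.
- exact: box_measurable.
move=> {EA}E' EA; rewrite setIC muleC.
apply: (@indep_g_sigma (box B)); try exact: joint_box FB.
- exact: boxI.
- exact: boxT.
- exact: box_measurable.
- exact: box_measurable EA.
move=> _ [f fG ->]; case: EA => e eG ->.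
(* Since [A] and [B] are disjoint, the two families glue into one, and the product formula over the
   union factors. *)
pose g j := if j \in A then e j else f j.
have gE : \bigcap_(j in [set` A]) e j = \bigcap_(j in [set` A]) g j.
  by apply: eq_bigcapr => j /= jA; rewrite /g jA.
have gF : \bigcap_(j in [set` B]) f j = \bigcap_(j in [set` B]) g j.
  apply: eq_bigcapr => j /= jB; rewrite /g ifF//.
  by apply/negbTE; apply: contraL jB; exact: AB.
have gG j : G j (g j) by rewrite /g; case: ifP.
rewrite gE gF -bigcap_setU.
have -> : [set` B] `|` [set` A] = [set` finset.setU B A].
  by apply/seteqP; split => x /=; rewrite finset.inE => /orP.
rewrite !indG//.
rewrite (eq_bigl [in [predU B & A]]) => [|j]; last by rewrite finset.inE inE.
rewrite bigU//=.
rewrite disjoint_subset; apply/fintype.subsetP => j jB.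
by rewrite inE; apply: contraL jB; exact: AB.
Qed.

Lemma joint_indep_preimage (A B : {set J}) d1 d2 (T1 : measurableType d1)
    (T2 : measurableType d2) (X : Omega -> T1) (Y : Omega -> T2) :
  mutually_independent P G -> (forall j, j \in A -> j \notin B) ->
  measurable_fun (setT : set (g_sigma_algebraType (joint A))) X ->
  measurable_fun (setT : set (g_sigma_algebraType (joint B))) Y ->
  forall C D, measurable C -> measurable D ->
    P (X @^-1` C `&` Y @^-1` D) = P (X @^-1` C) * P (Y @^-1` D).
Proof.
move=> indG AB mX mY C D mC mD; apply: (joint_indep indG AB).
- by rewrite -[_ @^-1` _]setTI; exact: mX.
- by rewrite -[_ @^-1` _]setTI; exact: mY.
Qed.

Lemma joint_measurable_fun (A : {set J}) d1 (T1 : measurableType d1) (X : Omega -> T1) :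
  measurable_fun (setT : set (g_sigma_algebraType (joint A))) X ->
  measurable_fun setT X.
Proof. by move=> mX _ C mC; apply: (@joint_measurable A); exact: mX. Qed.

Lemma sub_joint_measurable_fun (A B : {set J}) d1 (T1 : measurableType d1)
    (X : Omega -> T1) : A \subset B ->
  measurable_fun (setT : set (g_sigma_algebraType (joint A))) X ->
  measurable_fun (setT : set (g_sigma_algebraType (joint B))) X.
Proof. by move=> AB mX _ C mC; apply: (sub_joint AB); exact: mX. Qed.

End Grouping.

Lemma generated_joint_measurable_fun {R : realType} {d : measure_display}
    {Omega : measurableType d} (J : finType) (G : J -> set (set Omega)) (A : {set J}) j
    d1 (T1 : measurableType d1) (X : Omega -> T1) :
  j \in A -> G j = preimage_set_system setT X measurable ->
  measurable_fun (setT : set (g_sigma_algebraType (joint G A))) X.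
Proof.
move=> jA GE _ C mC; apply: sub_sigma_algebra; exists j => //.
by rewrite GE; exists C.
Qed.

(** * Euclidean and Borel structure of column vectors *)

Section EuclideanGeometry.
Context {R : realType} {m : nat}.
Implicit Types (x y z : 'cV[R]_m) (a c : R).

Lemma dotvE x y : dotv x y = \sum_i x i 0 * y i 0.
Proof. by rewrite /dotv mxE; apply: eq_bigr => i _; rewrite mxE. Qed.

Lemma dotvC x y : dotv x y = dotv y x.
Proof. by rewrite !dotvE; apply: eq_bigr => i _; rewrite mulrC. Qed.

Lemma dotvDr x y z : dotv x (y + z) = dotv x y + dotv x z.
Proof. by rewrite /dotv mulmxDr mxE. Qed.

Lemma dotvDl x y z : dotv (y + z) x = dotv y x + dotv z x.
Proof. by rewrite dotvC dotvDr !(dotvC x). Qed.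

Lemma dotvZr a x y : dotv x (a *: y) = a * dotv x y.
Proof. by rewrite /dotv -scalemxAr mxE. Qed.

Lemma dotvZl a x y : dotv (a *: x) y = a * dotv x y.
Proof. by rewrite dotvC dotvZr dotvC. Qed.

Lemma dotvNr x y : dotv x (- y) = - dotv x y.
Proof. by rewrite -scaleN1r dotvZr mulN1r. Qed.

Lemma dotvNl x y : dotv (- x) y = - dotv x y.
Proof. by rewrite dotvC dotvNr dotvC. Qed.

Lemma dotvBr x y z : dotv x (y - z) = dotv x y - dotv x z.
Proof. by rewrite dotvDr dotvNr. Qed.

Lemma dotvBl x y z : dotv (y - z) x = dotv y x - dotv z x.
Proof. by rewrite dotvDl dotvNl. Qed.

Lemma dotv0 x : dotv x 0 = 0.
Proof. by rewrite /dotv mulmx0 mxE. Qed.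

Lemma dotv_ge0 x : 0 <= dotv x x.
Proof. by rewrite dotvE sumr_ge0// => i _; rewrite -expr2 sqr_ge0. Qed.

Lemma enorm_ge0 x : 0 <= enorm x.
Proof. exact: sqrtr_ge0. Qed.

Lemma enorm_sqr x : enorm x ^+ 2 = dotv x x.
Proof. by rewrite sqr_sqrtr// dotv_ge0. Qed.

Lemma enorm_sqrE x : enorm x ^+ 2 = \sum_i x i 0 ^+ 2.
Proof. by rewrite enorm_sqr dotvE; apply: eq_bigr => i _; rewrite expr2. Qed.

Lemma enormN x : enorm (- x) = enorm x.
Proof. by rewrite /enorm dotvNr dotvNl opprK. Qed.

Lemma enormBC x y : enorm (x - y) = enorm (y - x).
Proof. by rewrite -enormN opprB. Qed.

Lemma enormZ a x : enorm (a *: x) = `|a| * enorm x.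
Proof. by rewrite /enorm dotvZl dotvZr mulrA -expr2 sqrtrM ?sqr_ge0// sqrtr_sqr. Qed.

Lemma enorm0 : enorm (0 : 'cV[R]_m) = 0.
Proof. by rewrite /enorm dotv0 sqrtr0. Qed.

Lemma dotv_young c x y : 0 < c ->
  dotv x y <= enorm x ^+ 2 / (4 * c) + c * enorm y ^+ 2.
Proof.
move=> c0; rewrite !enorm_sqr !dotvE mulr_suml mulr_sumr -big_split/=.
apply: ler_sum => i _.
have -> : x i 0 * x i 0 / (4 * c) = x i 0 ^+ 2 / (4 * c) by rewrite expr2.
rewrite -subr_ge0 (_ : _ - _ = (x i 0 / (2 * c) - y i 0) ^+ 2 * c).
  by rewrite mulr_ge0 ?sqr_ge0 ?ltW.
by field; rewrite gt_eqF.
Qed.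

Lemma dotv_le_enorm x y : dotv x y <= enorm x * enorm y.
Proof.
have [y0|y0] := eqVneq (enorm y) 0.
  have yz : y = 0.
    apply/matrixP => i j; rewrite ord1 mxE; apply/eqP; rewrite -sqrf_eq0.
    have := enorm_sqrE y; rewrite y0 expr0n/= => /esym/eqP.
    by rewrite psumr_eq0 => [/allP/(_ i)|k _]; [rewrite mem_index_enum; apply|exact: sqr_ge0].
  by rewrite yz dotv0 enorm0 mulr0.
have y_gt0 : 0 < enorm y by rewrite lt_neqAle eq_sym y0 enorm_ge0.
have [x0|x0] := eqVneq (enorm x) 0.
  apply/ler_addgt0Pr => e e0; rewrite x0 mul0r add0r.
  have c0 : 0 < e / enorm y ^+ 2 by rewrite divr_gt0// exprn_gt0.
  apply: le_trans (dotv_young x y c0) _.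
  by rewrite x0 expr0n mul0r add0r divfK// sqrf_eq0.
have x_gt0 : 0 < enorm x by rewrite lt_neqAle eq_sym x0 enorm_ge0.
have c0 : 0 < enorm x / (2 * enorm y) by rewrite divr_gt0// mulr_gt0.
apply: le_trans (dotv_young x y c0) _.
rewrite le_eqVlt; apply/orP; left; apply/eqP; by field; rewrite x0 y0.
Qed.

Lemma dotv_le_enorm_norm x y : `|dotv x y| <= enorm x * enorm y.
Proof.
by rewrite ler_norml lerNl -dotvNl -(enormN x) dotv_le_enorm enormN dotv_le_enorm.
Qed.

Lemma enormD_sqr_le x y : enorm (x + y) ^+ 2 <= 2 * enorm x ^+ 2 + 2 * enorm y ^+ 2.
Proof.
rewrite !enorm_sqrE !mulr_sumr -big_split/=; apply: ler_sum => i _.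
by rewrite mxE; have := sqr_ge0 (x i 0 - y i 0); nra.
Qed.

Lemma norm_coord_le_enorm x i : `|x i 0| <= enorm x.
Proof.
rewrite -sqrtr_sqr ler_sqrt ?dotv_ge0// -enorm_sqr enorm_sqrE.
by rewrite (bigD1 i)//= lerDl sumr_ge0// => j _; exact: sqr_ge0.
Qed.

Lemma norm_le_enorm x : `|x| <= enorm x.
Proof.
rewrite -[`|x|]/(mx_norm x) mx_normrE; apply: bigmax_le => [|[i j] _ /=].
  exact: enorm_ge0.
by rewrite ord1 norm_coord_le_enorm.
Qed.

Lemma enorm_le_norm x : enorm x <= m%:R * `|x|.
Proof.
have n0 : 0 <= m%:R * `|x| by rewrite mulr_ge0.
rewrite -ler_sqr ?nnegrE ?enorm_ge0// enorm_sqrE.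
apply: le_trans (_ : \sum_(i < m) `|x| ^+ 2 <= _).
  apply: ler_sum => i _; rewrite -real_normK ?num_real// ler_sqr ?nnegrE//.
  rewrite -[leRHS]/(mx_norm x) mx_normrE.
  exact: (le_bigmax _ (fun ij : 'I_m * 'I_1 => `|x ij.1 ij.2|) (i, ord0)).
rewrite sumr_const card_ord -[leLHS]mulr_natl exprMn ler_wpM2r ?sqr_ge0//.
by rewrite -natrX ler_nat; case: (m) => // k; rewrite expnS leq_pmulr.
Qed.

Lemma enorm_eq0 x : enorm x = 0 -> x = 0.
Proof.
move=> x0; apply/matrixP => i j; rewrite ord1 mxE; apply/eqP.
by rewrite -normr_le0 -x0 norm_coord_le_enorm.
Qed.

End EuclideanGeometry.

Lemma norm_le_continuous {R : realType} {V W : normedModType R} (k : R) (h : V -> W) :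
  0 <= k -> (forall x y, `|h x - h y| <= k * `|x - y|) -> continuous h.
Proof.
move=> k0 hk x; have k1 : 0 < k + 1 by lra.
apply/cvgrPdist_lt => e e0; near=> y.
apply: le_lt_trans (hk x y) _.
have : ball x (e / (k + 1)) y by near: y; apply: nbhsx_ballx; exact: divr_gt0.
rewrite -ball_normE /ball_/=.
by rewrite ltr_pdivlMr//; have := normr_ge0 (x - y); nra.
Unshelve. all: by end_near. Qed.

Lemma dotv_continuous {R : realType} {m : nat} (v : 'cV[R]_m) : continuous (dotv v).
Proof.
apply: (@norm_le_continuous _ _ _ (enorm v * m%:R)) => [|x y].
  by rewrite mulr_ge0 ?enorm_ge0.
rewrite -dotvBr; apply: le_trans (dotv_le_enorm_norm _ _) _.
by rewrite -mulrA ler_wpM2l ?enorm_ge0// enorm_le_norm.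
Qed.

Section BorelVectors.
Context {R : realType} {m : nat}.
Local Notation V := 'cV[R]_m.

Lemma open_borel (A : set V) : open A -> measurable (A : set (borel V)).
Proof. exact: sub_sigma_algebra. Qed.

Lemma closed_borel (A : set V) : closed A -> measurable (A : set (borel V)).
Proof.
move=> cA; rewrite -[A]setCK; apply: measurableC; apply: open_borel; exact: closed_openC.
Qed.

Lemma continuous_borel (h : V -> R) :
  continuous h -> measurable_fun setT (h : borel V -> R).
Proof.
move=> /continuousP ch; apply: (measurability _ (RGenOpens.measurableE R)).
move=> _ [_ [a [c ->]] <-]; rewrite setTI; apply: open_borel.
exact/ch/interval_open.
Qed.

Lemma measurable_coord i : measurable_fun setT (fun x : borel V => (x : V) i 0).
Proof.
by apply: (@continuous_borel (fun x => x i 0)); exact: coord_continuous.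
Qed.

Let qbox (p : {ffun 'I_m -> rat} * rat) : set V :=
  [set y | forall i, `|y i 0 - ratr (p.1 i)| < ratr p.2].

Let open_qbox (A : set V) : open A ->
  A = \bigcup_(p in [set p | qbox p `<=` A]) qbox p.
Proof.
move=> oA; apply/seteqP; split => [x Ax|x [p pA px]]; last exact: pA.
have /nbhs_ballP[e /= e0 eA] : nbhs x A by exact: open_nbhs_nbhs.
(* With r below e / 2 and the rational centre within r of x, the box contains x and each of its
   points lies within 2 r < e of x. *)
have /rat_in_itvoo[r /andP[r0 re]] : 0 < e / 2 by rewrite divr_gt0.
have c_ex i : exists q : rat, `|x i 0 - ratr q| < ratr r.
  have /rat_in_itvoo[q] : x i 0 - ratr r < x i 0 + ratr r by rewrite ltrD2l gtrN.
  by rewrite in_itv /= => /andP[q1 q2]; exists q; rewrite ltr_norml; lra.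
have [c cP] := choice c_ex.
exists ([ffun i => c i], r) => [y /= yb|i /=]; last by rewrite ffunE.
apply: eA; split => // i j; rewrite ord1 /ball/= /ball_/=.
have := yb i; rewrite ffunE => yi; have := cP i; move: yi re.
rewrite !ltr_norml => /andP[y1 y2] /= re /andP[x1 x2].
by rewrite !bnd_simp in re; apply/andP; split; lra.
Qed.

Lemma measurable_borel d (T : measurableType d) (D : set T) (g : T -> borel V) :
  (forall i, measurable_fun D (fun w => (g w : V) i 0)) -> measurable_fun D g.
Proof.
move=> mg mD.
have mbox p : measurable (D `&` g @^-1` (qbox p)).
  rewrite (_ : _ `&` _ = D `&` \bigcap_(i in [set: 'I_m])
     (D `&` (fun w => (g w : V) i 0) @^-1` (ball (ratr (p.1 i) : R) (ratr p.2)))).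
    apply: measurableI => //; apply: fin_bigcap_measurable => // i _.
    by apply: mg => //; exact: measurable_ball.
  apply/seteqP; split => w [Dw] /= h; split => // i.
    by move=> _; split => //=; rewrite /ball/= distrC; exact: h.
  by have [_ /=] := h i Logic.I; rewrite /ball/= distrC.
apply: (@measurability _ _ _ _ D g (@open V)) => //.
move=> _ [A oA <-]; rewrite {1}(open_qbox oA) preimage_bigcup setI_bigcupr.
rewrite bigcup_mkcond; apply: countable_bigcupT_measurable => [|p].
  exact: (@countableP ({ffun 'I_m -> rat} * rat)%type setT).
by case: ifP.
Qed.

Lemma continuous_borel_vec k (Q : V -> 'cV[R]_k) : continuous Q ->
  measurable_fun setT (Q : borel V -> borel 'cV[R]_k).
Proof.
move=> /continuousP cQ; apply: (@measurability _ _ (borel V) (borel 'cV[R]_k) setT Q (@open 'cV[R]_k)) => //.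
by move=> _ [A oA <-]; rewrite setTI; apply: open_borel; exact: cQ.
Qed.

End BorelVectors.

(** * Gaussian moments *)

Section Density.
Local Open Scope ereal_scope.
Context {R : realType} {d : measure_display} {T : measurableType d}.
Variables (mu nu : {measure set T -> \bar R}) (p : T -> R).
Hypotheses (mp : measurable_fun setT p) (p0 : forall x, (0 <= p x)%R).
Hypothesis nuE : forall A, measurable A -> nu A = \int[mu]_(x in A) (p x)%:E.

Import HBNNSimple.

Let integral_density_nnsfun (f : {nnsfun T >-> R}) :
  \int[nu]_x (f x)%:E = \int[mu]_x ((f x)%:E * (p x)%:E).
Proof.
under eq_integral do rewrite fimfunE -fsumEFin//.
rewrite [LHS]ge0_integral_fsum//; last 2 first.
  - by move=> r; exact/measurable_EFinP/measurableT_comp.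
  - by move=> r x _; rewrite EFinM nnfun_muleindic_ge0.
under [RHS]eq_integral.
  move=> x _; rewrite fimfunE -fsumEFin// ge0_mule_fsuml; last first.
    by move=> r; rewrite EFinM nnfun_muleindic_ge0.
  over.
rewrite [RHS]ge0_integral_fsum//; last 2 first.
  - move=> r; apply: emeasurable_funM; last exact/measurable_EFinP.
    by apply/measurable_EFinP; apply/measurableT_comp.
  - move=> r x _; apply: mule_ge0; last by rewrite lee_fin.
    by rewrite EFinM nnfun_muleindic_ge0.
apply: eq_fsbigr => r _.
have [r0|r0] := ltP r 0%R.
  rewrite !integral0_eq// => x _; rewrite preimage_nnfun0// indic0/= mulr0 ?mul0e//.
under eq_integral do rewrite EFinM.
rewrite ge0_integralZl//; first last.
- exact/measurable_EFinP.
under [RHS]eq_integral do rewrite EFinM -muleA.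
rewrite [RHS]ge0_integralZl//; first last.
- by move=> x _; rewrite mule_ge0 ?lee_fin.
- by apply: emeasurable_funM; exact/measurable_EFinP.
congr (_ * _); rewrite integral_indic// setIT nuE// integral_mkcond.
apply: eq_integral => x _; rewrite patchE indicE.
by case: ifPn => _; rewrite (mul1e, mul0e).
Qed.

(** The normal law is given through its density. The change of measure is checked on simple
    functions and passes to the limit by monotone convergence on both sides. *)
Lemma ge0_integral_density (f : T -> \bar R) :
  measurable_fun setT f -> (forall x, 0 <= f x) ->
  \int[nu]_x f x = \int[mu]_x (f x * (p x)%:E).
Proof.
move=> mf f0; pose f_ := nnsfun_approx measurableT mf.
transitivity (lim (\int[nu]_x (f_ n x)%:E @[n --> \oo])).
  rewrite -monotone_convergence//=.
  - apply: eq_integral => x _; apply/esym/cvg_lim => //; exact: cvg_nnsfun_approx.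
  - by move=> n; exact/measurable_EFinP/measurable_funTS.
  - by move=> n x _; rewrite lee_fin.
  - by move=> x _ i j ij; rewrite lee_fin; exact/lefP/nd_nnsfun_approx.
rewrite (_ : (fun n => _) = fun n => \int[mu]_x ((f_ n x)%:E * (p x)%:E)); last first.
  by apply/funext => n; exact: integral_density_nnsfun.
rewrite -monotone_convergence//=.
- apply: eq_integral => x _; apply/cvg_lim => //.
  apply: cvgeZr => //; exact: cvg_nnsfun_approx.
- by move=> n; apply: emeasurable_funM; exact/measurable_EFinP.
- by move=> n x _; rewrite mule_ge0 ?lee_fin.
- move=> x _ i j ij; rewrite lee_wpmul2r ?lee_fin//.
  exact/lefP/nd_nnsfun_approx.
Qed.

End Density.

Section GaussianMoments.
Context {R : realType}.
Local Notation mu := (@lebesgue_measure R).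
Local Notation w := (normal_pdf 0 1 : R -> R).

Let wE (x : R) : w x = normal_peak 1 * expR (- x ^+ 2 / 2).
Proof.
by rewrite normal_pdfE ?oner_neq0// /normal_fun subr0 expr1n.
Qed.

Let w0 (x : R) : 0 <= w x. Proof. exact: normal_pdf_ge0. Qed.

Let cw : continuous w.
Proof. by apply: continuous_normal_pdf; exact: oner_neq0. Qed.

Let derive_w (x : R) : is_derive x 1 w (- x * w x).
Proof.
have -> : w = fun x => normal_peak 1 * expR (- x ^+ 2 / 2).
  by apply/funext => y; exact: wE.
apply: is_derive_eq.
rewrite !scaler0 add0r.
rewrite -[LHS]/(normal_peak 1 * (expR (- x ^+ 2 / 2) * (2^-1 * - (x * 1 + x * 1)))).
by field.
Qed.

Let wN (x : R) : w (- x) = w x.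
Proof. by rewrite !wE sqrrN. Qed.

Let mxw k : measurable_fun setT (fun x : R => (x ^+ k * w x)%:E).
Proof.
apply/measurable_EFinP; apply: measurable_funM; first exact: measurable_funX.
exact: measurable_normal_pdf.
Qed.

Let continuous_xw k : continuous (fun x : R => x ^+ k * w x).
Proof. by move=> x; apply: cvgM; [exact: exprn_continuous|exact: cw]. Qed.

Let derive_xw k (x : R) : is_derive x 1 (fun x => x ^+ k.+1 * w x)
  (k.+1%:R * x ^+ k * w x - x ^+ k.+2 * w x).
Proof.
have dw := derive_w x.
have dX : is_derive x 1 ((fun y : R => y) ^+ k.+1 : R -> R) ((k.+1%:R * x ^+ k) *: (1 : R)).
  exact: is_deriveX.
have -> : (fun x => x ^+ k.+1 * w x) = ((fun y : R => y) ^+ k.+1 * w : R -> R).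
  by apply/funext => y; rewrite mulrfctE exprfctE.
apply: is_derive_eq; rewrite exprfctE.
rewrite -[LHS]/(x ^+ k.+1 * (- x * w x) + w x * (k.+1%:R * x ^+ k * 1)).
by rewrite !exprS; ring.
Qed.

(** A single term of the exponential series suffices: expR (x^2 / 2) is at least (x^2 / 2)^(k+1) /
    (k+1)!, whence x^k w(x) <= K / x for x >= 1. *)
Let cvg_xw k : (x ^+ k * w x : R) @[x --> +oo%R] --> (0 : R).
Proof.
pose K : R := normal_peak 1 * (2 ^+ k.+1 * k.+1`!%:R).
have K0 : 0 <= K by rewrite mulr_ge0 ?normal_peak_ge0// mulr_ge0// exprn_ge0.
apply/cvgrPdist_le => e e0; near=> x.
have x1 : 1 <= x by near: x; exact: nbhs_pinfty_ge.
have x0 : 0 < x by exact: lt_le_trans x1.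
rewrite sub0r normrN ger0_norm; last by rewrite mulr_ge0 ?exprn_ge0 ?w0// ltW.
have Kx : K <= e * x.
  rewrite mulrC -ler_pdivrMr//; near: x; exact: nbhs_pinfty_ge.
suff : x ^+ k * w x <= K / x by move=> /le_trans; apply; rewrite ler_pdivrMr.
rewrite wE mulrCA /K -mulrA ler_wpM2l ?normal_peak_ge0//.
rewrite mulNr expRN ler_pdivrMr ?expR_gt0// -ler_pdivrMl.
  apply: le_trans (expR_ge1Dxn k _); last by rewrite divr_ge0// sqr_ge0.
  rewrite expr_div_n -exprM.
  have xk : x ^+ k * x <= x ^+ (2 * k.+1).
    by rewrite -exprSr ler_weXn2l// leq_pmull.
  have f0 : (0 : R) < k.+1`!%:R by rewrite ltr0n fact_gt0.
  rewrite invf_div invfM !mulrA -[leLHS]add0r lerD//.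
  rewrite mulrAC ler_pM2r ?invr_gt0// mulrAC ler_pM2r ?invr_gt0 ?exprn_gt0//.
  by rewrite mulrC.
by rewrite divr_gt0// mulr_gt0 ?exprn_gt0// ltr0n fact_gt0.
Unshelve. all: by end_near. Qed.

Let I k : \bar R := \int[mu]_(x in `[0%R, +oo[) (x ^+ k * w x)%:E.

Let I0 : I 0 = 2^-1%:E.
Proof.
have := integral_normal_pdf (0 : R) 1.
rewrite ge0_symfun_integralT//; last by move=> x; rewrite /= wN.
rewrite -set_itvcy /I => h.
under eq_integral do rewrite expr0 mul1r.
move: h; case: (integral _ _ _) => [r /eqP| |] //=.
- by rewrite -EFinM eqe => /eqP h; congr EFin; lra.
- by rewrite mulry gtr0_sg// mul1e.
- by rewrite mulrNy gtr0_sg// mul1e.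
Qed.

Let I1 : I 1 = (w 0)%:E.
Proof.
rewrite /I (@ge0_continuous_FTC2y _ _ (fun x => - w x) 0 0).
- by rewrite sub0e -EFinN opprK.
- by move=> x x0; rewrite mulr_ge0 ?exprn_ge0.
- exact/continuous_subspaceT/continuous_xw.
- have wx : (fun x => x ^+ 0 * w x) = w by apply/funext => x; rewrite mul1r.
  by have h := cvgN (cvg_xw 0); rewrite wx oppr0 in h; exact: h.
- by move=> x _; apply: derivableN; exact: (@ex_derive _ _ _ _ _ _ _ (derive_w x)).
- by apply: cvgN; apply: cvg_at_right_filter; exact: cw.
- move=> x _; rewrite derive1E; have dw := derive_w x.
  by rewrite derive_val expr1 mulNr opprK.
Qed.

(** Integration by parts. The derivative (k+1) x^k w - x^(k+2) w of x^(k+1) w changes sign exactly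
    at c = sqrt (k+1). Splitting there gives an integrand of constant sign on each piece, so the
    fundamental theorem applies before any moment is known to be finite, and the boundary term [t]
    moves from one piece to the other. *)
Let I_rec k : (I k.+2 = (k.+1%:R)%:E * I k)%E.
Proof.
pose c : R := Num.sqrt k.+1%:R.
have c2 : c ^+ 2 = k.+1%:R by rewrite sqr_sqrtr.
have c0 : 0 < c by rewrite sqrtr_gt0.
have split_I j : I j = (\int[mu]_(x in `[0%R, c]) (x ^+ j * w x)%:E +
    \int[mu]_(x in `[c, +oo[) (x ^+ j * w x)%:E)%E.
  rewrite /I -(@integral_itv_obnd_cbnd _ c (BInfty _ false))//; last first.
    apply: measurable_funTS; exact: mxw.
  rewrite -ge0_integral_setU//=.
  - congr integral; rewrite -itv_bndbnd_setU// bnd_simp; exact: ltW.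
  - apply: measurable_funTS; exact: mxw.
  - move=> x [|]; rewrite /= in_itv/= => /andP[x0 _]; rewrite lee_fin mulr_ge0// exprn_ge0//.
    by rewrite (le_trans (ltW c0))// ltW.
  - apply/disj_setPLR => x /=; rewrite !in_itv/= => /andP[x0 xc].
    by rewrite andbT ltNge xc.
pose t := (c ^+ k.+1 * w c)%:E.
have lo : (\int[mu]_(x in `[0%R, c]) (k.+1%:R * (x ^+ k * w x))%:E =
    \int[mu]_(x in `[0%R, c]) (x ^+ k.+2 * w x)%:E + t)%E.
  pose g (x : R) := k.+1%:R * x ^+ k * w x - x ^+ k.+2 * w x.
  have cg : continuous g.
    move=> x; apply: cvgB; last exact: continuous_xw.
    apply: cvgM; last exact: cw.
    by apply: cvgM; [exact: cvg_cst|exact: exprn_continuous].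
  have <- : (\int[mu]_(x in `[0%R, c]) (g x)%:E = t)%E.
    rewrite (@continuous_FTC2 _ g (fun x => x ^+ k.+1 * w x) 0 c c0).
    - by rewrite expr0n/= mul0r sube0.
    - exact/continuous_subspaceT.
    - split; first by move=> x _; exact: (@ex_derive _ _ _ _ _ _ _ (derive_xw k x)).
        by apply: cvg_at_right_filter; exact: continuous_xw.
      by apply: cvg_at_left_filter; exact: continuous_xw.
    - by move=> x _; rewrite derive1E; have dw := derive_xw k x; rewrite derive_val.
  rewrite -ge0_integralD//=.
  - by apply: eq_integral => x _; rewrite -EFinD /g addrCA subrr addr0 mulrA.
  - by move=> x; rewrite /= in_itv/= => /andP[x0 _]; rewrite lee_fin mulr_ge0 ?exprn_ge0.
  - apply: measurable_funTS; exact: mxw.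
  - move=> x; rewrite /= in_itv/= => /andP[x0 xc]; rewrite lee_fin /g -mulrBl mulr_ge0//.
    rewrite !exprS mulrA -expr2 -mulrBl mulr_ge0 ?exprn_ge0// subr_ge0 -c2.
    by rewrite ler_sqr ?nnegrE// ltW.
  - by apply/measurable_EFinP; apply: measurable_funTS; exact: continuous_measurable_fun.
have hi : (\int[mu]_(x in `[c, +oo[) (x ^+ k.+2 * w x)%:E =
    t + \int[mu]_(x in `[c, +oo[) (k.+1%:R * (x ^+ k * w x))%:E)%E.
  pose g (x : R) := x ^+ k.+2 * w x - k.+1%:R * x ^+ k * w x.
  have cg : continuous g.
    move=> x; apply: cvgB; first exact: continuous_xw.
    apply: cvgM; last exact: cw.
    by apply: cvgM; [exact: cvg_cst|exact: exprn_continuous].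
  have g0 x : c <= x -> 0 <= g x.
    move=> cx; have x0 : 0 <= x by rewrite (le_trans (ltW c0)).
    rewrite /g -mulrBl mulr_ge0// !exprS mulrA -expr2 -mulrBl mulr_ge0 ?exprn_ge0//.
    by rewrite subr_ge0 -c2 ler_sqr ?nnegrE// ltW.
  have <- : (\int[mu]_(x in `[c, +oo[) (g x)%:E = t)%E.
    rewrite (@ge0_continuous_FTC2y _ g (fun x => - (x ^+ k.+1 * w x)) c 0).
    - by rewrite sub0e -EFinN opprK.
    - exact: g0.
    - exact/continuous_subspaceT.
    - by have h := cvgN (cvg_xw k.+1); rewrite oppr0 in h; exact: h.
    - by move=> x _; apply: derivableN; exact: (@ex_derive _ _ _ _ _ _ _ (derive_xw k x)).
    - by apply: cvgN; apply: cvg_at_right_filter; exact: continuous_xw.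
    - move=> x _; rewrite derive1E; have dw := derive_xw k x.
      by rewrite derive_val opprB.
  rewrite -ge0_integralD//=.
  - by apply: eq_integral => x _; rewrite -EFinD /g mulrA subrK.
  - by move=> x; rewrite /= in_itv/= andbT => /g0; rewrite lee_fin.
  - by apply/measurable_EFinP; apply: measurable_funTS; exact: continuous_measurable_fun.
  - move=> x; rewrite /= in_itv/= andbT => cx; rewrite lee_fin !mulr_ge0 ?exprn_ge0//.
    by rewrite (le_trans (ltW c0)).
  - apply/measurable_EFinP/measurable_funTS; apply: measurable_funM => //.
    by apply/measurable_EFinP; exact: mxw.
rewrite (split_I k.+2) (split_I k) hi addeA -lo ge0_muleDr; first last.
- apply: integral_ge0 => x; rewrite /= in_itv/= andbT => cx.
  by rewrite lee_fin mulr_ge0 ?exprn_ge0// (le_trans (ltW c0)).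
- apply: integral_ge0 => x; rewrite /= in_itv/= => /andP[x0 _].
  by rewrite lee_fin mulr_ge0 ?exprn_ge0.
under eq_integral do rewrite EFinM.
under [X in (_ + X = _)%E]eq_integral do rewrite EFinM.
rewrite !ge0_integralZl//.
- apply: measurable_funTS; exact: mxw.
- move=> x; rewrite /= in_itv/= andbT => cx.
  by rewrite lee_fin mulr_ge0 ?exprn_ge0// (le_trans (ltW c0)).
- apply: measurable_funTS; exact: mxw.
- move=> x; rewrite /= in_itv/= => /andP[x0 _].
  by rewrite lee_fin mulr_ge0 ?exprn_ge0.
Qed.

Let I_fin k : (I k < +oo)%E.
Proof.
have [m] := ubnP k; elim: m k => // m IH [|[|k]].
- by rewrite I0 ltry.
- by rewrite I1 ltry.
- rewrite !ltnS => km; rewrite I_rec; apply: lte_mul_pinfty => //.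
  by apply: IH; exact: leq_trans km.
Qed.

Local Notation N01 := (normal_prob (0 : R) 1).

Let normal_density (f : R -> \bar R) :
  measurable_fun setT f -> (forall x, 0 <= f x)%E ->
  (\int[N01]_x f x = \int[mu]_x (f x * (w x)%:E))%E.
Proof.
by move=> mf f0; apply: ge0_integral_density => //; exact: measurable_normal_pdf.
Qed.

Let normal_absX k :
  (\int[N01]_x (`|x| ^+ k)%:E = 2%:E * I k)%E.
Proof.
rewrite normal_density//; last first.
  by apply/measurable_EFinP; apply: measurable_funX; exact: normr_measurable.
under eq_integral do rewrite -EFinM.
rewrite ge0_symfun_integralT.
- rewrite -set_itvcy /I; congr (_ * _)%E; apply: eq_integral => x.
  by rewrite inE/= in_itv/= andbT => x0; rewrite ger0_norm.
- by move=> x; rewrite mulr_ge0 ?exprn_ge0.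
- move=> x; apply: cvgM; last exact: cw.
  apply: (@cvg_comp _ _ _ (fun x : R => `|x|) (fun x => x ^+ k)); last exact: exprn_continuous.
  exact: norm_continuous.
- by move=> x; rewrite /= normrN wN.
Qed.

Lemma integrable_normalX k : N01.-integrable setT (fun x => (x ^+ k)%:E).
Proof.
apply/integrableP; split; first by apply/measurable_EFinP; exact: measurable_funX.
under eq_integral do rewrite /= normrX.
by rewrite normal_absX; apply: lte_mul_pinfty.
Qed.

Lemma normal_moment_even k : (\int[N01]_x (x ^+ k.+1.*2)%:E =
  (k.*2.+1)%:R%:E * \int[N01]_x (x ^+ k.*2)%:E)%E.
Proof.
have absE j : (\int[N01]_x (x ^+ j.*2)%:E = 2%:E * I j.*2)%E.
  rewrite -normal_absX; apply: eq_integral => x _.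
  by rewrite -mul2n !exprM real_normK// num_real.
by rewrite !absE doubleS I_rec muleCA.
Qed.

(** The positive and negative parts are integrable, and the reflection x -> -x exchanges their
    integrals because the density is even. *)
Lemma normal_moment1 : (\int[N01]_x x%:E = 0)%E.
Proof.
pose p (x : R) := Num.max x 0; pose q (x : R) := Num.max (- x) 0.
have mp : measurable_fun setT p by apply: measurable_maxr.
have mq : measurable_fun setT q by apply: measurable_maxr => //; exact: measurableT_comp.
have p0 x : 0 <= p x by rewrite /p le_max lexx orbT.
have q0 x : 0 <= q x by rewrite /q le_max lexx orbT.
have pE x : (x : R)%:E = ((p x)%:E - (q x)%:E)%E.
  rewrite -EFinB /p /q /Num.max; congr EFin.
  by rewrite oppr_lt0; case: ltrgtP => //; lra.
have ip : N01.-integrable setT (EFin \o p).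
  apply: le_integrable (integrable_normalX 1) => //; first exact/measurable_EFinP.
  move=> x _; rewrite /= lee_fin expr1 ger0_norm// /p.
  by rewrite ge_max normr_ge0 ler_norm.
have iq : N01.-integrable setT (EFin \o q).
  apply: le_integrable (integrable_normalX 1) => //; first exact/measurable_EFinP.
  move=> x _; rewrite /= lee_fin expr1 ger0_norm// /q.
  by rewrite ge_max normr_ge0 -normrN ler_norm.
under eq_integral do rewrite pE.
rewrite integralB//.
suff -> : (\int[N01]_x (q x)%:E = \int[N01]_x (p x)%:E)%E.
  by rewrite subee//; exact: integrable_fin_num.
rewrite !normal_density//; first last.
- exact/measurable_EFinP.
- exact/measurable_EFinP.
pose gp x := p x * w x; pose gq x := q x * w x.
have cmax (h : R -> R) : continuous h -> continuous (fun x => Num.max (h x) 0).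
  move=> ch x; apply: (@cvg_comp _ _ _ h (fun y => Num.max y 0) _ (nbhs (h x))); first exact: ch.
  have -> : (fun y => Num.max y 0) = (fun y : R => (y + `|y|) / 2).
    by apply/funext => y; rewrite maxr_absE subr0 addr0.
  rewrite maxr_absE subr0 addr0.
  apply: cvgM; last exact: cvg_cst.
  by apply: cvgD => //; exact: norm_continuous.
have cgq : continuous gq.
  move=> x; apply: cvgM; last exact: cw.
  by apply: (cmax -%R) => y; exact: opp_continuous.
(* [gq] vanishes on the positive half-line, so the restriction loses nothing; the endpoint is
   written [- 0] to fit the substitution rule. *)
transitivity (\int[mu]_(x in `]-oo, (- 0)%R]) (gq x)%:E)%E.
  rewrite [RHS]integral_mkcond; apply: eq_integral => x _.
  rewrite patchE oppr0; case: ifPn; rewrite -EFinM//.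
  rewrite notin_setE/= in_itv/= => /negP; rewrite -ltNge => x0.
  by rewrite /q max_r ?mul0r// oppr_le0 ltW.
rewrite (@ge0_integration_by_substitutionNy _ gq 0); first last.
- by move=> x _; rewrite mulr_ge0.
- exact/continuous_subspaceT.
rewrite [LHS]integral_mkcond; apply: eq_integral => x _.
rewrite patchE/=; case: ifPn; first by rewrite /gq /q opprK wN EFinM.
rewrite notin_setE/= in_itv/= andbT => /negP; rewrite -ltNge => x0.
by rewrite -EFinM /p max_r ?mul0r// ltW.
Qed.

Lemma normal_moment0 : (\int[N01]_x (x ^+ 0)%:E = 1)%E.
Proof.
under eq_integral do rewrite expr0.
by rewrite integral_cst//= mul1e; exact: probability_setT.
Qed.

End GaussianMoments.

(** * Calculus of finite expectations *)

Section HasMean.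
Context {R : realType} {d : measure_display} {Omega : measurableType d}.
Variable P : probability Omega R.
Implicit Types (X Y : Omega -> R) (a b c : R).

(** Integrability and the value are carried together, as a relation to a real number, so that moment
    computations take place in R rather than in the extended reals. *)
Definition has_mean X a : Prop :=
  P.-integrable setT (EFin \o X) /\ (\int[P]_w (X w)%:E = a%:E)%E.

Lemma has_mean_measurable X a : has_mean X a -> measurable_fun setT X.
Proof. by move=> [iX _]; apply/measurable_EFinP; exact: measurable_int iX. Qed.

Lemma eq_has_mean X Y a : X =1 Y -> has_mean X a -> has_mean Y a.
Proof. by move=> /funext ->. Qed.

Lemma has_mean_uniq X a b : has_mean X a -> has_mean X b -> a = b.
Proof. by move=> [_ EX] [_]; rewrite EX => -[]. Qed.

Lemma integrable_has_mean X : P.-integrable setT (EFin \o X) -> exists a, has_mean X a.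
Proof.
move=> iX; exists (fine (\int[P]_w (X w)%:E)); split=> //.
by rewrite fineK//; exact: integrable_fin_num iX.
Qed.

Lemma has_mean_cst c : has_mean (fun=> c) c.
Proof.
split; last by rewrite integral_cst//= probability_setT mule1.
exact: finite_measure_integrable_cst.
Qed.

Lemma has_meanD X Y a b : has_mean X a -> has_mean Y b ->
  has_mean (fun w => X w + Y w) (a + b).
Proof.
move=> [iX EX] [iY EY]; split; first exact: (integrableD measurableT iX iY).
under eq_integral do rewrite EFinD.
by rewrite integralD// EX EY.
Qed.

Lemma has_meanZ X a c : has_mean X a -> has_mean (fun w => c * X w) (c * a).
Proof.
move=> [iX EX]; split; first by apply: (integrableZl _ c) iX.
under eq_integral do rewrite EFinM.
by rewrite integralZl// EX.
Qed.

Lemma has_meanN X a : has_mean X a -> has_mean (fun w => - X w) (- a).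
Proof.
move=> /(has_meanZ (-1)); rewrite mulN1r; apply: eq_has_mean => w.
by rewrite mulN1r.
Qed.

Lemma has_meanB X Y a b : has_mean X a -> has_mean Y b ->
  has_mean (fun w => X w - Y w) (a - b).
Proof. by move=> hX /has_meanN hY; exact: has_meanD. Qed.

Lemma has_mean_sum (I : Type) (s : seq I) (X : I -> Omega -> R) (a : I -> R) :
  (forall i, has_mean (X i) (a i)) ->
  has_mean (fun w => \sum_(i <- s) X i w) (\sum_(i <- s) a i).
Proof.
move=> h; elim: s => [|i s IH].
  by rewrite big_nil; apply: eq_has_mean (has_mean_cst 0) => w; rewrite big_nil.
rewrite big_cons; apply: eq_has_mean (has_meanD (h i) IH) => w.
by rewrite big_cons.
Qed.

Lemma has_mean_ae X Y a : measurable_fun setT Y -> {ae P, forall w, X w = Y w} ->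
  has_mean X a -> has_mean Y a.
Proof.
move=> mY XY [iX EX].
have XYE : ae_eq P setT (EFin \o X) (EFin \o Y).
  by move: XY; apply: filterS => w /= -> _.
split.
  have [mX' iX'] := integrableP _ _ _ iX; apply/integrableP.
  split; first exact/measurable_EFinP.
  rewrite (_ : \int[P]_w _ = \int[P]_w `|(EFin \o X) w|)%E//.
  apply: ae_eq_integral => //; [exact/measurableT_comp/measurable_EFinP|
    exact: measurableT_comp|exact/ae_eq_abse/ae_eq_sym].
by rewrite -EX; apply/esym/ae_eq_integral => //;
  [exact: measurable_int iX|exact/measurable_EFinP].
Qed.

Lemma ae_le_has_mean X Y a b : has_mean X a -> has_mean Y b ->
  {ae P, forall w, X w <= Y w} -> a <= b.
Proof.
move=> hX hY XY; have hYX := has_meanB hY hX.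
rewrite -subr_ge0.
have mpos : measurable_fun setT (fun w => Num.max (Y w - X w) 0).
  by apply: measurable_maxr => //; exact: has_mean_measurable hYX.
have [_ E] : has_mean (fun w => Num.max (Y w - X w) 0) (b - a).
  apply: has_mean_ae hYX => //; move: XY; apply: filterS => w /=.
  by rewrite -subr_ge0 => /max_l ->.
by rewrite -lee_fin -E; apply: integral_ge0 => w _; rewrite lee_fin le_max lexx orbT.
Qed.

Lemma le_has_mean X Y a b : has_mean X a -> has_mean Y b ->
  (forall w, X w <= Y w) -> a <= b.
Proof. by move=> hX hY XY; apply: ae_le_has_mean hX hY _; exact: aeW. Qed.

Lemma ae_norm_le_has_mean X Y b : measurable_fun setT X -> has_mean Y b ->
  {ae P, forall w, `|X w| <= Y w} -> exists a, has_mean X a.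
Proof.
move=> mX [iY _] XY; apply: integrable_has_mean.
apply/integrableP; split; first exact/measurable_EFinP.
apply: le_lt_trans (proj2 (integrableP _ _ _ iY)).
apply: ae_ge0_le_integral => //.
- by apply/measurableT_comp => //; exact/measurable_EFinP.
- by apply/measurableT_comp => //; exact: measurable_int iY.
- move: XY; apply: filterS => w /= XY _.
  by rewrite lee_fin (le_trans XY)// ler_norm.
Qed.

Lemma ge0_has_mean X c : measurable_fun setT X -> (forall w, 0 <= X w) ->
  (\int[P]_w (X w)%:E <= c%:E)%E -> exists2 a, has_mean X a & a <= c.
Proof.
move=> mX X0 Xc; have [|a hX] := @integrable_has_mean X.
  apply/integrableP; split; first exact/measurable_EFinP.
  under eq_integral do rewrite /= ger0_norm//.
  by rewrite (le_lt_trans Xc)// ltry.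
by exists a => //; case: hX => _ EX; move: Xc; rewrite EX lee_fin.
Qed.

(** A mean exists because |X| <= 1 + X^2; the inequality is the expansion of E (X - c)^2 >= 0. *)
Lemma sqr_has_mean X a : measurable_fun setT X ->
  has_mean (fun w => X w ^+ 2) a -> exists2 c, has_mean X c & c ^+ 2 <= a.
Proof.
move=> mX hX.
have [|c hc] := ae_norm_le_has_mean mX (has_meanD (has_mean_cst 1) hX).
  apply: aeW => w; rewrite -(@real_normK _ (X w))// ?num_real//.
  by have := sqr_ge0 (`|X w| - 1); nra.
exists c => //; rewrite -subr_ge0.
apply: (@le_has_mean (fun=> 0) (fun w => (X w - c) ^+ 2)); first exact: has_mean_cst.
  have -> : a - c ^+ 2 = a - (2 * c) * c + c ^+ 2 by ring.
  apply: eq_has_mean (has_meanD (has_meanB hX (has_meanZ (2 * c) hc)) (has_mean_cst _)) => w.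
  by ring.
by move=> w; exact: sqr_ge0.
Qed.

Lemma has_mean_markov X a t : has_mean X a -> (forall w, 0 <= X w) -> 0 < t ->
  (P [set w | (t <= X w)%R] <= (a / t)%:E)%E.
Proof.
move=> hX X0 t0; have mX := has_mean_measurable hX.
have mA : measurable [set w | t <= X w].
  rewrite (_ : [set _ | _] = setT `&` [set w | t%:E <= (X w)%:E]%E); last first.
    by rewrite setTI; apply/seteqP; split => w /=; rewrite lee_fin.
  by apply: emeasurable_fun_c_infty => //; exact/measurable_EFinP.
rewrite EFinM muleC lee_pdivlMl//; case: hX => iX <-.
rewrite -(setIT [set w | _]) -integral_indic// -ge0_integralZl//; last 2 first.
- exact/measurable_EFinP.
- by rewrite lee_fin ltW.
apply: ge0_le_integral => //.
- by move=> w _; rewrite mule_ge0 ?lee_fin// ltW.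
- by apply: measurable_funeM; exact/measurable_EFinP.
- exact: measurable_int iX.
- move=> w _; rewrite -EFinM lee_fin indicE; case: (boolP (_ \in _)).
    by rewrite inE/= mulr1.
  by rewrite mulr0.
Qed.

End HasMean.

Section IndependentMeans.
Context {R : realType} {d : measure_display} {Omega : measurableType d}.
Variable P : probability Omega R.
Variables (J : finType) (G : J -> set (set Omega)).
Hypotheses (GI : forall j, setI_closed (G j)) (GT : forall j, G j setT).
Hypothesis Gm : forall j, G j `<=` measurable.
Hypothesis indG : mutually_independent P G.
Local Notation sub A := (g_sigma_algebraType (joint G A)).

Lemma has_mean_indepM (A B : {set J}) (X Y : Omega -> R) a b :
  (forall j, j \in A -> j \notin B) ->
  measurable_fun (setT : set (sub A)) X -> measurable_fun (setT : set (sub B)) Y ->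
  has_mean P X a -> has_mean P Y b -> has_mean P (fun w => X w * Y w) (a * b).
Proof.
move=> AB mX mY [iX EX] [iY EY].
have ind := joint_indep_preimage GI GT Gm indG AB mX mY.
split; first exact: integrable_indepM.
by rewrite expectation_indepM// EX EY.
Qed.

Lemma has_mean_indep_prod (Y : J -> Omega -> R) (a : J -> R) :
  (forall j, measurable_fun (setT : set (sub [set j]%SET)) (Y j)) ->
  (forall j, has_mean P (Y j) (a j)) ->
  has_mean P (fun w => \prod_j Y j w) (\prod_j a j).
Proof.
move=> mY hY.
suff H s : uniq s -> has_mean P (fun w => \prod_(j <- s) Y j w) (\prod_(j <- s) a j).
  exact/H/index_enum_uniq.
elim: s => [_|j s IH /= /andP[js us]].
  rewrite big_nil; apply: eq_has_mean (has_mean_cst P 1) => w.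
  by rewrite big_nil.
rewrite big_cons.
apply: eq_has_mean (_ : has_mean P (fun w => Y j w * \prod_(j <- s) Y j w) _).
  by move=> w; rewrite big_cons.
apply: (@has_mean_indepM [set j]%SET [set:: s]%SET) => //; last exact: IH.
  by move=> i; rewrite !finset.inE => /eqP ->.
apply: measurable_prod => i si.
apply: sub_joint_measurable_fun (mY i).
by apply/fintype.subsetP => k; rewrite !finset.inE => /eqP ->.
Qed.

End IndependentMeans.

(** * Mixed moments of standard Gaussian vectors *)

Section GaussianVectors.
Context {R : realType} {d : measure_display} {Omega : measurableType d}.
Variable P : probability Omega R.
Variables (m : nat) (u : Omega -> borel 'cV[R]_m).
Hypothesis gauss_u : std_gaussian P u.

Local Notation U j w := ((u w : 'cV[R]_m) j 0).

Let mU j : measurable_fun setT (fun w => U j w).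
Proof. by apply: (measurableT_comp (measurable_coord j)); case: gauss_u. Qed.

Let law1 (j : 'I_m) (A : set (measurableTypeR R)) : measurable A ->
  P [set w | A (U j w)] = normal_prob (0 : R) 1 A.
Proof.
move=> mA; case: gauss_u => _ /(_ (fun i => if i == j then A else setT)).
have mif i : measurable (if i == j then A else setT : set (measurableTypeR R)).
  by case: ifP.
move=> /(_ mif); rewrite (bigD1 j)//= eqxx big1 ?mule1; last first.
  by move=> i /negbTE ->; exact: probability_setT.
move=> <-; congr (P _); apply/seteqP; split => w /=; last by move=> /(_ j); rewrite eqxx.
by move=> Aw i; case: eqP => // ->.
Qed.

Let GU j := preimage_set_system setT (fun w => U j w) (@measurable _ (measurableTypeR R)).

Let GUI j : setI_closed (GU j).
Proof.
move=> _ _ [A mA <-] [B mB <-]; exists (A `&` B); first exact: measurableI.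
by rewrite !setTI.
Qed.

Let GUT j : GU j setT.
Proof. by exists setT => //; rewrite setTI. Qed.

Let GUm j : GU j `<=` measurable.
Proof. by move=> _ [A mA <-]; exact: mU. Qed.

(** The law is prescribed on full rectangles only; a subfamily is reached by taking [setT] for the
    coordinates outside [K]. *)
Let indepU : mutually_independent P GU.
Proof.
move=> K A GA.
have exB j : exists C : set (measurableTypeR R), measurable C /\
    if j \in K then A j = [set w | C (U j w)] else C = setT.
  have [jK|jK] := boolP (j \in K); last by exists setT.
  by have [C mC <-] := GA j jK; exists C; rewrite setTI.
have [B BP] := choice exB.
have mB j : measurable (B j) by case: (BP j).
transitivity (P [set w | forall j, B j (U j w)]).
  congr (P _); apply/seteqP; split => w /= h j.
    case: (BP j) => _; case: ifPn => [jK AE|_ ->//].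
    by have := h j jK; rewrite AE.
  by move=> jK; case: (BP j) => _; rewrite jK => ->; exact: h.
case: gauss_u => _ ->//; rewrite (bigID [in K])/= [X in (_ * X)%E]big1 ?mule1.
  by apply: eq_bigr => j jK; case: (BP j) => _; rewrite jK => ->; rewrite law1.
move=> j /negbTE jK; case: (BP j) => _; rewrite jK => ->; exact: probability_setT.
Qed.

Definition normal_moment k : R := fine (\int[normal_prob (0 : R) 1]_x (x ^+ k)%:E)%E.

Let EFin_moment k : (normal_moment k)%:E = (\int[normal_prob (0 : R) 1]_x (x ^+ k)%:E)%E.
Proof. by rewrite fineK//; apply: integrable_fin_num => //; exact: integrable_normalX. Qed.

Let moment_even k : normal_moment k.+1.*2 = k.*2.+1%:R * normal_moment k.*2.
Proof. by apply: EFin_inj; rewrite EFinM !EFin_moment normal_moment_even. Qed.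

Let moment0 : normal_moment 0 = 1.
Proof. by apply: EFin_inj; rewrite EFin_moment normal_moment0. Qed.

Let moment1 : normal_moment 1 = 0.
Proof. by apply: EFin_inj; rewrite EFin_moment normal_moment1. Qed.

Let moment2 : normal_moment 2 = 1.
Proof. by rewrite (moment_even 0) moment0 mulr1. Qed.

Let moment4 : normal_moment 4 = 3.
Proof. by rewrite (moment_even 1) moment2 mulr1. Qed.

Let moment6 : normal_moment 6 = 15.
Proof. by rewrite (moment_even 2) moment4 -natrM. Qed.

Let coordX_mean j k : has_mean P (fun w => U j w ^+ k) (normal_moment k).
Proof.
pose D := distribution P (@mfun_of _ _ Omega (measurableTypeR R) _ (mU j)).
have lawE (A : set (measurableTypeR R)) : measurable A -> A `<=` setT ->
    D A = normal_prob (0 : R) 1 A.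
  by move=> mA _; rewrite -(law1 j).
have mX : measurable_fun setT (fun x : measurableTypeR R => (x ^+ k)%:E).
  by apply/measurable_EFinP; exact: measurable_funX.
have iX : P.-integrable setT (EFin \o (fun w => U j w ^+ k)).
  apply/integrableP; split; first by apply/measurable_EFinP; exact: measurable_funX.
  have /integrableP[_] := integrable_normalX k (R := R).
  rewrite -(@eq_measure_integral _ _ _ _ (normal_prob 0 1) D _ lawE).
  by rewrite ge0_integral_distribution//; exact: measurableT_comp.
split => //; rewrite EFin_moment.
rewrite -(@eq_measure_integral _ _ _ _ (normal_prob 0 1) D _ lawE).
by rewrite integral_distribution.
Qed.

Lemma gaussian_monomial_mean (e : 'I_m -> nat) :
  has_mean P (fun w => \prod_j U j w ^+ e j) (\prod_j normal_moment (e j)).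
Proof.
apply: (has_mean_indep_prod GUI GUT GUm indepU) => j; last exact: coordX_mean.
apply: measurable_funX.
by apply: (@generated_joint_measurable_fun R _ _ _ _ _ j); rewrite ?finset.inE.
Qed.

Let prodX1 i w : \prod_j U j w ^+ (j == i) = U i w.
Proof.
rewrite (bigD1 i)//= eqxx expr1 big1 ?mulr1// => l /negbTE ->.
by rewrite expr0.
Qed.

Lemma gaussian_covariance i j : has_mean P (fun w => U i w * U j w) (i == j)%:R.
Proof.
(* The exponent of coordinate l in a monomial is the number of occurrences of l among its indices;
   the next two moments are encoded in the same way. *)
have -> : (i == j)%:R = \prod_l normal_moment ((l == i) + (l == j)).
  case: (eqVneq i j) => [<-|ij].
    rewrite (bigD1 i)//= eqxx moment2 big1 ?mulr1// => l /negbTE ->.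
    exact: moment0.
  by rewrite (bigD1 i)//= eqxx (negbTE ij) moment1 mul0r.
apply: eq_has_mean (gaussian_monomial_mean _) => w.
by rewrite -(prodX1 i) -(prodX1 j) -big_split/=; apply: eq_bigr => l _; rewrite exprD.
Qed.

(** Summed over k, this gives E [U_i U_j |u|^2] = (m + 2) (i == j), the source of the factor n + 2
    in the second moment of <a, u> u. *)
Lemma gaussian_mixed_moment i j k :
  has_mean P (fun w => U i w * U j w * U k w ^+ 2) ((i == j)%:R * (1 + 2 * (i == k)%:R)).
Proof.
pose e l := ((l == i) + (l == j) + ((l == k) + (l == k)))%N.
have -> : (i == j)%:R * (1 + 2 * (i == k)%:R) = \prod_l normal_moment (e l).
  rewrite /e; case: (eqVneq i j) => [<-|ij].
    case: (eqVneq i k) => [<-|ik].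
      rewrite (bigD1 i)//= eqxx moment4 big1 => [|l /negbTE -> //]; first by ring.
    rewrite big1; first by rewrite mul1r mulr0 addr0.
    move=> l _; case: (eqVneq l i) => [->|li]; first by rewrite (negbTE ik) moment2.
    by case: (eqVneq l k) => _; rewrite ?moment2.
  rewrite mul0r; case: (eqVneq i k) => [<-|ik].
    by rewrite (bigD1 j)//= eqxx eq_sym (negbTE ij) moment1 mul0r.
  by rewrite (bigD1 i)//= eqxx (negbTE ij) (negbTE ik) moment1 mul0r.
apply: eq_has_mean (gaussian_monomial_mean _) => w.
rewrite -(prodX1 i) -(prodX1 j) -(prodX1 k) expr2 -!big_split/=.
by apply: eq_bigr => l _; rewrite /e !exprD.
Qed.

(** The moment is 1, 3 or 15 according as the indices are distinct, exactly two agree or all agree.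
    A bound that is a combination of Kronecker deltas can be summed over triples one index at a
    time. *)
Lemma gaussian_sixth_moment i j k : exists2 c,
  has_mean P (fun w => U i w ^+ 2 * U j w ^+ 2 * U k w ^+ 2) c &
  c <= 1 + 3 * (i == j)%:R + 3 * (j == k)%:R + 3 * (i == k)%:R + 15 * ((i == j) && (j == k))%:R.
Proof.
pose e l := ((l == i) + (l == j) + (l == k)).*2.
exists (\prod_l normal_moment (e l)).
  apply: eq_has_mean (gaussian_monomial_mean _) => w.
  rewrite -(prodX1 i) -(prodX1 j) -(prodX1 k) -!prodrXl -!big_split/=.
  by apply: eq_bigr => l _; rewrite /e -mul2n mulnC exprM !exprD !exprMn.
rewrite /e; case: (eqVneq i j) => [<-|ij].
  case: (eqVneq i k) => [<-|ik].
    rewrite (bigD1 i)//= !eqxx moment6 big1 => [|l /negbTE -> //].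
    by rewrite !mulr1; lra.
  rewrite (bigD1 i)//= !eqxx (negbTE ik) moment4 big1 => [|l /negbTE ->].
    by rewrite !mulr1 !mulr0; lra.
  by case: (eqVneq l k).
case: (eqVneq j k) => [<-|jk].
  rewrite (negbTE ij) (bigD1 j)//= !eqxx eq_sym (negbTE ij) moment4 big1 => [|l /negbTE ->].
    by rewrite !mulr1 !mulr0; lra.
  by case: (eqVneq l i).
case: (eqVneq i k) => [<-|ik].
  rewrite (bigD1 i)//= !eqxx (negbTE ij) moment4 big1 => [|l /negbTE ->].
    by rewrite !mulr1 !mulr0; lra.
  by case: (eqVneq l j).
rewrite big1; first by rewrite !mulr0; lra.
move=> l _; case: (eqVneq l i) => [->|li]; first by rewrite (negbTE ij) (negbTE ik).
case: (eqVneq l j) => [->|lj]; first by rewrite (negbTE jk).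
by case: (eqVneq l k).
Qed.

Lemma gaussian_enorm6 : exists2 c,
  has_mean P (fun w => enorm (u w) ^+ 6) c & c <= (m%:R + 4) ^+ 3.
Proof.
have ex_c (t : 'I_m * 'I_m * 'I_m) : exists c,
    has_mean P (fun w => U t.1.1 w ^+ 2 * U t.1.2 w ^+ 2 * U t.2 w ^+ 2) c /\
    c <= 1 + 3 * (t.1.1 == t.1.2)%:R + 3 * (t.1.2 == t.2)%:R
           + 3 * (t.1.1 == t.2)%:R + 15 * ((t.1.1 == t.1.2) && (t.1.2 == t.2))%:R.
  by have [x] := gaussian_sixth_moment t.1.1 t.1.2 t.2; exists x.
have [c cP] := choice ex_c.
exists (\sum_i \sum_j \sum_k c (i, j, k)).
  apply: eq_has_mean (_ : has_mean P (fun w => \sum_i \sum_j \sum_k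
    (U i w ^+ 2 * U j w ^+ 2 * U k w ^+ 2)) _).
    move=> w; rewrite (exprM _ 2 3) enorm_sqrE !exprS expr0 mulr1 mulrA.
    rewrite big_distrlr/= mulr_suml; apply: eq_bigr => i _.
    rewrite mulr_suml; apply: eq_bigr => j _; rewrite mulr_sumr; apply: eq_bigr => k _.
    by rewrite expr2.
  apply: has_mean_sum => i; apply: has_mean_sum => j; apply: has_mean_sum => k.
  exact: (proj1 (cP (i, j, k))).
(* The total is m^3 + 9 m^2 + 15 m, which is below (m + 4)^3. *)
apply: le_trans (_ : \sum_(i < m) (m%:R * (m%:R + 3) + 3 * m%:R + 3 * m%:R + 15) <= _).
  apply: ler_sum => i _.
  have sum1 (x : 'I_m) : \sum_(y < m) (x == y)%:R = 1 :> R.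
    by rewrite (bigD1 x)//= eqxx big1 ?addr0// => y /negbTE; rewrite eq_sym => ->.
  apply: le_trans (_ : \sum_(j < m) (m%:R * (1 + 3 * (i == j)%:R) + 3 + 3
     + 15 * (i == j)%:R) <= _).
    apply: ler_sum => j _.
    apply: le_trans (ler_sum _ (fun k _ => proj2 (cP (i, j, k)))) _.
    rewrite /= !big_split/= -!mulr_sumr !sum1 !sumr_const card_ord !mulr1.
    have -> : \sum_(k < m) ((i == j) && (j == k))%:R = (i == j)%:R :> R.
      by case: eqP => _ /=; [exact: sum1|rewrite big1].
    by rewrite le_eqVlt; apply/orP; left; apply/eqP; ring.
  rewrite !big_split/= -!mulr_sumr big_split/= -!mulr_sumr !sum1 !sumr_const card_ord.
  by rewrite le_eqVlt; apply/orP; left; apply/eqP; ring.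
rewrite sumr_const card_ord -mulr_natl.
by have := ler0n R m; set x := m%:R => x0; nra.
Qed.

End GaussianVectors.

(** * Gradients and proximal steps *)

Section Gradients.
Context {R : realType} {m : nat}.
Local Notation V := 'cV[R]_m.
Implicit Types (h : V -> R) (x y v : V).

Let translation_continuous (a : V) : continuous (fun x : V => a + x).
Proof.
by move=> x; apply: differentiable_continuous.
Qed.

Lemma derive_grad h x v : differentiable h x -> 'D_v h x = dotv (grad h x) v.
Proof.
move=> dh; rewrite deriveE// {1}(matrix_sum_delta v) linear_sum dotvE.
apply: eq_bigr => i _; rewrite big_ord1 linearZ mxE deriveE//.
by rewrite mulrC.
Qed.

Lemma is_derive_line h x v (t : R) : differentiable h (x + t *: v) ->
  is_derive t 1 (fun s : R => h (x + s *: v)) (dotv (grad h (x + t *: v)) v).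
Proof.
move=> dh; rewrite -derive_grad//.
have lineE : (fun s : R => s^-1 *: (((fun s : R => h (x + s *: v)) \o shift t) (s *: (1 : R))
    - h (x + t *: v))) =
    (fun s : R => s^-1 *: ((h \o shift (x + t *: v)) (s *: v) - h (x + t *: v))).
  apply/funext => s /=; congr (_ *: (h _ - _)).
  have -> : s *: (1 : R) = s by exact: mulr1.
  by rewrite scalerDl addrCA.
have dv : derivable h (x + t *: v) v by exact: diff_derivable.
split; first by rewrite /derivable lineE.
by rewrite /derive lineE.
Qed.

Let line_bound h x v c : (forall y, differentiable h y) ->
  (forall t : R, 0 <= t -> dotv (grad h (x + t *: v) - grad h x) v <= c * t) ->
  h (x + v) - h x - dotv (grad h x) v <= c / 2.
Proof.
move=> dh hc.
pose q (t : R) := h (x + t *: v) - t * dotv (grad h x) v - c / 2 * t ^+ 2.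
have dq (t : R) : is_derive t 1 q (dotv (grad h (x + t *: v) - grad h x) v - c * t).
  have dl := is_derive_line (dh (x + t *: v)).
  apply: is_derive_eq.
  rewrite dotvBl /GRing.scale/=; by field.
have [|t] := @MVT R q (fun t => dotv (grad h (x + t *: v) - grad h x) v - c * t) 0 1 ltr01.
  apply: derivable_within_continuous => t _.
  exact: (@ex_derive _ _ _ _ _ _ _ (dq t)).
rewrite in_itv/= => /andP[t0 _]; rewrite /q scale0r scale1r addr0 => E.
have := hc t (ltW t0); move: E.
set D := dotv (_ - _) v; set D0 := dotv _ v; rewrite expr0n expr1n/=; lra.
Qed.

(** The upper bound is the mean value theorem for t -> h (x + t v) - t <grad h x, v> - c t^2 / 2,
    and the lower one is the same for - h. As the hypothesis concerns one direction only, it serves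
    both the Taylor remainder with [Lf] and the block descent with [L s]. *)
Lemma descent h x v c : (forall y, differentiable h y) ->
  (forall t : R, 0 <= t -> `|dotv (grad h (x + t *: v) - grad h x) v| <= c * t) ->
  `|h (x + v) - h x - dotv (grad h x) v| <= c / 2.
Proof.
move=> dh hc.
have gradN y : grad (fun y => - h y) y = - grad h y.
  apply/matrixP => i j; rewrite !mxE.
  by rewrite (deriveN (f := h)) //; exact: diff_derivable.
rewrite ler_norml; apply/andP; split; last first.
  by apply: line_bound => // t t0; apply: le_trans (hc t t0); exact: ler_norm.
have := @line_bound (fun y => - h y) x v c.
rewrite !gradN dotvNl => H; suff : - h (x + v) - - h x - - dotv (grad h x) v <= c / 2 by lra.
apply: H => [y|t t0]; first by apply: differentiableN.
have := hc t t0; rewrite ler_norml dotvBl => /andP[+ _].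
by rewrite gradN opprK dotvDl dotvNl; lra.
Qed.

(** Strong convexity at s y + (1 - s) x, divided by s, bounds the difference quotient of h along y -
    x; then s tends to 0 from the right. *)
Lemma strongly_convex1_grad h x y : (forall z, differentiable h z) -> strongly_convex1 h ->
  h x + dotv (grad h x) (y - x) + enorm (y - x) ^+ 2 / 2 <= h y.
Proof.
move=> dh sh; set v := y - x.
have dv : derivable h x v by exact: diff_derivable.
have lim1 : (fun s : R => s^-1 *: ((h \o shift x) (s *: v) - h x)) @ 0^'+ --> dotv (grad h x) v.
  by rewrite -derive_grad//; apply: cvg_dnbhs_at_right; exact: dv.
have lim2 : (fun s : R => h y - h x - (1 - s) / 2 * enorm v ^+ 2) @ 0^'+ -->
    h y - h x - (1 - 0) / 2 * enorm v ^+ 2.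
  apply: cvg_at_right_filter; apply: cvgB; first exact: cvg_cst.
  apply: cvgM; last exact: cvg_cst.
  by apply: cvgM; [apply: cvgB; [exact: cvg_cst|exact: cvg_id]|exact: cvg_cst].
suff : dotv (grad h x) v <= h y - h x - (1 - 0) / 2 * enorm v ^+ 2 by lra.
apply: (ler_cvg_to lim1 lim2); near=> s.
have s0 : 0 < s by near: s; exact: nbhs_right_gt.
have s1 : s < 1 by near: s; exact: nbhs_right_lt.
have s01 : 0 <= s <= 1 by rewrite !ltW.
have := sh y x s s01.
have -> : s *: y + (1 - s) *: x = s *: v + x.
  by rewrite /v scalerBr scalerBl scale1r [in RHS]addrAC addrA addrAC.
rewrite /= -/v => H.
rewrite -[leLHS]/(s^-1 * (h (s *: v + x) - h x)) ler_pdivrMl//.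
by move: H; nra.
Unshelve. all: by end_near. Qed.

(** A partial derivative is the pointwise limit of the continuous difference quotients with steps 1
    / (n + 1). *)
Lemma measurable_grad h i : (forall y, differentiable h y) ->
  measurable_fun setT (fun x : borel V => grad h x i 0).
Proof.
move=> dh; have ch : continuous h by move=> y; exact/differentiable_continuous.
pose e (n : nat) : R := n.+1%:R^-1.
apply: (@measurable_fun_cvg _ _ _ _
  (fun n (x : borel V) => (e n)^-1 * (h (e n *: delta_mx i 0 + x) - h x))).
  move=> n; apply: measurable_funM => //; apply: measurable_funB; last exact: continuous_borel.
  apply: (@continuous_borel _ _ (fun x => h (e n *: delta_mx i 0 + x))) => x.
  apply: (@continuous_comp _ _ _ (fun x : V => e n *: delta_mx i 0 + x) h); last exact: ch.
  exact: translation_continuous.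
move=> x _; rewrite mxE.
have dv : derivable h x (delta_mx i 0) by exact: diff_derivable.
have /cvgr_dnbhsP := dv; apply; split; first by move=> n; rewrite invr_eq0 pnatr_eq0.
exact: cvg_harmonic.
Qed.

End Gradients.

(** * Bregman proximal points and inexact minimizers *)

Section Prox.
Context {R : realType} {m : nat}.
Local Notation V := 'cV[R]_m.
Variables (X : set V) (phi chi : V -> R).
Hypotheses (X_closed : closed X) (X_convex : convex_set X).
Hypothesis chi_cc : closed_convex_fun chi.
Hypotheses (phi_diff : forall x, differentiable phi x) (phi_sc : strongly_convex1 phi).
Implicit Types (x y w g p : V) (t delta : R).

Let X_conv t x y : 0 <= t <= 1 -> X x -> X y -> X (t *: x + (1 - t) *: y).
Proof.
move=> /andP[t0 t1] Xx Xy.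
have := @X_convex x y (Itv01 t0 t1); rewrite !inE; exact.
Qed.

Let chi_conv t x y : 0 <= t <= 1 ->
  chi (t *: x + (1 - t) *: y) <= t * chi x + (1 - t) * chi y.
Proof.
move=> /andP[t0 t1].
have := chi_cc.2 (Itv01 t0 t1) x y; rewrite !inE => /(_ Logic.I Logic.I).
by rewrite convRE.
Qed.

Lemma bregman_ge y x : enorm (y - x) ^+ 2 / 2 <= bregman phi y x.
Proof. by have := strongly_convex1_grad x y phi_diff phi_sc; rewrite /bregman; lra. Qed.

Let bregmanxx x : bregman phi x x = 0.
Proof. by rewrite /bregman !subrr dotv0 subrr. Qed.

Let three_point w y x : bregman phi w x - bregman phi y x =
  bregman phi w y + dotv (grad phi y - grad phi x) (w - y).
Proof. by rewrite /bregman dotvBl !dotvBr; ring. Qed.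

Let obj alpha x g y := dotv g y + alpha^-1 * bregman phi y x + chi y.

(** The certificate left by the stopping test of CndG: the test is made at a minimizer of the gap,
    so it bounds the gap at every point of [X]. The proofs below use only this certificate, not the
    iterates that produced it. *)
Definition cndg_approx alpha delta x g y : Prop :=
  X y /\ forall w, X w -> - delta <= cndg_gap phi chi x g alpha y w.

Lemma cndg_from_approx alpha delta x g k ut y : (1 <= k)%N -> X ut ->
  cndg_from X phi chi x g alpha delta k ut y -> cndg_approx alpha delta x g y.
Proof.
move=> k1 Xut H; elim: H k1 Xut => {k ut y} [k ut v [Xv vmin] gap k1 Xut|
    k ut v y [Xv vmin] gap _ IH k1 Xut].
  by split => // w /vmin; exact: le_trans.
apply: IH => //.
rewrite addrC.
(* Counting steps from 1 makes the weight 2 / (k + 1) at most 1, which keeps the iterates in [X]. *)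
apply: X_conv => //; rewrite divr_ge0//= ler_pdivrMr// mul1r ler_nat.
by rewrite ltnS.
Qed.

Lemma cndg_output_approx alpha delta x g y : X x ->
  cndg_output X phi chi x g alpha delta y -> cndg_approx alpha delta x g y.
Proof. by move=> Xx; exact: cndg_from_approx. Qed.

(** The gap linearizes the Bregman term at y. By the three-point identity the linearization error is
    alpha^-1 D(w, y), and strong convexity of [phi] bounds it below by |w - y|^2 / (2 alpha). *)
Let approx_obj alpha delta x g y w : 0 < alpha ->
  cndg_approx alpha delta x g y -> X w ->
  obj alpha x g y - delta + (2 * alpha)^-1 * enorm (w - y) ^+ 2 <= obj alpha x g w.
Proof.
move=> a0 [Xy yP] Xw; have := yP w Xw; rewrite /cndg_gap /obj.
have := three_point w y x; have := bregman_ge w y.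
set E := enorm _ ^+ 2; set S := dotv (grad phi y - _) _ => h1 h2 h3.
have {}h3 : - delta <= dotv g w - dotv g y + alpha^-1 * S + chi w - chi y.
  by move: h3; rewrite dotvDl dotvZl -/S dotvBr.
have ai : 0 < alpha^-1 by rewrite invr_gt0.
have h4 : alpha^-1 * (E / 2) <= alpha^-1 * bregman phi w y by rewrite ler_pM2l.
have h5 : alpha^-1 * (bregman phi w x - bregman phi y x) = alpha^-1 * bregman phi w y +
    alpha^-1 * S.
  by rewrite h2; ring.
rewrite (_ : (2 * alpha)^-1 * E = alpha^-1 * (E / 2)); last first.
  by rewrite invfM; ring.
move: h3 h4 h5; move: (bregman phi w x) (bregman phi y x) (bregman phi w y) => b1 b2 b3.
by move=> h3 h4; rewrite mulrBr; lra.
Qed.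

(** The comparison with w = x yields |y - x|^2 / (2 alpha), and the term alpha^-1 D(y, x) of the
    objective yields as much again, hence the full alpha^-1. *)
Lemma cndg_descent alpha delta x g y : 0 < alpha -> X x -> cndg_approx alpha delta x g y ->
  dotv g (y - x) + chi y - chi x <= delta - alpha^-1 * enorm (y - x) ^+ 2.
Proof.
move=> a0 Xx yP; have := approx_obj a0 yP Xx.
rewrite /obj bregmanxx mulr0 addr0 enormBC invfM dotvBr.
have := bregman_ge y x; set E := enorm _ ^+ 2 => h.
have ai : 0 < alpha^-1 by rewrite invr_gt0.
have h4 : alpha^-1 * (E / 2) <= alpha^-1 * bregman phi y x by rewrite ler_pM2l.
by rewrite (_ : 2^-1 * alpha^-1 * E = alpha^-1 * (E / 2)); [lra|ring].
Qed.

Let obj_sc alpha x g w p t : 0 < alpha -> 0 <= t <= 1 ->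
  obj alpha x g (t *: w + (1 - t) *: p) <= t * obj alpha x g w + (1 - t) * obj alpha x g p
    - t * (1 - t) * ((2 * alpha)^-1 * enorm (w - p) ^+ 2).
Proof.
move=> a0 t01; rewrite /obj /bregman.
have h1 := phi_sc w p t01; have h2 := chi_conv w p t01.
have ai : 0 < alpha^-1 by rewrite invr_gt0.
have h3 : alpha^-1 * phi (t *: w + (1 - t) *: p) <= alpha^-1 *
   (t * phi w + (1 - t) * phi p - t * (1 - t) / 2 * enorm (w - p) ^+ 2) by rewrite ler_pM2l.
rewrite !dotvBr !dotvDr !dotvZr invfM.
move: h3; set E := enorm _ ^+ 2.
rewrite (_ : t * (1 - t) * (2^-1 * alpha^-1 * E) = alpha^-1 * (t * (1 - t) / 2 * E)); last by ring.
by move=> h3; nra.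
Qed.

(** Quadratic growth at a minimizer: p is compared with t w + (1 - t) p, the inequality is divided
    by t, and t is small enough for the loss t c to stay below e. *)
Let argmin_sc alpha x g p w : 0 < alpha -> argmin_on X (obj alpha x g) p -> X w ->
  obj alpha x g p + (2 * alpha)^-1 * enorm (w - p) ^+ 2 <= obj alpha x g w.
Proof.
move=> a0 [Xp pmin] Xw.
set c := (2 * alpha)^-1 * _.
have c0 : 0 <= c by rewrite mulr_ge0 ?sqr_ge0// invr_ge0 mulr_ge0// ltW.
apply/ler_addgt0Pr => e e0.
pose t := Num.min 1 (e / (c + 1)).
have c1 : 0 < c + 1 by lra.
have t0 : 0 < t by rewrite lt_min ltr01 divr_gt0.
have t1 : t <= 1 by rewrite ge_min lexx.
have tc : t * c <= e.
  apply: le_trans (_ : e / (c + 1) * c <= e); last first.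
    by rewrite mulrAC ler_pdivrMr//; nra.
  by rewrite ler_wpM2r// ge_min lexx orbT.
have t01 : 0 <= t <= 1 by rewrite (ltW t0).
have h1 := obj_sc x g w p a0 t01.
have h2 := pmin _ (X_conv t01 Xw Xp).
have h3 := le_trans h2 h1; rewrite -/c in h3.
have h4 : t * (obj alpha x g p + (1 - t) * c) <= t * obj alpha x g w by lra.
by rewrite ler_pM2l// in h4; lra.
Qed.

(** The smooth part is continuous, while [chi] enters through its closed epigraph: the limit is
    taken on the pairs formed by y n and the upper bound on chi (y n). *)
Let obj_cvg alpha x g (y : nat -> V) p w (delta : nat -> R) :
  X w -> y @ \oo --> p -> delta @ \oo --> 0 ->
  (forall n, obj alpha x g (y n) - delta n <= obj alpha x g w) ->
  obj alpha x g p <= obj alpha x g w.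
Proof.
move=> Xw yp d0 H.
pose smooth (y : V) := dotv g y + alpha^-1 * bregman phi y x.
have csmooth : continuous smooth.
  have cdot (v : V) : continuous (dotv v) by exact: dotv_continuous.
  move=> z; rewrite /smooth /bregman.
  apply: (@continuousD R R V (fun y => dotv g y)); first exact: cdot.
  apply: (@continuousM R V (fun=> alpha^-1)); first exact: cst_continuous.
  apply: (@continuousB R R V (fun y => phi y - phi x)).
    apply: (@continuousB R R V phi); last exact: cst_continuous.
    exact: differentiable_continuous.
  rewrite (_ : (fun y => _) = (fun y => dotv (grad phi x) y - dotv (grad phi x) x)); last first.
    by apply/funext => y'; rewrite dotvBr.
  apply: (@continuousB R R V (fun y => dotv (grad phi x) y)); last exact: cst_continuous.
  exact: cdot.
have cl := chi_cc.1.
pose F n : V * R := (y n, obj alpha x g w + delta n - smooth (y n)).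
have Fcl : [set q : V * R | chi q.1 <= q.2] (p, obj alpha x g w + 0 - smooth p).
  apply: (@closed_cvg _ _ \oo _ F _ cl).
    by apply: nearW => n /=; have := H n; rewrite {1}/obj -/(smooth (y n)); lra.
  have snd_cvg : (obj alpha x g w + delta n - smooth (y n)) @[n --> \oo] -->
      obj alpha x g w + 0 - smooth p.
    apply: cvgB; first by apply: cvgD => //; exact: cvg_cst.
    by apply: (@cvg_comp _ _ _ y smooth \oo (nbhs p)) => //; exact: csmooth.
  exact: (cvg_pair yp snd_cvg).
by move: Fcl => /=; rewrite {2}/obj -/(smooth p); lra.
Qed.

Hypothesis approx_ex : forall alpha delta x g, 0 < alpha -> 0 < delta -> X x ->
  exists y, cndg_approx alpha delta x g y.

(* The outputs of CndG with precisions tending to 0 form a Cauchy sequence, so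
   termination of CndG already provides the minimizer. *)
Let argmin_ex alpha x g : 0 < alpha -> X x ->
  exists p, argmin_on X (obj alpha x g) p.
Proof.
move=> a0 Xx.
pose delta (n : nat) : R := n.+1%:R^-1.
have delta0 n : 0 < delta n by rewrite invr_gt0.
have [y yP] := choice (fun n => approx_ex g a0 (delta0 n) Xx).
have Xy n : X (y n) by case: (yP n).
have H n w : X w -> obj alpha x g (y n) - delta n <= obj alpha x g w.
  move=> Xw; apply: le_trans (approx_obj a0 (yP n) Xw).
  by rewrite lerDl mulr_ge0 ?sqr_ge0// invr_ge0 mulr_ge0// ltW.
(* Each of the two approximate minimizers is compared with the other; in the sum the objective
   values cancel and alpha^-1 |y_j - y_k|^2 remains. *)
have dist j k : enorm (y j - y k) ^+ 2 <= alpha * (delta j + delta k).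
  have h1 := approx_obj a0 (yP k) (Xy j); have h2 := approx_obj a0 (yP j) (Xy k).
  rewrite [in X in _ + X <= _]enormBC in h2; move: h1 h2; set E := enorm _ ^+ 2 => h1 h2.
  have : 2 * ((2 * alpha)^-1 * E) <= delta j + delta k by lra.
  rewrite (_ : 2 * ((2 * alpha)^-1 * E) = alpha^-1 * E); last by field; rewrite gt_eqF.
  by rewrite ler_pdivrMl.
have cy : cauchy (y @ \oo).
  apply: cauchy_exP => e e0.
  have [K _ KP] : \forall n \near \oo, (2 * alpha / e ^+ 2 < n.+1%:R :> R).
    near=> n; apply: lt_le_trans (_ : n%:R <= _); last by rewrite ler_nat.
    by near: n; exact: nbhs_infty_gtr.
  exists (y K); exists K => // j /= Kj.
  rewrite mx_norm_ball /ball_ /=.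
  apply: le_lt_trans (norm_le_enorm _) _.
  rewrite -ltr_sqr ?nnegrE ?enorm_ge0 ?ltW//.
  apply: le_lt_trans (dist K j) _.
  have hj : delta j <= delta K by rewrite lef_pV2 ?posrE// ler_nat.
  have hK : 2 * alpha * delta K < e ^+ 2.
    have := KP K (leqnn _); rewrite /= ltr_pdivrMr ?exprn_gt0// => h.
    by rewrite /delta ltr_pdivrMr// [ltRHS]mulrC.
  by apply: le_lt_trans hK; have := ler_wpM2l (ltW a0) hj; lra.
have /cvg_ex[p yp] : cvg (y @ \oo) by exact: (@cauchy_cvg _ (y @ \oo) _ cy).
exists p; split.
  by apply: (@closed_cvg _ _ \oo _ y _ X_closed) => //; exact: nearW.
move=> w Xw; apply: (obj_cvg Xw yp (delta := delta)); first exact: cvg_harmonic.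
by move=> n; exact: H.
Unshelve. all: by end_near. Qed.

Let proxP alpha x g : 0 < alpha -> X x ->
  argmin_on X (obj alpha x g) (block_prox X phi chi x g alpha).
Proof.
move=> a0 Xx; have [p pP] := argmin_ex g a0 Xx.
exact: (getPex (ex_intro _ p pP)).
Qed.

(** The certificate at y for [gbar] and the quadratic growth at the exact minimizer p for [g] are
    added, giving |y - p|^2 / alpha <= delta + <gbar - g, p - y>. Young's inequality with parameter
    1 / (2 alpha) absorbs half of the left side. *)
Lemma cndg_prox_dist alpha delta x g gbar y : 0 < alpha -> X x ->
  cndg_approx alpha delta x gbar y ->
  enorm (y - block_prox X phi chi x g alpha) ^+ 2 <=
    2 * alpha * delta + alpha ^+ 2 * enorm (gbar - g) ^+ 2.
Proof.
move=> a0 Xx yP; set p := block_prox _ _ _ _ _ _.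
have pP : argmin_on X (obj alpha x g) p by exact: proxP.
have h1 := approx_obj a0 yP pP.1; have h2 := argmin_sc a0 pP yP.1.
have c0 : 0 < (2 * alpha)^-1 by rewrite invr_gt0 mulr_gt0.
have h3 := dotv_young (gbar - g) (p - y) c0.
move: h1 h2 h3; rewrite /obj (enormBC p y) dotvBr !dotvBl.
rewrite (_ : _ / (4 * (2 * alpha)^-1) = alpha * enorm (gbar - g) ^+ 2 / 2); last first.
  by field; rewrite gt_eqF.
set E := enorm (y - p) ^+ 2; set G := enorm _ ^+ 2 => h1 h2 h3.
have h : (2 * alpha)^-1 * E <= delta + alpha * G / 2.
  by move: h1 h2 h3; move: (bregman phi y x) (bregman phi p x) => b1 b2; lra.
move: h; rewrite ler_pdivrMl ?mulr_gt0// => /le_trans; apply.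
by rewrite le_eqVlt; apply/orP; left; apply/eqP; field.
Qed.

(** Quadratic growth at each minimizer is tested at the other and the two are added. The linear
    terms assemble into the difference of the vectors alpha g - grad phi(x), the only combination of
    x and g on which the proximal point depends; Cauchy-Schwarz concludes. *)
Lemma block_prox_lipschitz alpha x x' g g' : 0 < alpha -> X x -> X x' ->
  enorm (block_prox X phi chi x g alpha - block_prox X phi chi x' g' alpha) <=
    enorm ((alpha *: g - grad phi x) - (alpha *: g' - grad phi x')).
Proof.
move=> a0 Xx Xx'; set p := block_prox _ _ _ x _ _; set p' := block_prox _ _ _ x' _ _.
have pP : argmin_on X (obj alpha x g) p by exact: proxP.
have p'P : argmin_on X (obj alpha x' g') p' by exact: proxP.
have h1 := argmin_sc a0 pP p'P.1; have h2 := argmin_sc a0 p'P pP.1.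
set c := _ - (_ - _).
have h3 := dotv_le_enorm c (p' - p).
have h4 : enorm (p' - p) ^+ 2 <= dotv c (p' - p).
  move: h1 h2; rewrite (enormBC p p') /obj /bregman /c.
  rewrite !dotvBr !dotvBl !dotvZl; set E := enorm _ ^+ 2.
  rewrite (_ : (2 * alpha)^-1 = alpha^-1 / 2); last by field; rewrite gt_eqF.
  move=> h1 h2.
  suff : alpha^-1 * E <= dotv g p' - dotv g' p' - (dotv g p - dotv g' p) - alpha^-1 *
      (dotv (grad phi x) p' - dotv (grad phi x') p' - (dotv (grad phi x) p - dotv (grad phi x') p)).
    rewrite ler_pdivrMl// => /le_trans; apply; rewrite le_eqVlt; apply/orP; left; apply/eqP.
    by field; rewrite gt_eqF.
  by lra.
have [->|E0] := eqVneq (enorm (p - p')) 0; first exact: enorm_ge0.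
have E1 : 0 < enorm (p - p') by rewrite lt_neqAle eq_sym E0 enorm_ge0.
rewrite -(ler_pM2r E1) -expr2; rewrite (enormBC p p'); exact: le_trans h4 h3.
Qed.

(** The choice made by [get] carries no measurability. The proximal point is instead written as [Q]
    at alpha g - grad phi(x), where [Q] has a fixed base point x0 and is continuous by the Lipschitz
    bound. *)
Lemma measurable_block_prox dT (T : measurableType dT) (D : set T)
    (x g : T -> borel V) alpha x0 :
  0 < alpha -> X x0 -> (forall o, D o -> X (x o)) ->
  measurable_fun D x -> measurable_fun D g ->
  measurable_fun D (fun o => block_prox X phi chi (x o) (g o) alpha : borel V).
Proof.
move=> a0 Xx0 DX mx mg.
pose Q (c : V) := block_prox X phi chi x0 (alpha^-1 *: (c + grad phi x0)) alpha.
have QE y h : X y -> block_prox X phi chi y h alpha = Q (alpha *: h - grad phi y).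
  move=> Xy; apply/eqP; rewrite -subr_eq0; apply/eqP; apply: enorm_eq0.
  apply/eqP; rewrite eq_le enorm_ge0 andbT; apply: le_trans (block_prox_lipschitz _ _ a0 Xy Xx0) _.
  by rewrite scalerA divff ?gt_eqF// scale1r addrK subrr enorm0.
have cQ : continuous Q.
  apply: (@norm_le_continuous _ _ _ m%:R) => // c c'.
  apply: le_trans (norm_le_enorm _) _.
  apply: le_trans (block_prox_lipschitz _ _ a0 Xx0 Xx0) _.
  rewrite !scalerA divff ?gt_eqF// !scale1r !addrK.
  exact: enorm_le_norm.
apply: (@eq_measurable_fun _ _ _ _ D (fun o => Q (alpha *: (g o : V) - grad phi (x o)) : borel V)).
  by move=> o; rewrite inE => Do; rewrite QE//; exact: DX.
apply: (measurableT_comp (continuous_borel_vec cQ)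
  (g := fun o => alpha *: (g o : V) - grad phi (x o) : borel V)).
apply: measurable_borel => i; rewrite (_ : (fun o => _) =
    (fun o => alpha * (g o : V) i 0 - grad phi (x o) i 0)); last first.
  by apply/funext => o; rewrite !mxE.
apply: measurable_funB.
  by apply: measurable_funM => //; exact: (measurableT_comp (measurable_coord i)).
exact: (measurableT_comp (measurable_grad i phi_diff)).
Qed.

End Prox.

(** * Moments of the zeroth-order gradient *)

Lemma sum_delta {R : pzSemiRingType} (m : nat) (v : 'I_m -> R) i :
  \sum_j v j * (j == i)%:R = v i.
Proof.
by rewrite (bigD1 i)//= eqxx mulr1 big1 ?addr0// => j /negbTE ->; rewrite mulr0.
Qed.

Lemma sqr_sum_le {R : realFieldType} (m : nat) (v : 'I_m -> R) :
  (\sum_i v i) ^+ 2 <= m%:R * \sum_i v i ^+ 2.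
Proof.
rewrite expr2 big_distrlr/=.
apply: le_trans (_ : \sum_i \sum_j (v i ^+ 2 / 2 + v j ^+ 2 / 2) <= _).
  do 2 apply: ler_sum => ? _; set s := v _; set t := v _.
  by have := sqr_ge0 (s - t); nra.
have -> : \sum_i \sum_j (v i ^+ 2 / 2 + v j ^+ 2 / 2) =
    \sum_i (m%:R * (v i ^+ 2 / 2) + \sum_j v j ^+ 2 / 2).
  by apply: eq_bigr => i _; rewrite big_split/= sumr_const card_ord mulr_natl.
rewrite big_split/= sumr_const card_ord -mulr_sumr -mulr_natl -mulr_suml.
by rewrite le_eqVlt; apply/orP; left; apply/eqP; field.
Qed.

Section Laws.
Context {R : realType} {dO d : measure_display}.
Context {Omega : measurableType dO} {T : measurableType d}.
Variables (P : probability Omega R) (D : probability T R) (Y : Omega -> T).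
Hypothesis lawY : has_law P Y D.

Lemma has_law_ae (Q : T -> Prop) : {ae D, forall z, Q z} -> {ae P, forall w, Q (Y w)}.
Proof.
case: lawY => mY PY [N [mN N0 QN]]; exists (Y @^-1` N); split.
- by rewrite -[_ @^-1` _]setTI; exact: mY.
- by rewrite PY.
- by move=> w /= h; apply: QN.
Qed.

Lemma has_law_mean (h : T -> R) a : has_mean D h a -> has_mean P (h \o Y) a.
Proof.
case: lawY => mY PY hm; have mh := has_mean_measurable hm; case: hm => ih Eh.
pose L := distribution P (mfun_of mY).
have LE A : measurable A -> A `<=` setT -> L A = D A by move=> mA _; exact: PY.
have iY : P.-integrable setT (EFin \o (h \o Y)).
  apply/integrableP; split; first by apply/measurable_EFinP; exact: measurableT_comp.
  case/integrableP: ih => mh' ih; move: ih.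
  rewrite -(@eq_measure_integral _ _ _ _ D L _ LE).
  by rewrite ge0_integral_distribution//; exact: measurableT_comp.
split => //; rewrite -Eh -(@eq_measure_integral _ _ _ _ D L _ LE).
by rewrite integral_distribution//; exact/measurable_EFinP.
Qed.

End Laws.

Section ZerothOrderMeasurability.
Context {R : realType} {b : nat} (d : 'I_b -> nat).
Local Notation V := (blockvec R d).
Context {dXi : measure_display} {Xi : measurableType dXi}.
Variable F : V -> Xi -> R.
Hypothesis F_borel : measurable_fun setT (fun q : borel V * Xi => F q.1 q.2).

Let measurable_F dT (T : measurableType dT) (x : T -> borel V) (z : T -> Xi) :
  measurable_fun setT x -> measurable_fun setT z ->
  measurable_fun setT (fun o => F (x o) (z o)).
Proof.
move=> mx mz; apply: (measurableT_comp F_borel (g := fun o => (x o, z o))).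
exact: measurable_fun_pair.
Qed.

Lemma measurable_zo_grad mu dT (T : measurableType dT) (x u : T -> borel V) (z : T -> Xi) i :
  measurable_fun setT x -> measurable_fun setT z -> measurable_fun setT u ->
  measurable_fun setT (fun o => zo_grad F mu (x o) (z o) (u o) i 0).
Proof.
move=> mx mz mu'; rewrite /zo_grad.
rewrite (_ : (fun o => _) = (fun o =>
    (F ((x o : V) + mu *: (u o : V)) (z o) - F (x o) (z o)) / mu * (u o : V) i 0)); last first.
  by apply/funext => o; rewrite mxE.
have mc (y : T -> borel V) j : measurable_fun setT y ->
    measurable_fun setT (fun o => (y o : V) j 0).
  exact: (measurableT_comp (measurable_coord j)).
apply: measurable_funM; last exact: mc.
apply: measurable_funM => //; apply: measurable_funB; last exact: measurable_F.
apply: (measurable_F (x := fun o => (x o : V) + mu *: (u o : V) : borel V)) => //.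
apply: measurable_borel => j; rewrite (_ : (fun o => _) =
    (fun o => (x o : V) j 0 + mu * (u o : V) j 0)); last first.
  by apply/funext => o; rewrite !mxE.
apply: measurable_funD; first exact: mc.
by apply: measurable_funM => //; exact: mc.
Qed.

Lemma measurable_avg_zo_grad mu k dT (T : measurableType dT) (x : T -> borel V)
    (u : nat -> T -> borel V) (z : nat -> T -> Xi) i :
  measurable_fun setT x -> (forall t : 'I_k, measurable_fun setT (z t)) ->
  (forall t : 'I_k, measurable_fun setT (u t)) ->
  measurable_fun setT (fun o => avg_zo_grad F mu k (z^~ o) (u^~ o) (x o) i 0).
Proof.
move=> mx mz mu'; rewrite (_ : (fun o => _) = (fun o =>
    k%:R^-1 * \sum_(t < k) zo_grad F mu (x o) (z t o) (u t o) i 0)); last first.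
  by apply/funext => o; rewrite mxE summxE.
apply: measurable_funM => //; apply: measurable_sum => t.
by apply: measurable_zo_grad.
Qed.

End ZerothOrderMeasurability.

Section ZerothOrderMoments.
Context {R : realType} {b : nat} (d : 'I_b -> nat).
Local Notation n := (\sum_(s < b) d s)%N.
Local Notation V := (blockvec R d).
Context {dXi : measure_display} {Xi : measurableType dXi}.
Variables (F : V -> Xi -> R) (D : probability Xi R) (f : V -> R).
Hypothesis F_borel : measurable_fun setT (fun q : borel V * Xi => F q.1 q.2).
Variables (Lf mu M sigma : R) (X : set V) (x : V).
Hypotheses (Lf0 : 0 < Lf) (mu0 : 0 < mu).
Hypotheses (A1 : assumption1 F D f X sigma) (A3 : assumption3 f X M) (Xx : X x).
Hypothesis lipF : {ae D, forall z, (forall y, differentiable (F^~ z) y) /\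
  forall y y', enorm (grad (F^~ z) y - grad (F^~ z) y') <= Lf * enorm (y - y')}.

Let g := grad f x.
Let a (z : Xi) := grad (F^~ z) x.

Let a_mean i : has_mean D (fun z => a z i 0) (g i 0).
Proof. by case: A1 => _ /(_ x)[_ /(_ i)[ia Ea]] _; split => //; move: Ea; rewrite unlock. Qed.

(** E |a|^2 = E |a - g|^2 + |g|^2: the cross term has mean 0 because a has mean g. *)
Let a_sqr_mean : exists2 q, has_mean D (fun z => enorm (a z) ^+ 2) q & q <= M ^+ 2 + sigma ^+ 2.
Proof.
have ma i : measurable_fun setT (fun z => a z i 0) by exact: has_mean_measurable (a_mean i).
have [|||s hs ss] := @ge0_has_mean _ _ _ D (fun z => enorm (a z - g) ^+ 2) (sigma ^+ 2).
- rewrite (_ : (fun z => _) = (fun z => \sum_i (a z i 0 - g i 0) ^+ 2)); last first.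
    by apply/funext => z; rewrite enorm_sqrE; apply: eq_bigr => i _; rewrite !mxE.
  by apply: measurable_sum => i; apply: measurable_funX; exact: measurable_funB.
- by move=> z; exact: sqr_ge0.
- by case: A1 => _ _ /(_ x Xx); rewrite unlock.
exists (s + 2 * 0 + enorm g ^+ 2).
  have h0 : has_mean D (fun z => dotv (a z - g) g) 0.
    have -> : 0 = \sum_i (g i 0 - g i 0) * g i 0 :> R.
      by rewrite big1// => i _; rewrite subrr mul0r.
    apply: eq_has_mean (_ : has_mean D (fun z => \sum_i (a z i 0 - g i 0) * g i 0) _).
      by move=> z; rewrite dotvE; apply: eq_bigr => i _; rewrite !mxE.
    apply: has_mean_sum => i; rewrite mulrC.
    apply: eq_has_mean (has_meanZ (g i 0) (has_meanB (a_mean i) (has_mean_cst _ _))) => z.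
    by rewrite mulrC.
  apply: eq_has_mean (has_meanD (has_meanD hs (has_meanZ 2 h0)) (has_mean_cst _ _)) => z.
  by rewrite !enorm_sqr !dotvBr !dotvBl (dotvC g (a z)); ring.
have : enorm g ^+ 2 <= M ^+ 2.
  by rewrite ler_sqr ?nnegrE ?enorm_ge0//; [exact: A3|exact: le_trans (enorm_ge0 g) (A3 Xx)].
by lra.
Qed.

(** Twice the bound on the second moment of <a, u> u plus twice that of r u. The latter is
    [zo_sqr_bias]: |r| <= mu Lf |u|^2 / 2 and E |u|^6 <= (n + 4)^3. *)
Definition zo_second_moment : R :=
  2 * (n%:R + 2) * (M ^+ 2 + sigma ^+ 2) + mu ^+ 2 * Lf ^+ 2 / 2 * (n%:R + 4) ^+ 3.

Definition zo_sqr_bias : R := mu ^+ 2 * Lf ^+ 2 / 4 * (n%:R + 4) ^+ 3.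

Context {dO : measure_display} {Omega : measurableType dO}.
Variables (P : probability Omega R) (J : finType) (G : J -> set (set Omega)).
Hypotheses (GI : forall j, setI_closed (G j)) (GT : forall j, G j setT).
Hypothesis Gm : forall j, G j `<=` measurable.
Hypothesis indG : mutually_independent P G.
Local Notation sub A := (g_sigma_algebraType (joint G A)).

Section OneSample.
Variables (jz ju : J) (z : Omega -> Xi) (u : Omega -> borel V).
Hypotheses (jzu : jz != ju) (law_z : has_law P z D) (gauss_u : std_gaussian P u).
Hypotheses (Gz : G jz = preimage_set_system setT z measurable).
Hypotheses (Gu : G ju = preimage_set_system setT u measurable).
Local Notation U i w := ((u w : V) i 0).

Let mz : measurable_fun (setT : set (sub [set jz]%SET)) z.
Proof. by apply: (@generated_joint_measurable_fun R _ _ _ _ _ jz); rewrite ?finset.inE. Qed.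
Let m_u : measurable_fun (setT : set (sub [set ju]%SET)) u.
Proof. by apply: (@generated_joint_measurable_fun R _ _ _ _ _ ju); rewrite ?finset.inE. Qed.
Let mU i : measurable_fun (setT : set (sub [set ju]%SET)) (fun w => U i w).
Proof. exact: (measurableT_comp (measurable_coord i)). Qed.
Let maz i : measurable_fun (setT : set (sub [set jz]%SET)) (fun w => a (z w) i 0).
Proof. exact: (measurableT_comp (has_mean_measurable (a_mean i)) mz). Qed.

Let indepzu j : j \in [set jz]%SET -> j \notin [set ju]%SET.
Proof. by rewrite !finset.inE => /eqP ->. Qed.

(* The first-order term <a, u> u has mean g; r is the Taylor remainder. *)
Let r w : R := (F (x + mu *: (u w : V)) (z w) - F x (z w)) / mu - dotv (a (z w)) (u w).

Let r_bound : {ae P, forall w, `|r w| <= mu * Lf / 2 * enorm (u w) ^+ 2}.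
Proof.
have := has_law_ae law_z lipF; apply: filterS => w /= [dF lF].
have H := @descent _ _ (F^~ (z w)) x (mu *: (u w : V)) (Lf * enorm (mu *: (u w : V)) ^+ 2) dF.
have {H} : `|F (x + mu *: (u w : V)) (z w) - F x (z w) - dotv (a (z w)) (mu *: (u w : V))| <=
    Lf * enorm (mu *: (u w : V)) ^+ 2 / 2.
  apply: H => t t0; apply: le_trans (dotv_le_enorm_norm _ _) _.
  rewrite (_ : _ * _ * t = Lf * enorm ((x + t *: (mu *: (u w : V))) - x) * enorm (mu *: (u w : V))).
    by rewrite ler_wpM2r ?enorm_ge0// lF.
  by rewrite [x + _]addrC addrK [in RHS]enormZ (ger0_norm t0); ring.
rewrite dotvZr enormZ (ger0_norm (ltW mu0)) exprMn => H.
rewrite /r (_ : _ - _ = (F (x + mu *: (u w : V)) (z w) - F x (z w)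
   - mu * dotv (a (z w)) (u w)) / mu); last by field; rewrite gt_eqF.
rewrite normrM normfV (ger0_norm (ltW mu0)) ler_pdivrMr//.
by apply: le_trans H _; rewrite le_eqVlt; apply/orP; left; apply/eqP; field.
Qed.

Let mzP : measurable_fun setT z. Proof. by case: law_z. Qed.
Let muP : measurable_fun setT u. Proof. by case: gauss_u. Qed.
Let mUP i : measurable_fun setT (fun w => U i w).
Proof. exact: (measurableT_comp (measurable_coord i)). Qed.

Let zo_gradE w i : zo_grad F mu x (z w) (u w) i 0 = dotv (a (z w)) (u w) * U i w + r w * U i w.
Proof. by rewrite /zo_grad mxE -mulrDl /r [_ + (_ - _)]addrC subrK. Qed.

Let main_mean i : has_mean P (fun w => dotv (a (z w)) (u w) * U i w) (g i 0).
Proof.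
have -> : g i 0 = \sum_j g j 0 * (j == i)%:R.
  by rewrite sum_delta.
apply: eq_has_mean (_ : has_mean P (fun w => \sum_j a (z w) j 0 * (U j w * U i w)) _).
  by move=> w; rewrite dotvE mulr_suml; apply: eq_bigr => j _; rewrite mulrA.
apply: has_mean_sum => j.
apply: (has_mean_indepM GI GT Gm indG indepzu) => //.
- exact: measurable_funM.
- exact: has_law_mean law_z _ _ (a_mean j).
- exact: gaussian_covariance.
Qed.

(** In coordinates the moments of a separate from those of u by independence. Only the terms i = j
    survive the Gaussian factor, which leaves (n + 2) E |a|^2. *)
Let main_sqr_mean : exists2 c, has_mean P (fun w => dotv (a (z w)) (u w) ^+ 2 * enorm (u w) ^+ 2) c &
  c <= (n%:R + 2) * (M ^+ 2 + sigma ^+ 2).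
Proof.
have [q hq qle] := a_sqr_mean.
have ex_c (ij : 'I_n * 'I_n) : exists c, has_mean D (fun z => a z ij.1 0 * a z ij.2 0) c.
  apply: ae_norm_le_has_mean hq _.
    by apply: measurable_funM; exact: has_mean_measurable (a_mean _).
  apply: aeW => y; rewrite normrM expr2.
  by apply: ler_pM => //; exact: norm_coord_le_enorm.
have [c cP] := choice ex_c.
exists (\sum_i \sum_j \sum_k c (i, j) * ((i == j)%:R * (1 + 2 * (i == k)%:R))).
  apply: eq_has_mean (_ : has_mean P (fun w => \sum_i \sum_j \sum_k
     (a (z w) i 0 * a (z w) j 0) * (U i w * U j w * U k w ^+ 2)) _).
    move=> w; rewrite expr2 !dotvE enorm_sqrE big_distrlr/= mulr_suml; apply: eq_bigr => i _.
    rewrite mulr_suml; apply: eq_bigr => j _; rewrite mulr_sumr; apply: eq_bigr => k _.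
    by ring.
  apply: has_mean_sum => i; apply: has_mean_sum => j; apply: has_mean_sum => k.
  apply: (has_mean_indepM GI GT Gm indG indepzu).
  - by apply: measurable_funM; exact: maz.
  - by do 2 apply: measurable_funM => //; exact: mU.
  - exact: has_law_mean law_z _ _ (cP (i, j)).
  - exact: gaussian_mixed_moment.
have -> : \sum_i \sum_j \sum_k c (i, j) * ((i == j)%:R * (1 + 2 * (i == k)%:R)) =
    (n%:R + 2) * \sum_i c (i, i).
  rewrite mulr_sumr; apply: eq_bigr => i _.
  rewrite (bigD1 i)//= [X in _ + X = _]big1 ?addr0; last first.
    move=> j ji; rewrite big1// => k _.
    by rewrite eq_sym (negbTE ji) mul0r mulr0.
  rewrite eqxx -mulr_sumr -mulr_sumr mul1r big_split/= -mulr_sumr sumr_const card_ord.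
  have -> : \sum_(k < n) (i == k)%:R = 1 :> R.
    rewrite -[RHS](sum_delta (fun=> 1) i); apply: eq_bigr => k _.
    by rewrite mul1r eq_sym.
  by rewrite mulr1 mulrC.
have -> : \sum_i c (i, i) = q.
  apply: has_mean_uniq hq; apply: eq_has_mean (has_mean_sum _ (fun i => cP (i, i))) => y.
  by rewrite enorm_sqrE; apply: eq_bigr => i _; rewrite expr2.
by rewrite ler_wpM2l// addr_ge0.
Qed.

Let mr : measurable_fun setT r.
Proof.
apply: measurable_funB.
  apply: measurable_funM => //; apply: measurable_funB.
    apply: (measurableT_comp F_borel (g := fun w => (x + mu *: (u w : V) : borel V, z w))).
    apply: measurable_fun_pair => //; apply: measurable_borel => i.
    rewrite (_ : (fun w => _) = (fun w => x i 0 + mu * U i w)); last first.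
      by apply/funext => w; rewrite !mxE.
    by apply: measurable_funD => //; exact: measurable_funM.
  apply: (measurableT_comp F_borel (g := fun w => (x : borel V, z w))).
  exact: measurable_fun_pair.
rewrite (_ : (fun w => _) = (fun w => \sum_i a (z w) i 0 * U i w)); last first.
  by apply/funext => w; rewrite dotvE.
apply: measurable_sum => i; apply: measurable_funM => //.
exact: (measurableT_comp (has_mean_measurable (a_mean i)) mzP).
Qed.

Let menorm2 : measurable_fun setT (fun w => enorm (u w) ^+ 2).
Proof.
rewrite (_ : (fun w => _) = (fun w => \sum_i U i w ^+ 2)); last first.
  by apply/funext => w; rewrite enorm_sqrE.
by apply: measurable_sum => i; exact: measurable_funX.
Qed.

Let rest_sqr_mean : exists2 c, has_mean P (fun w => r w ^+ 2 * enorm (u w) ^+ 2) c &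
  c <= zo_sqr_bias.
Proof.
have [s hs sle] := gaussian_enorm6 gauss_u.
have hs' := has_meanZ (mu ^+ 2 * Lf ^+ 2 / 4) hs.
have bnd : {ae P, forall w, `|r w ^+ 2 * enorm (u w) ^+ 2| <=
    mu ^+ 2 * Lf ^+ 2 / 4 * enorm (u w) ^+ 6}.
  apply: filterS r_bound => w /= rw.
  rewrite ger0_norm; last by rewrite mulr_ge0 ?sqr_ge0.
  rewrite (_ : mu ^+ 2 * Lf ^+ 2 / 4 * enorm (u w) ^+ 6 =
     (mu * Lf / 2 * enorm (u w) ^+ 2) ^+ 2 * enorm (u w) ^+ 2); last by field.
  rewrite ler_wpM2r ?sqr_ge0// -[leLHS]real_normK ?num_real// ler_sqr ?nnegrE//.
  exact: le_trans rw.
have [|c hc] := @ae_norm_le_has_mean _ _ _ P (fun w => r w ^+ 2 * enorm (u w) ^+ 2) _ _ _ hs' bnd.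
  by apply: measurable_funM => //; exact: measurable_funX.
exists c => //; apply: le_trans (ae_le_has_mean hc hs' _) _.
  by apply: filterS bnd => w /=; apply: le_trans; exact: ler_norm.
by rewrite /zo_sqr_bias ler_wpM2l// divr_ge0// mulr_ge0 ?sqr_ge0.
Qed.

Lemma zo_grad_moments : exists m : V,
  [/\ forall i, has_mean P (fun w => zo_grad F mu x (z w) (u w) i 0) (m i 0),
      enorm (m - g) ^+ 2 <= zo_sqr_bias &
      exists2 v, has_mean P (fun w => enorm (zo_grad F mu x (z w) (u w)) ^+ 2) v &
                 v <= zo_second_moment].
Proof.
have [c hc cle] := main_sqr_mean; have [s hs sle] := rest_sqr_mean.
have msq i : measurable_fun setT (fun w => r w * U i w) by exact: measurable_funM.
have ex_s i : exists c, has_mean P (fun w => (r w * U i w) ^+ 2) c.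
  apply: ae_norm_le_has_mean hs _; first exact: measurable_funX.
  apply: aeW => w; rewrite ger0_norm ?sqr_ge0// exprMn ler_wpM2l ?sqr_ge0//.
  by rewrite enorm_sqrE (bigD1 i)//= lerDl sumr_ge0// => k _; exact: sqr_ge0.
have [s_ hs_] := choice ex_s.
have ex_b i : exists c, has_mean P (fun w => r w * U i w) c /\ c ^+ 2 <= s_ i.
  by have [e he ele] := sqr_has_mean (msq i) (hs_ i); exists e.
have [e eP] := choice ex_b.
(* Here e_i is the mean of r U_i; e_i^2 <= E (r U_i)^2, summed over i, bounds the squared bias by E
   r^2 |u|^2. *)
exists (\col_i (g i 0 + e i)); split.
- move=> i; rewrite mxE.
  apply: eq_has_mean (has_meanD (main_mean i) (eP i).1) => w.
  by rewrite zo_gradE.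
- apply: le_trans sle; rewrite enorm_sqrE.
  have -> : s = \sum_i s_ i.
    apply: has_mean_uniq hs _; apply: eq_has_mean (has_mean_sum _ hs_) => w.
    by rewrite enorm_sqrE mulr_sumr; apply: eq_bigr => i _; rewrite exprMn.
  by apply: ler_sum => i _; rewrite !mxE addrC addKr; exact: (eP i).2.
have hd := has_meanD (has_meanZ 2 hc) (has_meanZ 2 hs).
have bnd w : enorm (zo_grad F mu x (z w) (u w)) ^+ 2 <=
    2 * (dotv (a (z w)) (u w) ^+ 2 * enorm (u w) ^+ 2) + 2 * (r w ^+ 2 * enorm (u w) ^+ 2).
  rewrite [in leLHS]enorm_sqrE [enorm (u w) ^+ 2]enorm_sqrE !mulr_sumr -big_split/=.
  apply: ler_sum => i _; rewrite zo_gradE.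
  by have := sqr_ge0 (dotv (a (z w)) (u w) * U i w - r w * U i w); nra.
have [||v hv] := @ae_norm_le_has_mean _ _ _ P (fun w => enorm (zo_grad F mu x (z w) (u w)) ^+ 2) _ _ _ hd _.
- rewrite (_ : (fun w => _) = (fun w => \sum_i zo_grad F mu x (z w) (u w) i 0 ^+ 2)); last first.
    by apply/funext => w; rewrite enorm_sqrE.
  apply: measurable_sum => i; apply: measurable_funX.
  exact: (measurable_zo_grad F_borel).
- by apply: aeW => w; rewrite ger0_norm ?sqr_ge0.
exists v => //; apply: le_trans (le_has_mean hv hd bnd) _.
by move: cle sle; rewrite /zo_second_moment /zo_sqr_bias; lra.
Qed.

End OneSample.

Section Batch.
Variables (B : nat) (jz ju : 'I_B -> J).
Variables (z : nat -> Omega -> Xi) (u : nat -> Omega -> borel V).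
Hypotheses (B0 : (0 < B)%N) (jz_inj : injective jz) (ju_inj : injective ju).
Hypothesis jzu : forall t t', jz t != ju t'.
Hypotheses (law_z : forall t : 'I_B, has_law P (z t) D).
Hypotheses (gauss_u : forall t : 'I_B, std_gaussian P (u t)).
Hypotheses (Gz : forall t : 'I_B, G (jz t) = preimage_set_system setT (z t) measurable).
Hypotheses (Gu : forall t : 'I_B, G (ju t) = preimage_set_system setT (u t) measurable).

Let pairs (t : 'I_B) : {set J} := [set jz t; ju t]%SET.

Let Y (t : 'I_B) i w : R := zo_grad F mu x (z t w) (u t w) i 0.

Let mY t i : measurable_fun (setT : set (sub (pairs t))) (Y t i).
Proof.
apply: (measurable_zo_grad F_borel _ _ (x := fun=> x : borel V)); first exact: measurable_cst.
  exact: (@generated_joint_measurable_fun R _ _ _ G _ _ _ _ _ (finset.set21 _ _) (Gz t)).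
exact: (@generated_joint_measurable_fun R _ _ _ G _ _ _ _ _ (finset.set22 _ _) (Gu t)).
Qed.

Let disjoint_pairs t t' : t != t' -> forall j, j \in pairs t -> j \notin pairs t'.
Proof.
move=> tt' j; rewrite !finset.inE => /orP[] /eqP ->; rewrite negb_or.
  by rewrite jzu andbT; apply: contra tt' => /eqP/jz_inj ->.
by rewrite eq_sym jzu/=; apply: contra tt' => /eqP/ju_inj ->.
Qed.

Let merror : measurable_fun setT
  (fun w => enorm (avg_zo_grad F mu B (z^~ w) (u^~ w) x - g) ^+ 2).
Proof.
rewrite (_ : (fun w => _) = (fun w => \sum_i (B%:R^-1 * \sum_(t < B) Y t i w - g i 0) ^+ 2)).
  apply: measurable_sum => i; apply: measurable_funX; apply: measurable_funB => //.
  apply: measurable_funM => //; apply: measurable_sum => t.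
  apply: (measurable_zo_grad F_borel _ _ (x := fun=> x : borel V)); first exact: measurable_cst.
    by case: (law_z t).
  by case: (gauss_u t).
apply/funext => w; rewrite enorm_sqrE; apply: eq_bigr => i _.
by rewrite mxE [X in X + _]mxE [X in _ + X]mxE summxE.
Qed.

(** Each sample is centred at its own mean, so distinct samples contribute 0 by independence of the
    pairs (z_t, u_t) and the B diagonal terms are divided by B^2. The means [m t] come from an
    existence statement and are not identified with one another, hence the convexity of the square
    in the bias bound. *)
Lemma batch_mean : exists mbar c, [/\
  has_mean P (fun w => enorm (avg_zo_grad F mu B (z^~ w) (u^~ w) x - mbar) ^+ 2) c,
  c <= zo_second_moment / B%:R & enorm (mbar - g) ^+ 2 <= zo_sqr_bias].
Proof.
have [m mP] := choice (fun t => zo_grad_moments (jzu t t) (law_z t) (gauss_u t) (Gz t) (Gu t)).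
have B1 : 0 < B%:R :> R by rewrite ltr0n.
have avgE w i : avg_zo_grad F mu B (z^~ w) (u^~ w) x i 0 = B%:R^-1 * \sum_(t < B) Y t i w.
  by rewrite mxE summxE.
pose Z t i w := Y t i w - m t i 0.
have hZ t i : has_mean P (Z t i) 0.
  rewrite -(subrr (m t i 0)); apply: has_meanB; last exact: has_mean_cst.
  by case: (mP t) => + _ _; exact.
have hZ2 t : exists2 c, has_mean P (fun w => \sum_i Z t i w ^+ 2) c & c <= zo_second_moment.
  have [hm _ [v hv vle]] := mP t.
  exists (v - \sum_i (2 * m t i 0) * m t i 0 + \sum_i m t i 0 ^+ 2).
    apply: eq_has_mean (has_meanD (has_meanB hv
      (has_mean_sum _ (fun i => has_meanZ (2 * m t i 0) (hm i)))) (has_mean_cst P _)) => w.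
    rewrite enorm_sqrE -sumrB -big_split/=; apply: eq_bigr => i _.
    by rewrite /Z /Y; ring.
  apply: le_trans vle; rewrite -addrA gerDl addrC -sumrB sumr_le0// => i _.
  by have := sqr_ge0 (m t i 0); lra.
have ex_c (tt : 'I_B * 'I_B) : exists c, has_mean P (fun w => \sum_i Z tt.1 i w * Z tt.2 i w) c /\
    c <= zo_second_moment * (tt.2 == tt.1)%:R.
  case: tt => t t' /=; case: (eqVneq t' t) => [->|tt'].
    by have [c hc cle] := hZ2 t; exists c; rewrite mulr1; split.
  exists (\sum_(i < n) 0 * 0); split; last first.
    by rewrite [leRHS]mulr0 big1// => i _; rewrite mul0r.
  apply: has_mean_sum => i; rewrite eq_sym in tt'.
  apply: (has_mean_indepM GI GT Gm indG (disjoint_pairs tt')) => //.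
    by apply: measurable_funB => //; exact: mY.
  by apply: measurable_funB => //; exact: mY.
have [c cP] := choice ex_c.
exists (B%:R^-1 *: \sum_t m t), ((B%:R^-1) ^+ 2 * \sum_t \sum_t' c (t, t')); split.
- apply: eq_has_mean (has_meanZ (B%:R^-1 ^+ 2) (has_mean_sum _ (fun t => has_mean_sum _
    (fun t' => (cP (t, t')).1)))) => w /=.
  rewrite (eq_bigr _ (fun t _ => exchange_big _ _ _ _ _ _)) exchange_big/=.
  rewrite enorm_sqrE mulr_sumr; apply: eq_bigr => i _.
  rewrite [in RHS]mxE avgE [in RHS]mxE [in RHS]mxE summxE -mulrBr -sumrB exprMn; congr (_ * _).
  by rewrite expr2 big_distrlr.
- apply: le_trans (_ : B%:R^-1 ^+ 2 * \sum_(t < B) zo_second_moment <= _).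
    rewrite ler_wpM2l ?sqr_ge0//; apply: ler_sum => t _.
    rewrite -[leRHS](sum_delta (fun=> zo_second_moment) t); apply: ler_sum => t' _.
    exact: (cP (t, t')).2.
  rewrite sumr_const card_ord -mulr_natr le_eqVlt; apply/orP; left; apply/eqP.
  by field; rewrite gt_eqF.
rewrite enorm_sqrE.
apply: le_trans (_ : \sum_i B%:R^-1 * \sum_(t < B) (m t i 0 - g i 0) ^+ 2 <= _).
  apply: ler_sum => i _.
  have -> : (B%:R^-1 *: \sum_t m t - g) i 0 = B%:R^-1 * \sum_(t < B) (m t i 0 - g i 0).
    rewrite mxE [X in X + _]mxE [X in _ + X]mxE summxE sumrB mulrBr sumr_const card_ord -mulr_natr; congr (_ - _).
    by field; rewrite gt_eqF.
  rewrite exprMn expr2 -mulrA ler_pM2l ?invr_gt0// ler_pdivrMl//.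
  exact: sqr_sum_le.
rewrite -mulr_sumr exchange_big/= ler_pdivrMl//.
have -> : B%:R * zo_sqr_bias = \sum_(t < B) zo_sqr_bias.
  by rewrite sumr_const card_ord mulr_natl.
apply: ler_sum => t _; have [_ + _] := mP t; rewrite enorm_sqrE.
by congr (_ <= _); apply: eq_bigr => i _; rewrite mxE [X in _ + X]mxE.
Qed.

Lemma batch_sqr_error_mean :
  (\int[P]_w (enorm (avg_zo_grad F mu B (z^~ w) (u^~ w) x - g) ^+ 2)%:E <=
    (2 * (zo_second_moment / B%:R) + 2 * zo_sqr_bias)%:E)%E.
Proof.
have [mbar [c [hc cle bias]]] := batch_mean.
have hd := has_meanD (has_meanZ 2 hc) (has_mean_cst P (2 * enorm (mbar - g) ^+ 2)).
apply: le_trans (_ : (2 * c + 2 * enorm (mbar - g) ^+ 2)%:E <= _)%E; last by rewrite lee_fin; lra.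
case: hd => /integrableP[mh _] <-; apply: ge0_le_integral => //.
- by move=> w _; rewrite lee_fin sqr_ge0.
- exact/measurable_EFinP.
- move=> w _; rewrite lee_fin -(subrKA mbar); exact: enormD_sqr_le.
Qed.

Lemma zo_second_moment_gt0 : 0 < zo_second_moment.
Proof.
rewrite /zo_second_moment ltr_wpDl ?mulr_ge0 ?addr_ge0 ?sqr_ge0//.
by rewrite mulr_gt0 ?exprn_gt0 ?ltr_wpDl// divr_gt0// mulr_gt0 ?exprn_gt0.
Qed.

(** Markov is applied to the deviation from [mbar] alone. The bias is deterministic and is added
    afterwards, so [lambda] does not multiply it. *)
Lemma batch_sqr_error_tail (lambda : R) : 0 < lambda ->
  (P [set w | (2 * (lambda * (zo_second_moment / B%:R)) + 2 * zo_sqr_bias <=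
        enorm (avg_zo_grad F mu B (z^~ w) (u^~ w) x - g) ^+ 2)%R] <= (lambda^-1)%:E)%E.
Proof.
move=> l0; have [mbar [c [hc cle bias]]] := batch_mean.
have v0 : 0 < zo_second_moment / B%:R by rewrite divr_gt0 ?zo_second_moment_gt0 ?ltr0n.
have lv : 0 < lambda * (zo_second_moment / B%:R) by rewrite mulr_gt0.
have ge0 w : 0 <= enorm (avg_zo_grad F mu B (z^~ w) (u^~ w) x - mbar) ^+ 2 by exact: sqr_ge0.
have mE h t : measurable_fun setT h -> measurable [set w : Omega | t <= h w :> R].
  move=> mh; rewrite (_ : [set _ | _] = setT `&` h @^-1` [set` `[t, +oo[]); last first.
    by rewrite setTI; apply/seteqP; split => w /=; rewrite in_itv/= andbT.
  exact: mh.
apply: le_trans (le_trans (has_mean_markov hc ge0 lv) _).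
  apply: le_measure; rewrite ?inE.
  - exact: mE.
  - exact/mE/(has_mean_measurable hc).
  move=> w /= h; have := enormD_sqr_le (avg_zo_grad F mu B (z^~ w) (u^~ w) x - mbar) (mbar - g).
  by rewrite subrKA; lra.
rewrite lee_fin ler_pdivrMr//; apply: le_trans cle _.
by rewrite mulKf ?gt_eqF.
Qed.

End Batch.

End ZerothOrderMoments.

(** * Block decomposition and the descent step *)

Section BlockAlgebra.
Context {R : realType} {b : nat} (d : 'I_b -> nat).
Local Notation V := (blockvec R d).
Implicit Types (x y v g : V) (s t : 'I_b).

Lemma blkE s x : blk s x = submxcol x s.
Proof. by rewrite /blk /blockU tr_submxrow trmx1 submxcol_mul mul1mx. Qed.

Lemma blk_mxcol s (A : forall s, 'cV[R]_(d s)) : blk s (\mxcol_s A s) = A s.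
Proof. by rewrite blkE mxcolK. Qed.

Lemma blkB s x y : blk s (x - y) = blk s x - blk s y.
Proof. exact: mulmxBr. Qed.

Lemma blk_sum x : x = \sum_s blockU d s *m blk s x.
Proof.
rewrite -{1}[x]mul1mx -(submxrowK 1%:M) -{1}(submxcolK x) mul_mxrow_mxcol.
by apply: eq_bigr => s _; rewrite blkE.
Qed.

Lemma dotv_blk x y : dotv x y = \sum_s dotv (blk s x) (blk s y).
Proof.
rewrite /dotv {1}(blk_sum y) mulmx_sumr summxE; apply: eq_bigr => s _.
by rewrite mulmxA /blk trmx_mul trmxK.
Qed.

Lemma enorm_sqr_blk x : enorm x ^+ 2 = \sum_s enorm (blk s x) ^+ 2.
Proof. by rewrite enorm_sqr dotv_blk; apply: eq_bigr => s _; rewrite enorm_sqr. Qed.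

Lemma dotv_blockU g s (h : 'cV[R]_(d s)) : dotv g (blockU d s *m h) = dotv (blk s g) h.
Proof. by rewrite /dotv mulmxA /blk trmx_mul trmxK. Qed.

Lemma blockU_move x y s : (forall t, t != s -> blk t y = blk t x) ->
  y = x + blockU d s *m (blk s y - blk s x).
Proof.
move=> yx; suff E : y - x = blockU d s *m blk s (y - x) by rewrite -blkB -E subrKC.
rewrite {1}[y - x]blk_sum [LHS](bigD1 s)//= [X in _ + X]big1 ?addr0// => t ts.
by rewrite blkB yx// subrr mulmx0.
Qed.

End BlockAlgebra.

Section BlockMeasurability.
Context {R : realType} {b : nat} (d : 'I_b -> nat).
Local Notation V := (blockvec R d).
Context {dT : measure_display} {T : measurableType dT}.

Lemma measurable_blk s (x : T -> borel V) : measurable_fun setT x ->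
  measurable_fun setT (fun o => blk s (x o : V) : borel 'cV[R]_(d s)).
Proof.
move=> mx; apply: measurable_borel => j.
rewrite (_ : (fun o => _) = (fun o => \sum_i (blockU d s)^T j i * (x o : V) i 0)).
  apply: measurable_sum => i; apply: measurable_funM => //.
  exact: (measurableT_comp (measurable_coord i)).
by apply/funext => o; rewrite mxE.
Qed.

Lemma measurable_mxcol (A : forall s, T -> borel 'cV[R]_(d s)) :
  (forall s, measurable_fun setT (A s)) ->
  measurable_fun setT (fun o => \mxcol_s (A s o : 'cV[R]_(d s)) : borel V).
Proof.
move=> mA; apply: measurable_borel => j.
rewrite (_ : (fun o => _) = (fun o => \sum_s \sum_i
    (blockU d s : 'M[R]_(_, _)) j i * (A s o : 'cV[R]_(d s)) i 0)).
  apply: measurable_sum => s; apply: measurable_sum => i; apply: measurable_funM => //.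
  exact: (measurableT_comp (measurable_coord i)).
apply/funext => o; rewrite [X in fun_of_matrix X]blk_sum summxE; apply: eq_bigr => s _.
by rewrite blk_mxcol mxE.
Qed.

Lemma measurable_enorm_sqr m (x : T -> 'cV[R]_m) :
  (forall i, measurable_fun setT (fun o => x o i 0)) ->
  measurable_fun setT (fun o => enorm (x o) ^+ 2).
Proof.
move=> mx; rewrite (_ : (fun o => _) = (fun o => \sum_i x o i 0 ^+ 2)).
  by apply: measurable_sum => i; exact: measurable_funX.
by apply/funext => o; rewrite enorm_sqrE.
Qed.

End BlockMeasurability.

Section BlockDescent.
Context {R : realType} {b : nat} (d : 'I_b -> nat).
Local Notation V := (blockvec R d).
Context {dXi : measure_display} {Xi : measurableType dXi}.
Variables (F : V -> Xi -> R) (D : probability Xi R) (f : V -> R).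
Variables (Y : set V) (sigma Lf : R) (L : 'I_b -> R).
Hypotheses (A1 : assumption1 F D f Y sigma) (A2 : assumption2 F D Lf L).

Lemma assumption1_mean x : has_mean D (F x) (f x).
Proof. by case: A1 => /(_ x)[iF EF] _ _; split => //; move: EF; rewrite unlock. Qed.

Lemma assumption1_grad_mean x i : has_mean D (fun z => grad (F^~ z) x i 0) (grad f x i 0).
Proof.
by case: A1 => _ /(_ x)[_ /(_ i)[ia Ea]] _; split => //; move: Ea; rewrite unlock.
Qed.

(** Block smoothness is assumed for almost every sample, so the inequality is obtained for F(., z)
    and then integrated; all three terms on the right have known means. *)
Lemma block_descent s x (h : 'cV[R]_(d s)) :
  f (x + blockU d s *m h) <= f x + dotv (blk s (grad f x)) h + L s / 2 * enorm h ^+ 2.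
Proof.
set v := blockU d s *m h.
have hr : has_mean D (fun z => F x z + \sum_i v i 0 * grad (F^~ z) x i 0 + L s / 2 * enorm h ^+ 2)
    (f x + \sum_i v i 0 * grad f x i 0 + L s / 2 * enorm h ^+ 2).
  apply: has_meanD; last exact: has_mean_cst.
  apply: has_meanD; first exact: assumption1_mean.
  by apply: has_mean_sum => i; apply: has_meanZ; exact: assumption1_grad_mean.
rewrite -dotv_blockU dotvC dotvE; apply: ae_le_has_mean (assumption1_mean _) hr _.
apply: filterS A2 => z [dF _ bF].
have := @descent _ _ (F^~ z) x v (L s * enorm h ^+ 2) dF.
rewrite dotvC dotvE ler_norml => H; suff /andP[_] : - (L s * enorm h ^+ 2 / 2) <=
   F (x + v) z - F x z - \sum_i v i 0 * grad (F^~ z) x i 0 <= L s * enorm h ^+ 2 / 2 by lra.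
apply: H => t t0; rewrite /v dotv_blockU blkB scalemxAr.
apply: le_trans (dotv_le_enorm_norm _ _) _.
apply: le_trans (ler_wpM2r (enorm_ge0 _) (bF s x (t *: h))) _.
by rewrite enormZ ger0_norm// le_eqVlt; apply/orP; left; apply/eqP; ring.
Qed.

End BlockDescent.

Section BlockSteps.
Context {R : realType} {b : nat} (d : 'I_b -> nat).
Local Notation V := (blockvec R d).
Variables (X : forall s, set 'cV[R]_(d s)) (phi chi : forall s, 'cV[R]_(d s) -> R).
Arguments X : clear implicits.
Arguments phi : clear implicits.
Arguments chi : clear implicits.
Hypotheses (X_closed : forall s, closed (X s))
  (X_convex : forall s, convex_set (M := 'cV[R]_(d s)) (X s)).
Hypothesis chi_cc : forall s, closed_convex_fun (chi s).
Hypothesis phi_diff : forall s x, differentiable (phi s) x.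
Hypothesis phi_sc : forall s, strongly_convex1 (phi s).
Hypothesis approx_ex : forall s (alpha delta : R) x g, 0 < alpha -> 0 < delta -> X s x ->
  exists y, cndg_approx (X s) (phi s) (chi s) alpha delta x g y.

Lemma blk_gen_grad x g alpha s : blk s (gen_grad X phi chi x g alpha) =
  alpha^-1 *: (blk s x - block_prox (X s) (phi s) (chi s) (blk s x) (blk s g) alpha).
Proof. exact: blk_mxcol. Qed.

Lemma gen_grad_lipschitz x g g' alpha : 0 < alpha -> prod_set X x ->
  enorm (gen_grad X phi chi x g alpha - gen_grad X phi chi x g' alpha) ^+ 2 <=
    enorm (g - g') ^+ 2.
Proof.
move=> a0 Xx; rewrite !enorm_sqr_blk; apply: ler_sum => s _.
rewrite ler_sqr ?nnegrE ?enorm_ge0// !blkB !blk_gen_grad -scalerBr opprB addrC subrKA.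
rewrite enormZ ger0_norm ?invr_ge0 ?(ltW a0)// ler_pdivrMl//.
have := block_prox_lipschitz (@X_closed s) (@X_convex s) (chi_cc s) (@phi_diff s) (@phi_sc s)
  (@approx_ex s) (blk s g') (blk s g) a0 (Xx s) (Xx s).
by rewrite opprB subrKA -scalerBr enormZ (ger0_norm (ltW a0)) (enormBC (blk s g)).
Qed.

(** The exact gradient mapping at x is replaced by the estimated one, the selection moves to y, and
    the estimate there is replaced by the exact mapping. Each replacement costs a factor 2 and a
    gradient error, hence 4, 2 and 4. *)
Lemma gen_grad_selection_le x y gx gy hx hy alpha : 0 < alpha -> prod_set X x -> prod_set X y ->
  enorm (gen_grad X phi chi x hx alpha) <= enorm (gen_grad X phi chi y hy alpha) ->
  enorm (gen_grad X phi chi x gx alpha) ^+ 2 <= 4 * enorm (gen_grad X phi chi y gy alpha) ^+ 2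
    + 2 * enorm (hx - gx) ^+ 2 + 4 * enorm (hy - gy) ^+ 2.
Proof.
move=> a0 Xx Xy; rewrite -ler_sqr ?nnegrE ?enorm_ge0//.
have := gen_grad_lipschitz gx hx a0 Xx; have := gen_grad_lipschitz hy gy a0 Xy.
set p := gen_grad X phi chi x gx alpha; set p' := gen_grad X phi chi x hx alpha.
set s := gen_grad X phi chi y gy alpha; set s' := gen_grad X phi chi y hy alpha.
clearbody p p' s s'.
have addKD (a c : V) : enorm c ^+ 2 <= 2 * enorm a ^+ 2 + 2 * enorm (c - a) ^+ 2.
  by have := enormD_sqr_le a (c - a); rewrite subrKC.
have := addKD p' p; have := addKD s s'; rewrite (enormBC gx).
move: (enorm (p - p')) (enorm (s' - s)) (enorm p) (enorm p') (enorm s) (enorm s').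
by move=> e1 e2 e3 e4 e5 e6; lra.
Qed.

Lemma measurable_blk_gen_grad dT (T : measurableType dT) (x g : T -> borel V) alpha x0 s i :
  0 < alpha -> prod_set X x0 -> (forall o, prod_set X (x o)) ->
  measurable_fun setT x -> measurable_fun setT g ->
  measurable_fun setT (fun o => (blk s (gen_grad X phi chi (x o) (g o) alpha) : 'cV[R]_(d s)) i 0).
Proof.
move=> a0 Xx0 Xx mx mg.
rewrite (_ : (fun o => _) = (fun o => alpha^-1 * (blk s (x o : V) i 0 -
    block_prox (X s) (phi s) (chi s) (blk s (x o : V)) (blk s (g o : V)) alpha i 0))); last first.
  by apply/funext => o; rewrite blk_gen_grad mxE mxE [X in _ + X]mxE.
apply: measurable_funM => //; apply: measurable_funB.
  exact: (measurableT_comp (measurable_coord i) (measurable_blk (s := s) mx)).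
have mp : measurable_fun setT (fun w => block_prox (X s) (phi s) (chi s)
    (blk s (x w : V)) (blk s (g w : V)) alpha : borel 'cV[R]_(d s)).
  apply: (measurable_block_prox (@X_closed s) (@X_convex s) (chi_cc s) (@phi_diff s) (@phi_sc s)
    (@approx_ex s) (x := fun w => blk s (x w : V)) (g := fun w => blk s (g w : V)) a0 (Xx0 s)).
  - by move=> w _; exact: Xx.
  - exact: measurable_blk.
  - exact: measurable_blk.
exact: (measurableT_comp (measurable_coord i) mp).
Qed.

Variables (f : V -> R) (L : 'I_b -> R) (Lhat : R).
Hypotheses (Lhat0 : 0 < Lhat) (LLhat : forall s, L s <= Lhat).
Hypothesis f_descent : forall s x (h : 'cV[R]_(d s)),
  f (x + blockU d s *m h) <= f x + dotv (blk s (grad f x)) h + L s / 2 * enorm h ^+ 2.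
Let alpha := (2 * Lhat)^-1.

Let alpha0 : 0 < alpha. Proof. by rewrite invr_gt0 mulr_gt0. Qed.

(* Both sides are compared with the squared move |h|^2, h = blk s y - blk s x:
   the objective decreases by (5/4) Lhat |h|^2 up to |e|^2 / Lhat + delta, where
   e is the error of the block gradient, and the block of the generalized
   gradient is at most 8 Lhat^2 |h|^2 + 2 |e|^2 + 8 Lhat delta. *)
Lemma bccg_step x y g s delta : prod_set X x ->
  (forall t, t != s -> blk t y = blk t x) ->
  cndg_approx (X s) (phi s) (chi s) alpha delta (blk s x) (blk s g) (blk s y) ->
  enorm (blk s (gen_grad X phi chi x (grad f x) alpha)) ^+ 2 <=
    32 / 5 * Lhat * ((f x + block_sum chi x) - (f y + block_sum chi y))
    + 42 / 5 * enorm (blk s (g - grad f x)) ^+ 2 + 72 / 5 * Lhat * delta.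
Proof.
move=> Xx yx yP; have ai : alpha^-1 = 2 * Lhat by rewrite invrK.
have h1 := cndg_descent (@phi_diff s) (@phi_sc s) alpha0 (Xx s) yP.
have h2 := cndg_prox_dist (@X_closed s) (@X_convex s) (chi_cc s) (@phi_diff s) (@phi_sc s)
  (@approx_ex s) (blk s (grad f x)) alpha0 (Xx s) yP.
have h3 := f_descent x (blk s y - blk s x); rewrite -(blockU_move yx) in h3.
have h4 : block_sum chi y - block_sum chi x = chi s (blk s y) - chi s (blk s x).
  rewrite /block_sum -sumrB (bigD1 s)//= big1 ?addr0// => t ts.
  by rewrite yx// subrr.
(* This Young parameter leaves the coefficient 2 - 1/2 - 1/4 = 5/4 of Lhat |h|^2: the CndG decrease,
   minus the smoothness term, minus the error term. *)
have c0 : 0 < Lhat / 4 by rewrite divr_gt0.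
have h5 := dotv_young (blk s (grad f x) - blk s g) (blk s y - blk s x) c0.
rewrite blk_gen_grad enormZ exprMn real_normK ?num_real// ai blkB.
set p := block_prox _ _ _ _ _ _ in h2 *.
have h6 := enormD_sqr_le (blk s x - blk s y) (blk s y - p).
rewrite subrKA (enormBC (blk s x)) in h6.
move: h1 h2 h3 h5 h6; rewrite ai dotvBl (enormBC (blk s (grad f x))).
have -> : 4 * (Lhat / 4) = Lhat by field.
set E := enorm (blk s g - _) ^+ 2; set H := enorm (blk s y - blk s x) ^+ 2.
set Q := enorm (blk s y - p) ^+ 2; set W := enorm (blk s x - p) ^+ 2.
have H0 : 0 <= H by exact: sqr_ge0.
have -> : 2 * alpha * delta = delta / Lhat by rewrite /alpha; field; rewrite gt_eqF.
have -> : alpha ^+ 2 * E = E / (4 * Lhat ^+ 2) by rewrite /alpha; field; rewrite gt_eqF.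
move=> h1 h2 h3 h5 h6.
have h7 : L s / 2 * H <= Lhat / 2 * H by rewrite ler_wpM2r// ler_wpM2r.
have h8 : (2 * Lhat) ^+ 2 * Q <= 4 * Lhat * delta + E.
  rewrite [leRHS](_ : _ = (2 * Lhat) ^+ 2 * (delta / Lhat + E / (4 * Lhat ^+ 2))).
    by rewrite ler_wpM2l ?sqr_ge0.
  by field; rewrite gt_eqF.
have h9 : (2 * Lhat) ^+ 2 * W <= (2 * Lhat) ^+ 2 * (2 * H + 2 * Q).
  by rewrite ler_wpM2l ?sqr_ge0.
have h10 : Lhat * (f y + block_sum chi y - (f x + block_sum chi x)) <=
    Lhat * (E / Lhat + delta - 5 / 4 * Lhat * H).
  by apply: ler_wpM2l; [exact: ltW|lra].
have {}h10 : Lhat * (f y + block_sum chi y - (f x + block_sum chi x)) <=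
   E + Lhat * delta - 5 / 4 * Lhat ^+ 2 * H.
  by apply: le_trans h10 _; rewrite le_eqVlt; apply/orP; left; apply/eqP; field; rewrite gt_eqF.
move: h8 h9; rewrite exprMn => h8 h9.
(* 8 = (32/5) (5/4), so [h10] is used 32/5 times; then 32/5 + 2 = 42/5 multiplies the squared error
   and 32/5 + 8 = 72/5 multiplies Lhat delta. *)
by nra.
Qed.

End BlockSteps.

(** * Integrals over disjoint groups of samples *)

Section IndependentPairBound.
Local Open Scope ereal_scope.
Context {R : realType} {d d1 d2 : measure_display}.
Context {Omega : measurableType d} {T1 : measurableType d1} {T2 : measurableType d2}.
Variable P : probability Omega R.
Variables (X : Omega -> T1) (Y : Omega -> T2).
Hypotheses (mX : measurable_fun setT X) (mY : measurable_fun setT Y).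
Hypothesis indep : forall A B, measurable A -> measurable B ->
  P (X @^-1` A `&` Y @^-1` B) = P (X @^-1` A) * P (Y @^-1` B).

Lemma ge0_integral_indep_le (h : T1 * T2 -> \bar R) (c : R) :
  measurable_fun setT h -> (forall p, 0 <= h p) ->
  (forall w, \int[P]_v h (X w, Y v) <= c%:E) ->
  \int[P]_w h (X w, Y w) <= c%:E.
Proof.
move=> mh h0 hc; rewrite (ge0_integral_indep mX mY indep mh h0).
pose PY : probability T2 R := distribution P (mfun_of mY).
have E w : \int[P]_v h (X w, Y v) = (fubini_F PY h \o X) w.
  by rewrite /= /fubini_F ge0_integral_distribution//; exact: measurableT_comp.
apply: le_trans (_ : \int[P]_w (cst c%:E) w <= _); last first.
  by rewrite integral_cst//= probability_setT mule1.
apply: ge0_le_integral => //.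
- by move=> w _; exact: integral_ge0.
- apply: (@eq_measurable_fun _ _ _ _ setT (fubini_F PY h \o X)) => [w _|]; first by rewrite E.
  by apply: measurableT_comp => //; exact: measurable_fun_fubini_tonelli_F.
Qed.

End IndependentPairBound.

Section IndependentGroups.
Context {R : realType} {d : measure_display} {Omega : measurableType d}.
Variable P : probability Omega R.
Variables (J : finType) (G : J -> set (set Omega)).
Hypotheses (GI : forall j, setI_closed (G j)) (GT : forall j, G j setT).
Hypothesis Gm : forall j, G j `<=` measurable.
Hypothesis indG : mutually_independent P G.
Local Notation sub A := (g_sigma_algebraType (joint G A)).
Local Open Scope ereal_scope.

(** The second variable is the identity of [Omega] equipped with the sigma-algebra of [B]: fresh
    samples are read off the sample point itself instead of being packed into a tuple. *)
Lemma joint_integral_le (A B : {set J}) d1 (T1 : measurableType d1) (X : Omega -> T1)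
    (h : T1 * sub B -> \bar R) (c : R) :
  (forall j, j \in A -> j \notin B) ->
  measurable_fun (setT : set (sub A)) X ->
  measurable_fun setT h -> (forall p, 0 <= h p) ->
  (forall w, \int[P]_v h (X w, v) <= c%:E) ->
  \int[P]_w h (X w, w) <= c%:E.
Proof.
move=> AB mX mh h0 hc.
have mY : measurable_fun (setT : set (sub B)) (fun w : sub B => w) by exact: measurable_id.
apply: (@ge0_integral_indep_le _ _ _ _ _ _ (sub B) P X (fun w => w)) => //.
- exact: (joint_measurable_fun Gm mX).
- exact: (joint_measurable_fun Gm mY).
- exact: (joint_indep_preimage GI GT Gm indG AB mX mY).
Qed.

(** The randomly selected value is split over the events that fix the index; each [Y s] is
    independent of the indicator of its event. *)
Lemma joint_index_integral (I : finType) (A B : {set J}) (i : Omega -> I) (p : I -> R)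
    (Y : I -> Omega -> R) :
  (forall j, j \in A -> j \notin B) ->
  (forall s, measurable_fun (setT : set (sub A)) (Y s)) -> (forall s w, 0 <= Y s w)%R ->
  (forall s, <<s joint G B >> (i @^-1` [set s])) ->
  (forall s, P (i @^-1` [set s]) = (p s)%:E) ->
  \int[P]_w (Y (i w) w)%:E = \sum_s (p s)%:E * \int[P]_w (Y s w)%:E.
Proof.
move=> AB mY Y0 mi ip.
pose e s w : R := (\1_(i @^-1` [set s]) w)%R.
have me s : measurable_fun (setT : set (sub B)) (e s).
  by apply: (@measurable_indic _ (sub B)); exact: mi.
have e0 s w : (0 <= e s w)%R by rewrite /e indicE.
have mYO s := joint_measurable_fun Gm (mY s).
have meO s := joint_measurable_fun Gm (me s).
transitivity (\int[P]_w \sum_s (Y s w * e s w)%:E).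
  apply: eq_integral => w _; rewrite sumEFin (bigD1 (i w))//= big1 => [|s si].
    by rewrite /e indicE mem_set// mulr1 addr0.
  by rewrite /e indicE memNset ?mulr0// => /= si'; rewrite si' eqxx in si.
rewrite ge0_integral_sum//; last 2 first.
- by move=> s; apply/measurable_EFinP; exact: measurable_funM.
- by move=> s w _; rewrite lee_fin mulr_ge0.
apply: eq_bigr => s _.
have -> : \int[P]_w (Y s w * e s w)%:E = \int[P]_w \int[P]_v (Y s w * e s v)%:E.
  have ind := joint_indep_preimage GI GT Gm indG AB (mY s) (me s).
  have absE (x y : R) : (0 <= x)%R -> (0 <= y)%R -> `|(x * y)%:E| = (x * y)%:E.
    by move=> x0 y0; rewrite gee0_abs// lee_fin mulr_ge0.
  transitivity (\int[P]_w `|(Y s w * e s w)%:E|).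
    by apply: eq_integral => w _; rewrite absE.
  rewrite (ge0_integral_indep (mYO s) (meO s) ind (h := fun q : R * R => `|(q.1 * q.2)%:E|))//.
    by apply: eq_integral => w _; apply: eq_integral => v _ /=; rewrite (ger0_norm (mulr_ge0 (Y0 s w) (e0 s v))).
  by apply: measurableT_comp => //; apply/measurable_EFinP; exact: measurable_funM.
rewrite muleC -ge0_integralZr//; last 3 first.
- exact/measurable_EFinP.
- by move=> w _; rewrite lee_fin.
- by rewrite -ip measure_ge0.
apply: eq_integral => w _; under eq_integral do rewrite EFinM.
rewrite ge0_integralZl//; last 3 first.
- exact/measurable_EFinP.
- by move=> v _; rewrite lee_fin.
- by rewrite lee_fin.
have mis : measurable (i @^-1` [set s]) by exact: (joint_measurable Gm (mi s)).
by rewrite -(ip s) /e integral_indic// setIT.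
Qed.

Lemma joint_bigcap_le (I : eqType) (Gr : I -> {set J}) (E : I -> set Omega) (q : R) (s : seq I) :
  (forall i i' j, j \in Gr i -> j \in Gr i' -> i = i') ->
  (forall i, <<s joint G (Gr i) >> (E i)) -> (forall i, P (E i) <= q%:E) -> uniq s ->
  P [set w | forall i, i \in s -> E i w] <= (q ^+ size s)%:E.
Proof.
move=> disj mE Eq.
pose U (t : seq I) : {set J} := [set j | has (fun i => j \in Gr i) t]%SET.
(* Measurability for the union of the groups is carried through the induction, because splitting off
   the next event requires it. *)
suff H : uniq s -> <<s joint G (U s) >> [set w | forall i, i \in s -> E i w] /\
    P [set w | forall i, i \in s -> E i w] <= (q ^+ size s)%:E by move=> /H[].
elim: s => [_|a s IH /= /andP[as_ us]].
  rewrite (_ : [set w | _] = setT); last by apply/seteqP; split.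
  split; last by rewrite probability_setT expr0.
  exact: (@measurableT _ (sub (U [::]))).
have [ms Ps] := IH us.
have -> : [set w | forall i, i \in a :: s -> E i w] =
    E a `&` [set w | forall i, i \in s -> E i w].
  apply/seteqP; split => w /= h.
    by split => [|i si]; apply: h; rewrite inE ?eqxx// si orbT.
  by move=> i; rewrite inE => /orP[/eqP ->|]; [exact: h.1|exact: h.2].
have q0 : (0 <= q)%R by rewrite -lee_fin; apply: le_trans (Eq a).
split.
  apply: (@measurableI _ (sub (U (a :: s)))).
    apply: sub_joint (mE a); apply/fintype.subsetP => j ja.
    by rewrite finset.inE /= ja.
  apply: sub_joint ms; apply/fintype.subsetP => j.
  by rewrite !finset.inE /= => ->; rewrite orbT.
rewrite (joint_indep GI GT Gm indG (A := Gr a) (B := U s))//.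
  by rewrite exprS EFinM lee_pmul.
move=> j ja; rewrite finset.inE; apply/hasPn => i si.
by apply: contra as_ => ji; rewrite (disj _ _ _ ja ji).
Qed.

End IndependentGroups.

(** * Constants *)

Section RunConstants.
Context {R : realType}.

(** The alternatives for [B] are the two arguments of the outer minimum in the batch size. With m A
    = a^2 tau, the first gives m A / B <= a Dt / om, to which k1 >= 1 is applied; the second gives m
    A / B <= a^2, where om a <= k1 Dt is used. *)
Lemma sampling_error_le (om m A a Dt tau B k1 : R) :
  3 <= om -> 0 <= a -> 0 < Dt -> 1 <= B -> 1 <= k1 -> om * a <= k1 * Dt ->
  m * A = a ^+ 2 * tau -> om * a * tau / Dt <= B \/ tau <= B ->
  m * A / B <= a * k1 * Dt / om.
Proof.
move=> om3 a0 Dt0 B1 k1_1 k1_ge mAE B_ge.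
have om0 : 0 < om by lra.
have Bp : 0 < B by lra.
rewrite ler_pdivrMr// mulrAC ler_pdivlMr// mAE.
have h1 : a * (om * a) <= a * (k1 * Dt) by rewrite ler_wpM2l.
case: B_ge => [|h].
  rewrite ler_pdivrMr// => h.
  have h2 : a * (om * a * tau) <= a * (B * Dt) by rewrite ler_wpM2l.
  have h3 : a * (B * Dt) <= a * (B * Dt) * k1.
    by rewrite ler_peMr// mulr_ge0// mulr_ge0// ltW.
  by lra.
have h2 : a * (om * a) * tau <= a * (om * a) * B.
  by rewrite ler_wpM2l// mulr_ge0// mulr_ge0// ltW.
have h3 : a * (om * a) * B <= a * (k1 * Dt) * B by rewrite ler_wpM2r// ltW.
by lra.
Qed.

(** In the application m = n + 4, A = 2 M^2 + sigma^2, a = sqrt (m A / tau), H = Lhat^2 DPhi^2 +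
    Lhat, W = Lf^2 DPhi^2 and E = mu^2 Lf^2 m^3, while V and beta are the second moment and the
    squared bias of one sample. Everything is compared termwise with the expansion of 2 bb om C. *)
Lemma run_constant_bound (bb om m A a Dt tau H W E V beta B T k1 k2 C : R) :
  1 <= bb -> 3 <= om -> 5 <= m -> 0 <= a -> 0 < Dt -> 1 <= tau -> 0 <= H -> 0 <= W ->
  1 <= B -> 0 < T -> 1 <= k1 -> om * a <= k1 * Dt -> 1 <= k2 -> m * A = a ^+ 2 * tau ->
  om * a * tau / Dt <= B \/ tau <= B -> B <= om * a * tau / Dt + 16 / 15 * om * m ->
  tau <= 2 * B * T -> 0 <= E -> E <= W * bb * m / tau ->
  V <= 2 * m * A + E / 2 -> beta <= E / 4 ->
  C = 8 * a * (2 * k1 * Dt + H / Dt) + ((16 * k2 + 1) * W + 8 * H) * m / tau ->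
  bb / T * (32 / 5 * H) + 42 / 5 * (2 * (V / B) + 2 * beta) <= 2 * bb * om * C.
Proof.
move=> bb1 om3 m5 a0 Dt0 tau1 H0 W0 B1 T0 k1_1 k1_ge k2_1 mAE B_ge B_le T_large E0 E_le.
move=> V_le beta_le C_def.
have tau0 : 0 < tau by lra.
have mA_le := sampling_error_le om3 a0 Dt0 B1 k1_1 k1_ge mAE B_ge.
have om0 : 0 < om by lra.
have bb0 : 0 < bb by lra.
have Bp : 0 < B by lra.
have K3 : 3 <= bb * om by nra.
have K0 : 0 < bb * om by lra.
have p1 : 0 <= H * a / Dt by rewrite divr_ge0 ?mulr_ge0// ltW.
have p2 : 0 <= H * m / tau by rewrite divr_ge0 ?mulr_ge0// ?ltW//; lra.
have p3 : 0 <= W * m / tau by rewrite divr_ge0 ?mulr_ge0// ?ltW//; lra.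
have p4 : 0 <= a * k1 * Dt by rewrite !mulr_ge0// ?ltW//; lra.
(* From 1 / T <= 2 B / tau the coefficients 64/5 and (64/5) (16/15) = 1024/75 arise, the latter
   rounded up to 16. *)
have i1 : bb / T * (32 / 5 * H) <= bb * om * (64 / 5 * (H * a / Dt) + 16 * (H * m / tau)).
  have iT : T^-1 <= 2 * B / tau.
    by rewrite -[leLHS]mul1r ler_pdivrMr// mulrAC ler_pdivlMr// mul1r.
  have iB : 2 * B / tau <= 2 * (om * a * tau / Dt + 16 / 15 * om * m) / tau.
    by rewrite ler_wpM2r ?invr_ge0 ?(ltW tau0)// ler_wpM2l.
  have h : bb * (32 / 5 * H) * T^-1 <= bb * (32 / 5 * H) *
     (2 * (om * a * tau / Dt + 16 / 15 * om * m) / tau).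
    apply: ler_wpM2l; last exact: le_trans iT iB.
    by rewrite !mulr_ge0// ltW.
  rewrite mulrAC; apply: le_trans h _.
  rewrite (_ : _ * _ = bb * om * (64 / 5 * (H * a / Dt) + 1024 / 75 * (H * m / tau))); last first.
    by field; rewrite !gt_eqF.
  by rewrite ler_pM2l// lerD2l ler_wpM2r//; lra.
have i2 : V / B <= 2 * (a * k1 * Dt / om) + E / 2.
  apply: le_trans (_ : (2 * m * A + E / 2) / B <= _); first by rewrite ler_wpM2r ?invr_ge0 ?(ltW Bp).
  rewrite mulrDl -mulrA -mulrA; apply: lerD; first by rewrite ler_wpM2l// mulrA.
  by rewrite ler_pdivrMr// ler_peMr// divr_ge0.
have i3 : a * k1 * Dt / om <= a * k1 * Dt / 3.
  by rewrite ler_wpM2l// lef_pV2// posrE.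
have i4 : 3 * (a * k1 * Dt) <= bb * om * (a * k1 * Dt) by rewrite ler_wpM2r.
have i5 : W * bb * m / tau <= bb * om * (W * m / tau) / 3.
  rewrite (_ : W * bb * m / tau = bb * (W * m / tau)); last by ring.
  have : bb * 3 * (W * m / tau) <= bb * om * (W * m / tau) by rewrite ler_wpM2r// ler_pM2l.
  by lra.
have -> : 2 * bb * om * C = bb * om * (32 * (a * k1 * Dt) + 16 * (H * a / Dt)
   + 2 * (16 * k2 + 1) * (W * m / tau) + 16 * (H * m / tau)).
  by rewrite C_def; field; rewrite !gt_eqF.
have q1 : 0 <= bb * om * (H * a / Dt) by rewrite mulr_ge0 ?(ltW K0).
have q3 : 0 <= bb * om * (W * m / tau) by rewrite mulr_ge0 ?(ltW K0).
(* 34 is the value of 2 (16 k2 + 1) at k2 = 1. *)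
have q4 : bb * om * (W * m / tau) * 34 <= bb * om * (W * m / tau) * (2 * (16 * k2 + 1)).
  by rewrite ler_wpM2l//; lra.
move: i1 i2 i3 i4 i5 q1 q3 q4 p4; rewrite !(mulrDr (bb * om)).
rewrite (_ : bb * om * (2 * (16 * k2 + 1) * (W * m / tau)) =
   bb * om * (W * m / tau) * (2 * (16 * k2 + 1))); last by ring.
rewrite (mulrCA (bb * om) 32) (mulrCA (bb * om) 16 (H * a / Dt)) (mulrCA (bb * om) 16).
rewrite (mulrCA (bb * om) (64 / 5)).
move: (bb * om * (H * a / Dt)) (bb * om * (H * m / tau)) (bb * om * (W * m / tau)) => x1 x2 x3.
move: (bb * om * (a * k1 * Dt)) (a * k1 * Dt / om) (a * k1 * Dt) => x4 x5 x6.
move: (bb / T * (32 / 5 * H)) (x3 * (2 * _)) (V / B) (W * bb * m / tau) E_le beta_le.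
by move=> x7 x8 x9 x10 *; lra.
Qed.

Lemma run_constant_le (bb om m A Dt tau H W E V beta B T k1 k2 C : R) :
  let target := Num.min (Num.max (om * Num.sqrt (m * A * tau) / Dt) (om * m)) tau in
  1 <= bb -> 3 <= om -> 5 <= m -> 0 <= A -> 0 < Dt -> 1 <= tau -> 0 <= H -> 0 <= W ->
  1 <= B -> 0 < T -> target <= B -> B <= target + 1 ->
  tau <= 2 * B * T -> 0 <= E -> E <= W * bb * m / tau ->
  V <= 2 * m * A + E / 2 -> beta <= E / 4 ->
  k1 = Num.max (om * Num.sqrt (m * A) / (Dt * Num.sqrt tau)) 1 -> 1 <= k2 ->
  C = 8 * Num.sqrt (m * A) / Num.sqrt tau * (2 * k1 * Dt + H / Dt)
    + ((16 * k2 + 1) * W + 8 * H) * m / tau ->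
  bb / T * (32 / 5 * H) + 42 / 5 * (2 * (V / B) + 2 * beta) <= 2 * bb * om * C.
Proof.
move=> target bb1 om3 m5 A0 Dt0 tau1 H0 W0 B1 T0 B_ge B_lt T_large E0 E_le V_le beta_le k1E k2_1 CE.
pose a := Num.sqrt (m * A) / Num.sqrt tau.
have a0 : 0 <= a by rewrite divr_ge0 ?sqrtr_ge0.
have tau0 : 0 < tau by lra.
have r0 : 0 < Num.sqrt tau by rewrite sqrtr_gt0.
have mA0 : 0 <= m * A by rewrite mulr_ge0//; lra.
have om0 : 0 < om by lra.
have mAE : m * A = a ^+ 2 * tau.
  by rewrite exprMn exprVn !sqr_sqrtr ?(ltW tau0)// divfK// gt_eqF.
have sqrtE : Num.sqrt (m * A * tau) = a * tau.
  by rewrite mAE -mulrA -expr2 -exprMn sqrtr_sqr ger0_norm// mulr_ge0// ltW.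
have k1_ge : om * a <= k1 * Dt.
  rewrite -ler_pdivrMr// k1E le_max /a; apply/orP; left.
  by rewrite le_eqVlt; apply/orP; left; apply/eqP; field; rewrite !gt_eqF.
move: B_ge B_lt; rewrite /target sqrtE (mulrA om); set x := om * a * tau / Dt => B_ge B_lt.
apply: (run_constant_bound (a := a) (E := E) bb1 om3 m5 a0 Dt0 tau1 H0 W0 B1 T0 _ k1_ge k2_1 mAE) => //.
- by rewrite k1E le_max lexx orbT.
- move: B_ge; rewrite ge_min => /orP[|h]; last by right.
  by rewrite ge_max => /andP[h _]; left.
- have x0 : 0 <= x by rewrite divr_ge0 ?(ltW Dt0)// mulr_ge0 ?(ltW tau0)// mulr_ge0// ltW.
  (* The 1 added by rounding up is thus at most om m / 15, whence the coefficient 16/15. *)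
  have omm : 15 <= om * m by nra.
  have : Num.max x (om * m) <= x + om * m by rewrite ge_max lerDl lerDr x0; lra.
  have : Num.min (Num.max x (om * m)) tau <= Num.max x (om * m) by rewrite ge_min lexx.
  by rewrite -/x; lra.
- by rewrite CE /a; ring.
Qed.

(** The bias contributes 12 beta <= 3 E, the lambda-free term. The fluctuation contributes 12 lambda
    V / N, with coefficients 24 and 6 that both fit under 32. *)
Lemma post_constant_le (bb om m A tau W E V beta N C lambda : R) :
  0 < tau -> 0 <= W -> 0 <= bb -> 0 <= m -> 0 < N -> 0 < lambda -> 0 <= A ->
  E <= W * bb * m / tau -> V <= 2 * m * A + E / 2 -> beta <= E / 4 ->
  8 * (2 * bb * om * C) + 6 * (2 * (lambda * (V / N)) + 2 * beta) <=
  16 * bb * om * C + 3 * W * bb * m / tau + 32 * m * lambda / N * (A + W * bb / tau).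
Proof.
move=> tau0 W0 bb0 m0 N0 l0 A0 E_le V_le beta_le.
have lN : 0 < lambda / N by rewrite divr_gt0.
have h : lambda / N * V <= lambda / N * (2 * m * A + W * bb * m / tau / 2).
  by rewrite ler_pM2l//; lra.
have p1 : 0 <= lambda / N * (m * A) by rewrite mulr_ge0 ?(ltW lN) ?mulr_ge0.
have p2 : 0 <= lambda / N * (W * bb * m / tau).
  by rewrite mulr_ge0 ?(ltW lN)// divr_ge0 ?(ltW tau0)// !mulr_ge0.
rewrite (mulrA lambda) [lambda * V]mulrC -mulrA (mulrC V).
have -> : 32 * m * lambda / N * (A + W * bb / tau) =
  32 * (lambda / N * (m * A)) + 32 * (lambda / N * (W * bb * m / tau)) by ring.
by lra.
Qed.

End RunConstants.

(** * The two-phase method *)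

Section FiniteIndex.
Context {dT : measure_display} {T : measurableType dT} {I : finType}.

Lemma measurable_finite_preimage (i : T -> I) (A : set I) :
  (forall s, measurable (i @^-1` [set s])) -> measurable (i @^-1` A).
Proof.
move=> mi; rewrite (_ : _ @^-1` _ = \bigcup_(s in A) i @^-1` [set s]).
  by apply: fin_bigcup_measurable => //; exact: finite_finset.
by apply/seteqP; split => [w Aw|w [s As /= ->//]]; exists (i w).
Qed.

Lemma measurable_index {R : realType} (i : T -> I) (Y : I -> T -> R) :
  (forall s, measurable (i @^-1` [set s])) -> (forall s, measurable_fun setT (Y s)) ->
  measurable_fun setT (fun w => Y (i w) w).
Proof.
move=> mi mY; rewrite (_ : (fun w => _) = fun w => \sum_s Y s w * \1_(i @^-1` [set s]) w).
  apply: measurable_sum => s; apply: measurable_funM => //.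
apply/funext => w; rewrite (bigD1 (i w))//= big1 => [|s si].
  by rewrite indicE mem_set// mulr1 addr0.
by rewrite indicE memNset ?mulr0// => /= si'; rewrite si' eqxx in si.
Qed.

End FiniteIndex.

Lemma setI_closed_preimage T1 T2 (X : T1 -> T2) (G : set (set T2)) :
  setI_closed G -> setI_closed (preimage_set_system setT X G).
Proof.
move=> GI _ _ [A GA <-] [C GC <-]; exists (A `&` C); first exact: GI.
by rewrite !setTI.
Qed.

Lemma integral_indicT {R : realType} {dT : measure_display} {T : measurableType dT}
    (P : probability T R) (A : set T) : measurable A -> (\int[P]_w (\1_A w)%:E = P A)%E.
Proof. by move=> mA; rewrite integral_indic// setIT. Qed.

Section RunIterates.
Context {R : realType}.
Variables (b : nat) (d : 'I_b -> nat).
Local Notation V := (blockvec R d).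
Local Notation n := (\sum_(s < b) d s)%N.
Variables (X : forall s : 'I_b, set 'cV[R]_(d s)).
Arguments X : clear implicits.
Hypotheses (X_closed : forall s, closed (X s))
  (X_convex : forall s, convex_set (M := 'cV[R]_(d s)) (X s)).
Context {dXi : measure_display} {Xi : measurableType dXi}.
Variables (D : probability Xi R) (F : V -> Xi -> R).
Hypothesis F_borel : measurable_fun setT (fun q : borel V * Xi => F q.1 q.2).
Variable f : V -> R.
Variables (chi phi : forall s : 'I_b, 'cV[R]_(d s) -> R).
Arguments chi : clear implicits.
Arguments phi : clear implicits.
Hypothesis chi_cc : forall s, closed_convex_fun (chi s).
Variable Phistar : R.
Hypothesis Phistar_le : forall x, prod_set X x -> Phistar <= f x + block_sum chi x.
Hypothesis phi_diff : forall s x, differentiable (phi s) x.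
Hypothesis phi_sc : forall s, strongly_convex1 (phi s).
Variables (sigma M Lf : R) (L : 'I_b -> R).
Hypothesis Lf0 : 0 < Lf.
Hypothesis A1 : assumption1 F D f (prod_set X) sigma.
Hypothesis A2 : assumption2 F D Lf L.
Hypothesis A3 : assumption3 f (prod_set X) M.
Variables (Lhat : R) (x1 : V) (mu : R).
Hypotheses (Lhat0 : 0 < Lhat) (LLhat : forall s, L s <= Lhat).
Hypotheses (x1_X : prod_set X x1) (mu0 : 0 < mu).
Variables (S T B N : nat).
Hypotheses (T0 : (0 < T)%N) (B0 : (0 < B)%N) (N0 : (0 < N)%N).
Variable cndg : forall s : 'I_b, 'cV[R]_(d s) -> 'cV[R]_(d s) -> R -> R -> 'cV[R]_(d s).
Arguments cndg : clear implicits.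
Hypothesis cndgP : cndg_implementation X phi chi cndg.
Context {dO : measure_display} {Omega : measurableType dO}.
Variable P : probability Omega R.
Variables (idx : 'I_S -> nat -> Omega -> 'I_b) (out : 'I_S -> Omega -> 'I_T).
Variables (z : 'I_S -> nat -> nat -> Omega -> Xi).
Variables (u : 'I_S -> nat -> nat -> Omega -> borel V).
Variables (zpost : nat -> Omega -> Xi) (upost : nat -> Omega -> borel V).
Hypothesis idx_law : forall i (k : 'I_T), finite_law P (idx i k) (fun=> b%:R^-1).
Variable q : R.
Hypothesis out_law : forall i, finite_law P (out i) (fun=> q).
Hypothesis z_law : forall i (k : 'I_T) (t : 'I_B), has_law P (z i k t) D.
Hypothesis u_law : forall i (k : 'I_T) (t : 'I_B), std_gaussian P (u i k t).
Hypothesis zpost_law : forall k : 'I_N, has_law P (zpost k) D.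
Hypothesis upost_law : forall k : 'I_N, std_gaussian P (upost k).
Hypothesis independent : samples_independent P B N idx out z u zpost upost.

Local Notation alpha := (2 * Lhat)^-1.
Local Notation delta := ((3 * T%:R)^-1 : R).
Local Notation J := ('I_S * 'I_T + ('I_S + ('I_S * 'I_T * 'I_B +
  ('I_S * 'I_T * 'I_B + ('I_N + 'I_N)))))%type.
Let G : J -> set (set Omega) := sample_sigma idx out z u zpost upost.
Local Notation sub A := (g_sigma_algebraType (joint G A)).

Let GI j : setI_closed (G j).
Proof.
by case: j => [[i k]|[i|[[[i k] t]|[[[i k] t]|[k|k]]]]];
  apply: setI_closed_preimage => A C mA mC //; exact: measurableI.
Qed.

Let GT j : G j setT.
Proof.
by case: j => [[i k]|[i|[[[i k] t]|[[[i k] t]|[k|k]]]]]; exists setT => //; rewrite setTI.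
Qed.

Let Gm j : G j `<=` measurable.
Proof.
case: j => [[i k]|[i|[[[i k] t]|[[[i k] t]|[k|k]]]]] _ [A mA <-].
- rewrite setTI; apply: measurable_finite_preimage => s.
  by case: (idx_law i k s).
- rewrite setTI; apply: measurable_finite_preimage => s.
  by case: (out_law i s).
- by case: (z_law i k t) => + _; exact.
- by case: (u_law i k t) => + _; exact.
- by case: (zpost_law k) => + _; exact.
- by case: (upost_law k) => + _; exact.
Qed.

Let indG : mutually_independent P G := independent.

(* Sets of indices of the sample sigma-algebras: [past i k] determines the first
   [k] steps of run [i], [batch i k] the oracle samples of its step [k], and
   [run i] the whole run, including the choice of its output. *)
Let in_step (i : 'I_S) (p : pred 'I_T) (j : J) : bool :=
  match j with
  | inl (i', k) => (i' == i) && p k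
  | inr (inr (inl (i', k, _))) => (i' == i) && p k
  | inr (inr (inr (inl (i', k, _)))) => (i' == i) && p k
  | _ => false
  end.

Let past i (k : nat) : {set J} := [set j | in_step i (fun l => (l < k)%N) j]%SET.

Let batch i (k : 'I_T) : {set J} :=
  [set j : J | if j is inl _ then false else in_step i (pred1 k) j]%SET.

Let run i : {set J} :=
  [set j : J | if j is inr (inl i') then i' == i else in_step i predT j]%SET.

Let post : {set J} := [set j : J | if j is inr (inr (inr (inr _))) then true else false]%SET.

Let iterate i k w := zs_bccg F cndg mu (fun=> alpha) (fun=> delta) (fun=> B) x1
  (fun k => idx i k w) (fun k t => z i k t w) (fun k t => u i k t w) k.

Let Gbar i k w (x : V) := avg_zo_grad F mu B (fun t => z i k t w) (fun t => u i k t w) x.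

Let alpha0 : 0 < alpha. Proof. by rewrite invr_gt0 mulr_gt0. Qed.
Let delta0 : 0 < delta. Proof. by rewrite invr_gt0 mulr_gt0// ltr0n. Qed.

Let cndg_approxP s x g : X s x ->
  cndg_approx (X s) (phi s) (chi s) alpha delta x g (cndg s x g alpha delta).
Proof.
move=> Xx; apply: (cndg_output_approx (@X_convex s)) => //.
by have [+ _] := @cndgP s alpha delta alpha0 delta0; exact.
Qed.

Let approx_ex s (a e : R) x g : 0 < a -> 0 < e -> X s x ->
  exists y, cndg_approx (X s) (phi s) (chi s) a e x g y.
Proof.
move=> a0 e0 Xx; exists (cndg s x g a e); apply: (cndg_output_approx (@X_convex s)) => //.
by have [+ _] := @cndgP s a e a0 e0; exact.
Qed.

Let blk_iterateS i k w s : blk s (iterate i k.+1 w) =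
  if s == idx i k w then cndg s (blk s (iterate i k w))
                                (blk s (Gbar i k w (iterate i k w))) alpha delta
  else blk s (iterate i k w).
Proof. exact: blk_mxcol. Qed.

Let iterate_X i k w : prod_set X (iterate i k w).
Proof.
elim: k => [|k IH] s; first exact: x1_X.
rewrite blk_iterateS; case: ifP => _; last exact: IH.
by case: (cndg_approxP (blk s (Gbar i k w (iterate i k w))) (IH s)).
Qed.

Let X_borel s : measurable (X s : set (borel 'cV[R]_(d s))).
Proof. by apply: closed_borel; exact: X_closed. Qed.

Let sub_past i k : past i k \subset past i k.+1.
Proof.
apply/fintype.subsetP; case=> [[i' l]|[i'|[[[i' l] t]|[[[i' l] t]|[l|l]]]]];
  by rewrite !finset.inE//= => /andP[-> /ltnW].
Qed.

Let idx_past i (k : 'I_T) s : <<s joint G (past i k.+1) >> (idx i k @^-1` [set s]).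
Proof.
apply: sub_sigma_algebra; exists (inl (i, k)); first by rewrite /= finset.inE /= eqxx /=.
by exists [set s] => //; rewrite setTI.
Qed.

Let z_measurable (A : {set J}) i (k : 'I_T) (t : 'I_B) :
  inr (inr (inl (i, k, t))) \in A -> measurable_fun (setT : set (sub A)) (z i k t).
Proof. by move=> jA; exact: (@generated_joint_measurable_fun R _ _ _ _ _ _ _ _ _ jA). Qed.

Let u_measurable (A : {set J}) i (k : 'I_T) (t : 'I_B) :
  inr (inr (inr (inl (i, k, t)))) \in A -> measurable_fun (setT : set (sub A)) (u i k t).
Proof. by move=> jA; exact: (@generated_joint_measurable_fun R _ _ _ _ _ _ _ _ _ jA). Qed.

(** Only the samples of the first k steps are involved, which makes the iterate independent of the
    next batch and the next block index. The restriction to k <= T reflects that the family of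
    sigma-algebras stops there. *)
Let iterate_measurable i k : (k <= T)%N ->
  measurable_fun (setT : set (sub (past i k))) (iterate i k : Omega -> borel V).
Proof.
elim: k => [_|k IH kT]; first exact: measurable_cst.
have {IH}mx : measurable_fun (setT : set (sub (past i k.+1))) (iterate i k : Omega -> borel V).
  exact: (sub_joint_measurable_fun (sub_past i k) (IH (ltnW kT))).
have mG : measurable_fun (setT : set (sub (past i k.+1)))
    (fun w => Gbar i k w (iterate i k w) : borel V).
  apply: measurable_borel => j; apply: (measurable_avg_zo_grad F_borel mu _ mx) => t.
    by apply: (z_measurable (k := Ordinal kT)); rewrite finset.inE /= eqxx /=.
  by apply: (u_measurable (k := Ordinal kT)); rewrite finset.inE /= eqxx /=.
have mC s : measurable_fun (setT : set (sub (past i k.+1)))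
    (fun w => cndg s (blk s (iterate i k w)) (blk s (Gbar i k w (iterate i k w))) alpha delta
              : borel 'cV[R]_(d s)).
  have [_ mc] := @cndgP s alpha delta alpha0 delta0.
  pose p w := (blk s (iterate i k w) : borel 'cV[R]_(d s),
               blk s (Gbar i k w (iterate i k w)) : borel 'cV[R]_(d s)).
  have mp : measurable_fun (setT : set (sub (past i k.+1))) p.
    by apply: measurable_fun_pair; [exact: measurable_blk|exact: measurable_blk].
  have mX : measurable (X s `*` setT : set (borel 'cV[R]_(d s) * borel 'cV[R]_(d s))).
    exact: measurableX.
  apply: (measurable_comp mX _ mc mp).
  by move=> _ [w _ <-]; split => //=; exact: iterate_X.
apply: measurable_mxcol => s; apply: measurable_fun_ifT => //.
- apply: (measurable_fun_bool true); rewrite setTI.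
  have mi : <<s joint G (past i k.+1) >> (idx i k @^-1` [set s]) := @idx_past i (Ordinal kT) s.
  have E : idx i k @^-1` [set s] = (fun t => s == idx i k t) @^-1` [set true].
    by apply/seteqP; split => w /=; rewrite eq_sym => /eqP.
  by rewrite E in mi.
- exact: (measurable_blk (s := s) mx).
Qed.

Let gg (x : V) := gen_grad X phi chi x (grad f x) alpha.

Let gap i k w s := enorm (blk s (gg (iterate i k w))) ^+ 2.

Let err i k w s :=
  enorm (blk s (Gbar i k w (iterate i k w) - grad f (iterate i k w))) ^+ 2.

(** The second [Lhat] pays for the CndG tolerances accumulated over the run. *)
Let H := Lhat * (f x1 + block_sum chi x1 - Phistar) + Lhat.

Let run_descent i w : \sum_(k < T) gap i k w (idx i k w) <=
  32 / 5 * H + 42 / 5 * \sum_(k < T) err i k w (idx i k w).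
Proof.
pose Phi x := f x + block_sum chi x.
have step m : \sum_(k < m) gap i k w (idx i k w) <= 32 / 5 * Lhat * (Phi x1 - Phi (iterate i m w))
    + 42 / 5 * (\sum_(k < m) err i k w (idx i k w)) + m%:R * (72 / 5 * Lhat * delta).
  elim: m => [|m IH]; first by rewrite !big_ord0 subrr !mulr0 mul0r !addr0.
  rewrite !big_ord_recr/= -natr1.
  have : gap i m w (idx i m w) <= 32 / 5 * Lhat * (Phi (iterate i m w) - Phi (iterate i m.+1 w))
      + 42 / 5 * err i m w (idx i m w) + 72 / 5 * Lhat * delta.
    apply: (bccg_step X_closed X_convex chi_cc phi_diff phi_sc approx_ex Lhat0 LLhat
      (block_descent A1 A2)) => [||].
    - exact: iterate_X.
    - by move=> t ts; rewrite blk_iterateS (negbTE ts).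
    - by rewrite blk_iterateS eqxx; exact/cndg_approxP/iterate_X.
  move: IH; set dl := 72 / 5 * Lhat * delta; set s1 := \sum_(k < m) gap _ _ _ _.
  set s2 := \sum_(k < m) err _ _ _ _; set p1 := Phi x1; set p2 := Phi (iterate i m w).
  by set p3 := Phi _; lra.
have := step T; have := Phistar_le (iterate_X i T w); rewrite -/(Phi _).
(* With delta = 1 / (3 T), the T tolerances add up to 24/5 Lhat, within the 32/5 Lhat available in
   32/5 H. *)
have -> : T%:R * (72 / 5 * Lhat * delta) = 24 / 5 * Lhat.
  by field; rewrite pnatr_eq0 -lt0n.
have L0 := Lhat0; rewrite /H -/(Phi x1).
set s1 := \sum_(k < T) gap _ _ _ _; set s2 := \sum_(k < T) err _ _ _ _.
move=> h1 h2; have h3 : Lhat * (Phi x1 - Phi (iterate i T w)) <= Lhat * (Phi x1 - Phistar).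
  by rewrite ler_pM2l// lerD2l lerN2.
by lra.
Qed.

Let H0 : 0 <= H.
Proof.
by rewrite /H addr_ge0 ?(ltW Lhat0)// mulr_ge0 ?(ltW Lhat0)// subr_ge0; exact: Phistar_le.
Qed.

Let f_diff x : differentiable f x.
Proof. by case: A1 => _ /(_ x)[+ _] _; exact. Qed.

Let measurable_gradf dT (Tm : measurableType dT) (x : Tm -> borel V) :
  measurable_fun setT x -> measurable_fun setT (fun o => grad f (x o) : borel V).
Proof.
move=> mx; apply: measurable_borel => j.
exact: (measurableT_comp (measurable_grad j f_diff) mx).
Qed.

Let measurable_gap dT (Tm : measurableType dT) (x : Tm -> borel V) s :
  measurable_fun setT x -> (forall o, prod_set X (x o)) ->
  measurable_fun setT (fun o => enorm (blk s (gg (x o))) ^+ 2).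
Proof.
move=> mx Xx; apply: measurable_enorm_sqr => j.
exact: (measurable_blk_gen_grad X_closed X_convex chi_cc phi_diff phi_sc approx_ex j alpha0
  x1_X Xx mx (measurable_gradf mx)).
Qed.

Let measurable_gg dT (Tm : measurableType dT) (x : Tm -> borel V) :
  measurable_fun setT x -> (forall o, prod_set X (x o)) ->
  measurable_fun setT (fun o => enorm (gg (x o)) ^+ 2).
Proof.
move=> mx Xx; rewrite (_ : (fun o => _) = fun o => \sum_s enorm (blk s (gg (x o))) ^+ 2).
  by apply: measurable_sum => s; exact: measurable_gap.
by apply/funext => o; rewrite enorm_sqr_blk.
Qed.

Let measurable_Gbar dT (Tm : measurableType dT) i k (x : Tm -> borel V) (e : Tm -> Omega) j :
  measurable_fun setT x -> (forall t : 'I_B, measurable_fun setT (z i k t \o e)) ->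
  (forall t : 'I_B, measurable_fun setT (u i k t \o e)) ->
  measurable_fun setT (fun o => (Gbar i k (e o) (x o) - grad f (x o)) j 0).
Proof.
move=> mx mz mu'.
rewrite (_ : (fun o => _) = fun o => Gbar i k (e o) (x o) j 0 - grad f (x o) j 0); last first.
  by apply/funext => o; rewrite mxE [X in _ + X]mxE.
apply: measurable_funB; last exact: (measurableT_comp (measurable_grad j f_diff) mx).
exact: (measurable_avg_zo_grad F_borel mu j mx mz mu').
Qed.

Let past_batch i (k : 'I_T) j : j \in past i k -> j \notin batch i k.
Proof.
by case: j => [[i' l]|[i'|[[[i' l] t]|[[[i' l] t]|[l|l]]]]]; rewrite !finset.inE//= =>
  /andP[-> lk] /=; rewrite neq_ltn lk.
Qed.

Let batch_z i (k : 'I_T) (t : 'I_B) : measurable_fun (setT : set (sub (batch i k))) (z i k t).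
Proof. by apply: z_measurable; rewrite finset.inE /= !eqxx. Qed.

Let batch_u i (k : 'I_T) (t : 'I_B) : measurable_fun (setT : set (sub (batch i k))) (u i k t).
Proof. by apply: u_measurable; rewrite finset.inE /= !eqxx. Qed.

Let lipF : {ae D, forall z, (forall y, differentiable (F^~ z) y) /\
  forall y y', enorm (grad (F^~ z) y - grad (F^~ z) y') <= Lf * enorm (y - y')}.
Proof. by apply: filterS A2 => v []. Qed.

Let V2 := zo_second_moment d Lf mu M sigma.
Let bias := zo_sqr_bias d Lf mu.
Let rho := 2 * (V2 / B%:R) + 2 * bias.

(** The iterate is measurable for [past i k] and the batch lies in a disjoint group, so the iterate
    may be frozen at a feasible point and the bound at a fixed point applies. *)
Let batch_error i (k : 'I_T) :
  (\int[P]_w (enorm (Gbar i k w (iterate i k w) - grad f (iterate i k w)) ^+ 2)%:E <= rho%:E)%E.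
Proof.
pose h (p : borel V * sub (batch i k)) :=
  (enorm (Gbar i k p.2 p.1 - grad f p.1) ^+ 2)%:E.
have mh : measurable_fun setT h.
  apply/measurable_EFinP; apply: measurable_enorm_sqr => j.
  apply: (@measurable_Gbar _ (borel V * sub (batch i k))%type i k fst snd j) => [|t|t].
  - exact: measurable_fst.
  - by apply: (measurableT_comp (@batch_z i k t)); exact: measurable_snd.
  - by apply: (measurableT_comp (@batch_u i k t)); exact: measurable_snd.
have h0 p : (0 <= h p)%E by rewrite lee_fin sqr_ge0.
have mx : measurable_fun (setT : set (sub (past i k))) (iterate i k : Omega -> borel V).
  by apply: iterate_measurable; exact/ltnW/ltn_ord.
have hle w : (\int[P]_v h (iterate i k w, v) <= rho%:E)%E.
  apply: (batch_sqr_error_mean F_borel mu0 A1 A3 (iterate_X i k w) lipF GI GT Gm indG B0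
    (jz := fun t => inr (inr (inl (i, k, t)))) (ju := fun t => inr (inr (inr (inl (i, k, t)))))
    (z := z i k) (u := u i k)) => //.
  - by move=> t t' [].
  - by move=> t t' [].
exact: (joint_integral_le GI GT Gm indG (@past_batch i k) mx mh h0 hle).
Qed.

Let mean_gg i k : \bar R := (\int[P]_w (enorm (gg (iterate i k w)) ^+ 2)%:E)%E.

Let idx_group i (k : 'I_T) : {set J} := [set inl (i, k)]%SET.

Let idx_pick i (k : 'I_T) s : <<s joint G (idx_group i k) >> (idx i k @^-1` [set s]).
Proof.
apply: sub_sigma_algebra; exists (inl (i, k)); first by rewrite /= finset.inE.
by exists [set s] => //; rewrite setTI.
Qed.

Let past_batch_idx i (k : 'I_T) j : j \in past i k :|: batch i k -> j \notin idx_group i k.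
Proof.
rewrite !finset.inE; case: j => [[i' l]|[i'|[[[i' l] t]|[[[i' l] t]|[l|l]]]]]//=.
by rewrite orbF => /andP[_]; apply: contraTN => /eqP[_ ->]; rewrite ltnn.
Qed.

Let iterate_measurable' i (k : 'I_T) (A : {set J}) : past i k \subset A ->
  measurable_fun (setT : set (sub A)) (iterate i k : Omega -> borel V).
Proof.
move=> pA; apply: (sub_joint_measurable_fun pA).
by apply: iterate_measurable; exact/ltnW/ltn_ord.
Qed.

Let sub_past_batch i (k : 'I_T) : past i k \subset past i k :|: batch i k.
Proof. exact: finset.subsetUl. Qed.

Let measurable_gap_iterate i (k : 'I_T) s :
  measurable_fun (setT : set (sub (past i k :|: batch i k))) (fun w => gap i k w s).
Proof.
apply: measurable_gap; last exact: iterate_X.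
exact: iterate_measurable'.
Qed.

Let measurable_err_iterate i (k : 'I_T) s :
  measurable_fun (setT : set (sub (past i k :|: batch i k))) (fun w => err i k w s).
Proof.
have mx : measurable_fun (setT : set (sub (past i k :|: batch i k)))
    (iterate i k : Omega -> borel V) by exact: iterate_measurable'.
have me : measurable_fun (setT : set (sub (past i k :|: batch i k)))
    (fun w => Gbar i k w (iterate i k w) - grad f (iterate i k w) : borel V).
  apply: measurable_borel => j.
  apply: (@measurable_Gbar _ (sub (past i k :|: batch i k)) i k _ id j mx) => t.
    by apply: z_measurable; rewrite !finset.inE /= !eqxx orbT.
  by apply: u_measurable; rewrite !finset.inE /= !eqxx orbT.
apply: measurable_enorm_sqr => j.
exact: (measurableT_comp (measurable_coord j) (measurable_blk (s := s) me)).
Qed.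

(** The block index is independent of the past and the batch together and is uniform, so the
    selected block carries 1 / b of the whole squared norm. *)
Let mean_gap i (k : 'I_T) :
  (\int[P]_w (gap i k w (idx i k w))%:E = b%:R^-1%:E * mean_gg i k)%E.
Proof.
rewrite (joint_index_integral GI GT Gm indG (@past_batch_idx i k)
  (Y := fun s w => gap i k w s) (p := fun=> b%:R^-1)).
- rewrite -ge0_sume_distrr => [|s _]; last by apply: integral_ge0 => w _; rewrite lee_fin sqr_ge0.
  congr (_ * _)%E; rewrite -ge0_integral_sum => // [|s|s w _].
  + by apply: eq_integral => w _; rewrite sumEFin enorm_sqr_blk.
  + by apply/measurable_EFinP; exact: (joint_measurable_fun Gm (@measurable_gap_iterate i k s)).
  + by rewrite lee_fin sqr_ge0.
- exact: measurable_gap_iterate.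
- by move=> s w; exact: sqr_ge0.
- exact: idx_pick.
- by move=> s; case: (idx_law i k s).
Qed.

Let mean_err i (k : 'I_T) :
  (\int[P]_w (err i k w (idx i k w))%:E <= (b%:R^-1 * rho)%:E)%E.
Proof.
rewrite (joint_index_integral GI GT Gm indG (@past_batch_idx i k)
  (Y := fun s w => err i k w s) (p := fun=> b%:R^-1)).
- rewrite -ge0_sume_distrr => [|s _]; last by apply: integral_ge0 => w _; rewrite lee_fin sqr_ge0.
  rewrite EFinM; apply: lee_wpmul2l; first by rewrite lee_fin invr_ge0.
  apply: le_trans (batch_error i k); rewrite -ge0_integral_sum => // [|s|s w _].
  + by rewrite le_eqVlt; apply/orP; left; apply/eqP/eq_integral => w _;
      rewrite sumEFin [in RHS]enorm_sqr_blk.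
  + by apply/measurable_EFinP; exact: (joint_measurable_fun Gm (@measurable_err_iterate i k s)).
  + by rewrite lee_fin sqr_ge0.
- exact: measurable_err_iterate.
- by move=> s w; exact: sqr_ge0.
- exact: idx_pick.
- by move=> s; case: (idx_law i k s).
Qed.

Let measurable_indexed i (k : 'I_T) (Y : 'I_b -> Omega -> R) :
  (forall s, measurable_fun (setT : set (sub (past i k :|: batch i k))) (Y s)) ->
  measurable_fun setT (fun w => Y (idx i k w) w).
Proof.
move=> mY; apply: measurable_index => s; first by case: (idx_law i k s).
exact: (joint_measurable_fun Gm (mY s)).
Qed.

Let sum_mean_gg i : (\sum_(k < T) b%:R^-1%:E * mean_gg i k <=
  (32 / 5 * H + 42 / 5 * (T%:R * (b%:R^-1 * rho)))%:E)%E.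
Proof.
have mgap (k : 'I_T) : measurable_fun setT (fun w => gap i k w (idx i k w)).
  by apply: (measurable_indexed (Y := fun s w => gap i k w s)); exact: measurable_gap_iterate.
have merr (k : 'I_T) : measurable_fun setT (fun w => err i k w (idx i k w)).
  by apply: (measurable_indexed (Y := fun s w => err i k w s)); exact: measurable_err_iterate.
have gap0 (k : 'I_T) w : 0 <= gap i k w (idx i k w) by exact: sqr_ge0.
have err0 (k : 'I_T) w : 0 <= err i k w (idx i k w) by exact: sqr_ge0.
rewrite -(eq_bigr _ (fun (k : 'I_T) _ => mean_gap i k)).
rewrite -ge0_integral_sum => // [|k|k w _]; last by rewrite lee_fin.
  2: exact/measurable_EFinP.
apply: le_trans (_ : \int[P]_w (32 / 5 * H + 42 / 5 * \sum_(k < T) err i k w (idx i k w))%:E <= _)%E.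
  apply: ge0_le_integral => //.
  - by move=> w _; apply: sume_ge0 => k _; rewrite lee_fin.
  - by apply: emeasurable_sum => k; exact/measurable_EFinP.
  - apply/measurable_EFinP; apply: measurable_funD => //; apply: measurable_funM => //.
    exact: measurable_sum.
  - by move=> w _; rewrite sumEFin lee_fin; exact: run_descent.
under eq_integral => w _ do rewrite EFinD (EFinM (42 / 5)) -sumEFin.
have s0 w : (0 <= \sum_(k < T) (err i k w (idx i k w))%:E)%E.
  by apply: sume_ge0 => k _; rewrite lee_fin.
have ms : measurable_fun setT (fun w => \sum_(k < T) (err i k w (idx i k w))%:E)%E.
  by apply: emeasurable_sum => k; exact/measurable_EFinP.
have c0 : (0 <= (42 / 5 : R)%:E)%E by rewrite lee_fin divr_ge0.
rewrite ge0_integralD//; last 3 first.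
- by move=> w _; rewrite lee_fin mulr_ge0// divr_ge0.
- by move=> w _; rewrite mule_ge0.
- exact: measurable_funeM.
rewrite integral_cst//= probability_setT mule1 EFinD leeD2l//.
rewrite ge0_integralZl// [leRHS]EFinM; apply: lee_wpmul2l => //.
rewrite ge0_integral_sum => // [|k|k w _].
- apply: le_trans (_ : \sum_(k < T) (b%:R^-1 * rho)%:E <= _)%E.
    by apply: lee_sum => k _; exact: mean_err.
  by rewrite sumEFin lee_fin sumr_const card_ord mulr_natl.
- exact/measurable_EFinP.
- by rewrite lee_fin.
Qed.

Let out_group i : {set J} := [set inr (inl i)]%SET.

Let out_pick i (k : 'I_T) : <<s joint G (out_group i) >> (out i @^-1` [set k]).
Proof.
apply: sub_sigma_algebra; exists (inr (inl i)); first by rewrite /= finset.inE.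
by exists [set k] => //; rewrite setTI.
Qed.

Let past_out i j : j \in past i T -> j \notin out_group i.
Proof. by rewrite !finset.inE; case: j => [[i' l]|[i'|[[[i' l] t]|[[[i' l] t]|[l|l]]]]]. Qed.

Let sub_pastT i (k : 'I_T) : past i k \subset past i T.
Proof.
apply/fintype.subsetP; case=> [[i' l]|[i'|[[[i' l] t]|[[[i' l] t]|[l|l]]]]];
  by rewrite !finset.inE//= => /andP[-> _] /=.
Qed.

(** The output weights are known only to be equal; their common value follows from the total mass 1,
    by integrating the constant 1 over the values of [out i]. *)
Let q_def (i : 'I_S) : q = T%:R^-1.
Proof.
have := joint_index_integral GI GT Gm indG (@past_out i) (i := out i) (p := fun=> q)
  (Y := fun _ _ => 1).
rewrite integral_cst//= probability_setT mule1 => H1.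
have {H1} : (1%:E = \sum_(k < T) q%:E * 1%:E)%E.
  apply: H1 => [s|s w|s|s]; [exact: measurable_cst|exact: ler01|exact: out_pick|].
  by case: (out_law i s).
under eq_bigr do rewrite mule1.
rewrite sumEFin sumr_const card_ord => -[] E.
by apply: (mulIf (x := T%:R)); rewrite ?mulVf ?pnatr_eq0 -?lt0n// mulr_natr.
Qed.

Let xout i w := iterate i (out i w) w.

Let run_mean i : (\int[P]_w (enorm (gg (xout i w)) ^+ 2)%:E <=
  (b%:R / T%:R * (32 / 5 * H) + 42 / 5 * rho)%:E)%E.
Proof.
(* A block index exists, namely the value of [idx] at the default point of [Omega]. *)
have b0 : (0 < b)%N by case: (idx i 0 point) => m; exact: leq_trans.
have T1 : T%:R != 0 :> R by rewrite pnatr_eq0 -lt0n.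
have b1 : b%:R != 0 :> R by rewrite pnatr_eq0 -lt0n.
rewrite /xout (joint_index_integral GI GT Gm indG (@past_out i) (i := out i)
  (Y := fun (k : 'I_T) w => enorm (gg (iterate i k w)) ^+ 2) (p := fun=> T%:R^-1)); first last.
- by move=> k; rewrite -(q_def i); case: (out_law i k).
- exact: out_pick.
- by move=> k w; exact: sqr_ge0.
- move=> k; apply: measurable_gg; last exact: iterate_X.
  by apply: (@iterate_measurable' i k); exact: sub_pastT.
(* Writing 1 / T as (b / T) (1 / b) recovers the sum over sampled blocks; the factor b is the price
   of updating one block per step, and it cancels the 1 / b of the error term. *)
rewrite (eq_bigr (fun k : 'I_T => (b%:R / T%:R)%:E * (b%:R^-1%:E * mean_gg i k))%E); last first.
  by move=> k _; rewrite muleA -EFinM mulrAC divff// mul1r.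
rewrite -ge0_sume_distrr => [|k _]; last first.
  by rewrite mule_ge0 ?lee_fin ?invr_ge0//; apply: integral_ge0 => w _; rewrite lee_fin sqr_ge0.
have bT0 : (0 <= (b%:R / T%:R : R)%:E)%E by rewrite lee_fin divr_ge0.
apply: le_trans (lee_wpmul2l bT0 (sum_mean_gg i)) _.
rewrite -EFinM lee_fin le_eqVlt; apply/orP; left; apply/eqP.
by field; rewrite T1 b1.
Qed.

Let past_run i : past i T \subset run i.
Proof.
apply/fintype.subsetP; case=> [[i' l]|[i'|[[[i' l] t]|[[[i' l] t]|[l|l]]]]];
  by rewrite !finset.inE//= => /andP[-> _] /=.
Qed.

Let xout_measurable i :
  measurable_fun (setT : set (sub (run i))) (xout i : Omega -> borel V).
Proof.
apply: measurable_borel => j.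
apply: (@measurable_index _ (sub (run i)) 'I_T R (out i) (fun k w => iterate i k w j 0)) => k.
  apply: (sub_joint (A := out_group i)); last exact: out_pick.
  by apply/fintype.subsetP => l; rewrite !finset.inE => /eqP ->; exact: eqxx.
have mx : measurable_fun (setT : set (sub (run i))) (iterate i k : Omega -> borel V).
  by apply: iterate_measurable'; exact: fintype.subset_trans (sub_pastT i k) (past_run i).
exact: (measurableT_comp (measurable_coord j) mx).
Qed.

Let xout_X i w : prod_set X (xout i w). Proof. exact: iterate_X. Qed.

Let zgap_event t i : <<s joint G (run i) >> [set w | t <= enorm (gg (xout i w)) ^+ 2].
Proof.
have mz : measurable_fun (setT : set (sub (run i))) (fun w => enorm (gg (xout i w)) ^+ 2).
  by apply: measurable_gg => //; exact: xout_measurable.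
have := mz measurableT `[t, +oo[%classic (measurable_itv _).
rewrite setTI; congr (<<s _ >> _).
by apply/seteqP; split => w /=; rewrite in_itv/= andbT.
Qed.

Let measurable_zgap_event t i : measurable [set w | t <= enorm (gg (xout i w)) ^+ 2].
Proof. by have := joint_measurable Gm (@zgap_event t i). Qed.

(** Markov at twice the mean bound gives 1/2 for each run, and distinct runs use disjoint groups of
    samples. *)
Let runs_tail (Q : R) : b%:R / T%:R * (32 / 5 * H) + 42 / 5 * rho <= Q -> 0 < Q ->
  (P [set w | forall i, (2 * Q <= enorm (gg (xout i w)) ^+ 2)%R] <= (2 ^- S)%:E)%E.
Proof.
move=> QQ Q0.
have Ei i : (P [set w | (2 * Q <= enorm (gg (xout i w)) ^+ 2)%R] <= (2^-1)%:E)%E.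
  have mz : measurable_fun setT (fun w => enorm (gg (xout i w)) ^+ 2).
    by apply: measurable_gg => //; exact: (joint_measurable_fun Gm (@xout_measurable i)).
  have z0 w : 0 <= enorm (gg (xout i w)) ^+ 2 by exact: sqr_ge0.
  have [a ha ale] := ge0_has_mean mz z0 (run_mean i).
  apply: le_trans (has_mean_markov ha z0 (_ : 0 < 2 * Q)) _; first by rewrite mulr_gt0.
  by rewrite lee_fin ler_pdivrMr ?mulr_gt0//; lra.
have run_disj i i' j : j \in run i -> j \in run i' -> i = i'.
  rewrite !finset.inE; case: j => [[l k]|[l|[[[l k] t]|[[[l k] t]|[k|k]]]]]//=; rewrite ?andbT;
  by move=> /eqP -> /eqP.
have := joint_bigcap_le GI GT Gm indG run_disj (zgap_event (2 * Q)) Ei (enum_uniq 'I_S).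
rewrite -cardE card_ord -exprVn.
suff -> : [set w | forall i, (2 * Q <= enorm (gg (xout i w)) ^+ 2)%R] =
  [set w | forall i, i \in enum 'I_S -> [set w | (2 * Q <= enorm (gg (xout i w)) ^+ 2)%R] w] by [].
apply/seteqP; split => w /= h i; first by move=> _; exact: h.
by apply: h; rewrite mem_enum.
Qed.

Let measurable_runs t : measurable [set w | forall i, t <= enorm (gg (xout i w)) ^+ 2].
Proof.
rewrite (_ : [set w | _] = \bigcap_(i in [set: 'I_S]) [set w | t <= enorm (gg (xout i w)) ^+ 2]).
  by apply: fin_bigcap_measurable => // i _; exact: measurable_zgap_event.
by apply/seteqP; split => w /= h i; [move=> _; exact: h|exact: h].
Qed.

Let perr i w := enorm (avg_zo_grad F mu N (zpost^~ w) (upost^~ w) (xout i w)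
                       - grad f (xout i w)) ^+ 2.

Let run_post i j : j \in run i -> j \notin post.
Proof. by rewrite !finset.inE; case: j => [[l k]|[l|[[[l k] t]|[[[l k] t]|[k|k]]]]]. Qed.

Let zpost_measurable (k : 'I_N) : measurable_fun (setT : set (sub post)) (zpost k).
Proof.
have jA : inr (inr (inr (inr (inl k)))) \in post by rewrite finset.inE.
exact: (@generated_joint_measurable_fun R _ _ _ _ _ _ _ _ _ jA).
Qed.

Let upost_measurable (k : 'I_N) : measurable_fun (setT : set (sub post)) (upost k).
Proof.
have jA : inr (inr (inr (inr (inr k)))) \in post by rewrite finset.inE.
exact: (@generated_joint_measurable_fun R _ _ _ _ _ _ _ _ _ jA).
Qed.

Let perr_measurable i : measurable_fun setT (perr i).
Proof.
apply: measurable_enorm_sqr => j.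
have mx : measurable_fun setT (xout i : Omega -> borel V).
  exact: (joint_measurable_fun Gm (@xout_measurable i)).
rewrite (_ : (fun w => _) = fun w => avg_zo_grad F mu N (zpost^~ w) (upost^~ w) (xout i w) j 0
   - grad f (xout i w) j 0); last by apply/funext => w; rewrite mxE [X in _ + X]mxE.
apply: measurable_funB; last exact: (measurableT_comp (measurable_grad j f_diff) mx).
apply: (measurable_avg_zo_grad F_borel mu j mx) => k.
  by case: (zpost_law k).
by case: (upost_law k).
Qed.

Let perr_event r i : measurable [set w | r <= perr i w].
Proof.
rewrite (_ : [set w | _] = setT `&` perr i @^-1` `[r, +oo[).
  exact: perr_measurable.
by rewrite setTI; apply/seteqP; split => w /=; rewrite in_itv/= andbT.
Qed.

(** The output of run i is frozen against the fresh second-phase samples. The integrand is the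
    indicator of a large error, so the tail bound at a deterministic point transfers to the random
    one. *)
Let post_tail i lambda : 0 < lambda ->
  (P [set w | (2 * (lambda * (V2 / N%:R)) + 2 * bias <= perr i w)%R] <= (lambda^-1)%:E)%E.
Proof.
move=> l0; set r := _ + _.
pose e (p : borel V * sub post) : R :=
  enorm (avg_zo_grad F mu N (zpost^~ p.2) (upost^~ p.2) p.1 - grad f p.1) ^+ 2.
have me : measurable_fun setT e.
  apply: measurable_enorm_sqr => j.
  rewrite (_ : (fun p => _) = fun p : borel V * sub post =>
     avg_zo_grad F mu N (zpost^~ p.2) (upost^~ p.2) p.1 j 0 - grad f p.1 j 0); last first.
    by apply/funext => p; rewrite mxE [X in _ + X]mxE.
  apply: measurable_funB.
    apply: (@measurable_avg_zo_grad _ _ _ _ _ _ F_borel mu N _ (borel V * sub post)%type fst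
      (fun t p => upost t p.2) (fun t p => zpost t p.2)) => [|k|k]; first exact: measurable_fst.
      exact: (measurableT_comp (@zpost_measurable k) measurable_snd).
    exact: (measurableT_comp (@upost_measurable k) measurable_snd).
  exact: (measurableT_comp (measurable_grad j f_diff) measurable_fst).
pose E := [set p | r <= e p].
have mE : measurable E.
  rewrite (_ : E = setT `&` e @^-1` `[r, +oo[); first exact: me.
  by rewrite setTI; apply/seteqP; split => p /=; rewrite /E/= in_itv/= andbT.
pose h p := (\1_E p : R)%:E.
have mh : measurable_fun setT h by apply/measurable_EFinP; exact: measurable_indic.
have h0 p : (0 <= h p)%E by rewrite lee_fin indicE.
(* For a frozen point the section [Ew] depends on the second-phase samples only, and its integral is
   a probability. *)
have hle w : (\int[P]_v h (xout i w, v) <= (lambda^-1)%:E)%E.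
  pose Ew : set Omega := [set v | (r <= e (xout i w, v))%R].
  have sEw : <<s joint G post >> Ew.
    have := measurableT_comp me (measurable_pair1 (xout i w : borel V)).
    move=> /(_ measurableT `[r, +oo[%classic (measurable_itv _)).
    rewrite setTI; congr (<<s _ >> _).
    by apply/seteqP; split => v /=; rewrite in_itv/= andbT.
  have mEw : measurable Ew by exact: (joint_measurable Gm sEw).
  rewrite (_ : (\int[P]_v h (xout i w, v))%E = (\int[P]_v (\1_Ew v)%:E)%E); last by [].
  rewrite (integral_indicT _ mEw).
  apply: (batch_sqr_error_tail F_borel Lf0 mu0 A1 A3 (xout_X i w) lipF GI GT Gm indG N0
    (jz := fun t => inr (inr (inr (inr (inl t)))))
    (ju := fun t => inr (inr (inr (inr (inr t)))))) => //.
  - by move=> t t' [].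
  - by move=> t t' [].
have := joint_integral_le GI GT Gm indG (@run_post i) (@xout_measurable i) mh h0 hle.
pose Er : set Omega := [set w | (r <= perr i w)%R].
rewrite (_ : (\int[P]_w h (xout i w, w))%E = (\int[P]_w (\1_Er w)%:E)%E); last by [].
by rewrite (integral_indicT _ (perr_event r i)).
Qed.

Let Gpost w (x : V) := avg_zo_grad F mu N (zpost^~ w) (upost^~ w) x.

(** If every second-phase error is at most r, the selection inequality turns c <= |P(xstar)|^2 into
    8 Q + 6 r <= 4 |P(xbar_j)|^2 + 6 r for all j, that is, every run exceeds 2 Q. The union bound
    over the S errors costs S / lambda. *)
Lemma two_phase_tail (xstar : Omega -> borel V) (Q lambda c : R) :
  measurable_fun setT xstar ->
  (forall w, exists2 i,
     xstar w = zs_bccg F cndg mu (fun=> alpha) (fun=> delta) (fun=> B) x1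
       (fun k => idx i k w) (fun k t => z i k t w) (fun k t => u i k t w) (out i w) &
     forall j, let x i := zs_bccg F cndg mu (fun=> alpha) (fun=> delta) (fun=> B) x1
       (fun k => idx i k w) (fun k t => z i k t w) (fun k t => u i k t w) (out i w) in
     let G := avg_zo_grad F mu N (fun k => zpost k w) (fun k => upost k w) in
     enorm (gen_grad X phi chi (x i) (G (x i)) alpha) <=
     enorm (gen_grad X phi chi (x j) (G (x j)) alpha)) ->
  b%:R / T%:R * (32 / 5 * (Lhat * (f x1 + block_sum chi x1 - Phistar) + Lhat))
    + 42 / 5 * (2 * (zo_second_moment d Lf mu M sigma / B%:R) + 2 * zo_sqr_bias d Lf mu) <= Q ->
  0 < Q -> 0 < lambda ->
  8 * Q + 6 * (2 * (lambda * (zo_second_moment d Lf mu M sigma / N%:R))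
    + 2 * zo_sqr_bias d Lf mu) <= c ->
  (P [set w | (c <= enorm (gen_grad X phi chi (xstar w) (grad f (xstar w)) alpha) ^+ 2)%R]
    <= ((S%:R + 1) / lambda + 2 ^- S)%:E)%E.
Proof.
have key (g1 g2 p1 p2 r' : R) : g1 <= 4 * g2 + 2 * p1 + 4 * p2 -> p1 <= r' -> p2 <= r' ->
  c <= g1 -> 8 * Q + 6 * r' <= c -> 2 * Q <= g2 by lra.
move=> mxs argmin QQ Q0 l0 cle.
set r := 2 * (lambda * (V2 / N%:R)) + 2 * bias in cle.
(* The error events are extended by the empty set to all natural indices, the form taken by the
   union bound. *)
pose A (k : nat) : set Omega := if insub k is Some i then [set w | r <= perr i w] else set0.
have AE (i : 'I_S) : A i = [set w | r <= perr i w] by rewrite /A valK.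
have mA k : measurable (A k) by rewrite /A; case: insub => [i|]; [exact: perr_event|].
have xsX w : prod_set X (xstar w) by have [i -> _] := argmin w; exact: xout_X.
have mstar : measurable_fun setT (fun w => enorm (gg (xstar w)) ^+ 2) by exact: measurable_gg.
have mE : measurable [set w | c <= enorm (gg (xstar w)) ^+ 2].
  rewrite (_ : [set w | _] = setT `&` (fun w => enorm (gg (xstar w)) ^+ 2) @^-1` `[c, +oo[).
    exact: mstar.
  by rewrite setTI; apply/seteqP; split => w /=; rewrite in_itv/= andbT.
have mR := measurable_runs (2 * Q).
have mU : measurable (\big[setU/set0]_(i < S) A i) by exact: bigsetU_measurable.
apply: le_trans (_ : P ([set w | forall i, (2 * Q <= enorm (gg (xout i w)) ^+ 2)%R]
    `|` \big[setU/set0]_(i < S) A i) <= _)%E.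
  apply: le_measure; rewrite ?inE//; first exact: measurableU.
  move=> w /= cw; have [[i ri]|/forallNP allr] := pselect (exists i, r <= perr i w).
    by right; rewrite -bigcup_mkord; exists i => //=; rewrite AE.
  left => j; have [i xi xmin] := argmin w; rewrite -/(xout i w) in xi.
  have hj : enorm (gen_grad X phi chi (xout i w) (Gpost w (xout i w)) alpha) <=
      enorm (gen_grad X phi chi (xout j w) (Gpost w (xout j w)) alpha) := xmin j.
  have perr_lt l : perr l w <= r by rewrite leNgt; apply/negP => /ltW; exact: allr.
  have xiE : xstar w = xout i w := xi.
  have h : enorm (gg (xout i w)) ^+ 2 <= 4 * enorm (gg (xout j w)) ^+ 2 +
      2 * perr i w + 4 * perr j w :=
    gen_grad_selection_le X_closed X_convex chi_cc phi_diff phi_sc approx_ex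
      (grad f (xout i w)) (grad f (xout j w)) alpha0 (xout_X i w) (xout_X j w) hj.
  have {}cw : c <= enorm (gg (xout i w)) ^+ 2 by rewrite -xiE.
  exact: key h (perr_lt i) (perr_lt j) cw cle.
apply: le_trans (measureU2 _ mR mU) _; rewrite addeC EFinD; apply: leeD; last first.
  exact: runs_tail.
apply: le_trans (le_mu_bigsetU _ _) _ => //.
apply: le_trans (_ : \sum_(i < S) (lambda^-1)%:E <= _)%E.
  by apply: lee_sum => i _; rewrite AE; exact: post_tail.
have -> : (\sum_(i < S) (lambda^-1)%:E = (S%:R / lambda)%:E)%E.
  by rewrite sumEFin sumr_const card_ord mulr_natl.
by rewrite lee_fin ler_pM2r ?invr_gt0// lerDl.
Qed.

End RunIterates.

(** * Elementary bounds on the parameters *)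

Lemma sup_range_ge {R : realType} (b : nat) (L : 'I_b -> R) s : L s <= sup (range L).
Proof.
apply: sup_upper_bound; last by exists s.
split; first by exists (L s), s.
exists (\sum_t `|L t|) => _ [t _ <-].
by rewrite (bigD1 t)//= (le_trans (ler_norm _))// lerDl sumr_ge0.
Qed.

Lemma inf_range_bounds {R : realType} (b : nat) (L : 'I_b -> R) : (0 < b)%N ->
  (forall s, 0 < L s) -> 0 < inf (range L) <= sup (range L).
Proof.
move=> b0 L0; pose s0 : 'I_b := Ordinal b0.
case: (Order.TotalTheory.arg_minP (P := xpredT) (i0 := s0) L isT) => s _ smin; apply/andP; split.
  apply: lt_le_trans (L0 s) _; apply: lb_le_inf; first by exists (L s), s.
  by move=> _ [t _ <-]; exact: smin.
apply: le_trans (sup_range_ge L s); apply: ge_inf; last by exists s.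
by exists (L s) => _ [t _ <-]; exact: smin.
Qed.

Lemma absz_ceil_bounds {R : realType} (t : R) (B k : nat) : 0 < t -> t <= k%:R ->
  B = `|Num.ceil t|%N -> [/\ t <= B%:R, B%:R <= t + 1, (0 < B)%N & (B <= k)%N].
Proof.
move=> t0 tk BE.
have c0 : 0 <= Num.ceil t by rewrite ceil_ge0; lra.
have BR : B%:R = (Num.ceil t)%:~R :> R by rewrite BE -[in RHS](gez0_abs c0) pmulrn.
have /andP[h1 h2] := ceil_itv t; rewrite -BR in h2.
have h3 : B%:R <= t + 1 by move: h1; rewrite intrB -BR; lra.
split => //; first by rewrite -(ltr_nat R); exact: lt_le_trans t0 h2.
by rewrite -lez_nat BE gez0_abs// ceil_le_int.
Qed.

(** Rounding the iteration count down loses at most a factor 2: the remainder is below B, and the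
    quotient is at least 1. *)
Lemma leq_double_div (k B : nat) : (0 < B)%N -> (B <= k)%N ->
  (0 < k %/ B)%N /\ (k <= 2 * B * (k %/ B))%N.
Proof.
move=> B0 Bk; have T0 : (0 < k %/ B)%N by rewrite divn_gt0.
split => //; rewrite {1}(divn_eq k B) -mulnA mul2n -addnn mulnC leq_add2l.
by apply: leq_trans (ltnW (ltn_pmod k B0)) _; rewrite leq_pmulr.
Qed.

Theorem theorem8 (R : realType)
  (* the space, its blocks, and the feasible set *)
  (b : nat) (d : 'I_b -> nat) (n : nat)
  (b_gt0 : (0 < b)%N) (d_gt0 : forall s, (0 < d s)%N)
  (n_def : n = (\sum_(s < b) d s)%N)
  (X : forall s : 'I_b, set 'cV[R]_(d s))
  (X_closed : forall s, closed (X s))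
  (X_convex : forall s, convex_set (M := 'cV[R]_(d s)) (X s))
  (* the objective *)
  (dXi : measure_display) (Xi : measurableType dXi) (D : probability Xi R)
  (F : blockvec R d -> Xi -> R)
  (F_borel : measurable_fun setT
     (fun q : borel (blockvec R d) * Xi => F q.1 q.2))
  (f : blockvec R d -> R)
  (chi : forall s : 'I_b, 'cV[R]_(d s) -> R)
  (chi_closed_convex : forall s, closed_convex_fun (chi s))
  (Phi : blockvec R d -> R)
  (Phi_def : forall x, Phi x = f x + block_sum chi x)
  (Phistar : R)
  (Phistar_min : (exists2 x, prod_set X x & Phi x = Phistar) /\
                 forall x, prod_set X x -> Phistar <= Phi x)
  (phi : forall s : 'I_b, 'cV[R]_(d s) -> R)
  (phi_differentiable : forall s x, differentiable (phi s) x)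
  (phi_strongly_convex : forall s, strongly_convex1 (phi s))
  (* the assumptions *)
  (sigma M Lf : R) (L : 'I_b -> R)
  (Lf_gt0 : 0 < Lf) (L_gt0 : forall s, 0 < L s)
  (A1 : assumption1 F D f (prod_set X) sigma)
  (A2 : assumption2 F D Lf L)
  (A3 : assumption3 f (prod_set X) M)
  (* the constants; extrema over the finitely many blocks *)
  (Lhat Lcheck omegaL DPhi Dtilde : R)
  (x1 : blockvec R d) (x1_X : prod_set X x1)
  (Lhat_def : Lhat = sup (range L)) (Lcheck_def : Lcheck = inf (range L))
  (omegaL_def : omegaL = Lhat / Lcheck + 2)
  (DPhi_def : DPhi = Num.sqrt ((Phi x1 - Phistar) / Lhat))
  (Dtilde_gt0 : 0 < Dtilde)
  (* the parameters of the method: S runs, Tt oracle calls per run, B the batch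
     size, T the iteration limit, N the post-optimization sample size *)
  (S Tt N B T : nat) (S_gt0 : (0 < S)%N) (Tt_gt0 : (0 < Tt)%N) (N_gt0 : (0 < N)%N)
  (B_def : B = `|Num.ceil
     (Num.min
       (Num.max
         (omegaL * Num.sqrt ((n%:R + 4) * (2 * M ^+ 2 + sigma ^+ 2) * Tt%:R) / Dtilde)
         (omegaL * (n%:R + 4)))
       Tt%:R)%R|%N)
  (T_def : T = (Tt %/ B)%N)
  (mu : R)
  (mu_bounds : 0 < mu <= DPhi / (n%:R + 4) * Num.sqrt (b%:R / Tt%:R))
  (cndg : forall s : 'I_b, 'cV[R]_(d s) -> 'cV[R]_(d s) -> R -> R -> 'cV[R]_(d s))
  (cndgP : cndg_implementation X phi chi cndg)
  (* the random quantities *)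
  (dO : measure_display) (Omega : measurableType dO) (P : probability Omega R)
  (idx : 'I_S -> nat -> Omega -> 'I_b) (out : 'I_S -> Omega -> 'I_T)
  (z : 'I_S -> nat -> nat -> Omega -> Xi)
  (u : 'I_S -> nat -> nat -> Omega -> borel (blockvec R d))
  (zpost : nat -> Omega -> Xi)
  (upost : nat -> Omega -> borel (blockvec R d))
  (idx_law : forall i (k : 'I_T), finite_law P (idx i k) (fun=> b%:R^-1))
  (out_law : forall i, finite_law P (out i)
     (out_pmf (fun=> b%:R^-1) L (fun=> (2 * Lhat)^-1) (T := T)))
  (z_law : forall i (k : 'I_T) (t : 'I_B), has_law P (z i k t) D)
  (u_law : forall i (k : 'I_T) (t : 'I_B), std_gaussian P (u i k t))
  (zpost_law : forall k : 'I_N, has_law P (zpost k) D)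
  (upost_law : forall k : 'I_N, std_gaussian P (upost k))
  (independent : @samples_independent _ _ _ P S T B N b _ _ _ idx out z u zpost upost)
  (* the outputs of the runs and of the two-phase method *)
  (xbar : 'I_S -> Omega -> blockvec R d)
  (xbar_def : forall i w, xbar i w =
     zs_bccg F cndg mu (fun=> (2 * Lhat)^-1) (fun=> (3 * T%:R)^-1) (fun=> B) x1
       (fun k => idx i k w) (fun k t => z i k t w) (fun k t => u i k t w) (out i w))
  (Gpost : Omega -> blockvec R d -> blockvec R d)
  (Gpost_def : forall w x, Gpost w x =
     avg_zo_grad F mu N (fun k => zpost k w) (fun k => upost k w) x)
  (xstar : Omega -> borel (blockvec R d))
  (xstar_measurable : measurable_fun setT xstar)
  (xstar_argmin : forall w, exists2 i, xstar w = xbar i w &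
     forall j,
       enorm (gen_grad X phi chi (xbar i w) (Gpost w (xbar i w)) (2 * Lhat)^-1) <=
       enorm (gen_grad X phi chi (xbar j w) (Gpost w (xbar j w)) (2 * Lhat)^-1))
  (* the bound *)
  (kappa1 kappa2 C : R)
  (kappa1_def : kappa1 = Num.max
     (omegaL * Num.sqrt ((n%:R + 4) * (2 * M ^+ 2 + sigma ^+ 2))
        / (Dtilde * Num.sqrt Tt%:R)) 1)
  (kappa2_def : kappa2 = Num.max (omegaL * (n%:R + 4) / Tt%:R) 1)
  (C_def : C =
     8 * Num.sqrt ((n%:R + 4) * (2 * M ^+ 2 + sigma ^+ 2)) / Num.sqrt Tt%:R
       * (2 * kappa1 * Dtilde + (Lhat ^+ 2 * DPhi ^+ 2 + Lhat) / Dtilde)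
     + ((16 * kappa2 + 1) * Lf ^+ 2 * DPhi ^+ 2
        + 8 * (Lhat ^+ 2 * DPhi ^+ 2 + Lhat)) * (n%:R + 4) / Tt%:R) :
  forall lambda : R, 0 < lambda ->
    (P [set w |
        (enorm (gen_grad X phi chi (xstar w) (grad f (xstar w)) (2 * Lhat)^-1) ^+ 2
         >= 16 * b%:R * omegaL * C
            + 3 * DPhi ^+ 2 * Lf ^+ 2 * b%:R * (n%:R + 4) / Tt%:R
            + 32 * (n%:R + 4) * lambda / N%:R
              * (2 * M ^+ 2 + sigma ^+ 2
                 + DPhi ^+ 2 * Lf ^+ 2 * b%:R / Tt%:R))%R]
      <= ((S%:R + 1) / lambda + 2 ^- S)%:E)%E.
Proof.
move=> lambda l0; subst n; set m := _%:R + 4 in mu_bounds B_def kappa1_def kappa2_def C_def *.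
set A := 2 * M ^+ 2 + sigma ^+ 2 in B_def kappa1_def C_def *.
have n1 : (1 <= \sum_(s < b) d s)%N.
  by rewrite (bigD1 (Ordinal b_gt0))//= ltn_addr// d_gt0.
have m5 : 5 <= m by rewrite /m; have := n1; rewrite -(ler_nat R); lra.
have A0 : 0 <= A by rewrite /A; have := sqr_ge0 M; have := sqr_ge0 sigma; lra.
have /andP[Lc0 LcL] := inf_range_bounds b_gt0 L_gt0.
rewrite -Lcheck_def -Lhat_def in Lc0 LcL.
have Lhat0 : 0 < Lhat by exact: lt_le_trans Lc0 LcL.
have LLhat s : L s <= Lhat by rewrite Lhat_def; exact: sup_range_ge.
have om3 : 3 <= omegaL.
  have : 1 <= Lhat / Lcheck by rewrite ler_pdivlMr// mul1r.
  by rewrite omegaL_def; lra.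
have tau1 : 1 <= Tt%:R :> R by rewrite ler1n.
have tau0 : 0 < Tt%:R :> R by lra.
have bb1 : 1 <= b%:R :> R by rewrite ler1n.
(* The outer minimum caps the batch size at [Tt], so that at least one iteration is performed. *)
have [||B_ge B_lt B0 BTt] := @absz_ceil_bounds R _ B Tt _ _ B_def.
- rewrite lt_min tau0 andbT lt_max; apply/orP; right.
  by rewrite mulr_gt0//; lra.
- by rewrite ge_min lexx orbT.
have [T0 T_large] := leq_double_div B0 BTt; rewrite -T_def in T0 T_large.
have [[xmin xminX Phi_xmin] Phistar_le] := Phistar_min.
have gap0 : 0 <= Phi x1 - Phistar by rewrite subr_ge0; exact: Phistar_le.
have D2 : Lhat * DPhi ^+ 2 = Phi x1 - Phistar.
  by rewrite DPhi_def sqr_sqrtr ?divr_ge0 ?(ltW Lhat0)// mulrC divfK// gt_eqF.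
pose H := Lhat ^+ 2 * DPhi ^+ 2 + Lhat.
have HE : Lhat * (f x1 + block_sum chi x1 - Phistar) + Lhat = H.
  by rewrite -Phi_def -D2 /H; ring.
have H0 : 0 < H by rewrite /H -[X in _ < X]addrC ltr_wpDr// mulr_ge0 ?sqr_ge0.
pose W := Lf ^+ 2 * DPhi ^+ 2.
have W0 : 0 <= W by rewrite mulr_ge0 ?sqr_ge0.
(* The common scale of the smoothing errors: E / 4 in the squared bias, E / 2 in the second moment.
   The upper bound on [mu] is what makes it at most W b m / Tt. *)
pose E := mu ^+ 2 * Lf ^+ 2 * m ^+ 3.
have m0 : 0 < m by lra.
have [mu0 mu_le] := andP mu_bounds.
have E_le : E <= W * b%:R * m / Tt%:R.
  have : mu ^+ 2 <= (DPhi / m * Num.sqrt (b%:R / Tt%:R)) ^+ 2.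
    by rewrite ler_sqr ?nnegrE ?(ltW mu0)//; exact: le_trans (ltW mu0) mu_le.
  rewrite exprMn sqr_sqrtr ?divr_ge0// => h.
  rewrite /E -mulrA; apply: le_trans (ler_wpM2r _ h) _.
    by rewrite mulr_ge0 ?sqr_ge0// exprn_ge0// ltW.
  rewrite le_eqVlt; apply/orP; left; apply/eqP; rewrite /W.
  by field; rewrite !gt_eqF.
have E0 : 0 <= E by rewrite /E -exprMn mulr_ge0 ?sqr_ge0// exprn_ge0// ltW.
set V := zo_second_moment d Lf mu M sigma; set beta := zo_sqr_bias d Lf mu.
have V_le : V <= 2 * m * A + E / 2.
  rewrite /V /zo_second_moment -/m /E /A.
  have := ler0n R (\sum_s d s); have := sqr_ge0 M; have := sqr_ge0 sigma; rewrite /m.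
  by move: (_%:R) (M ^+ 2) (sigma ^+ 2) => k p1 p2 h1 h2 h3; nra.
have beta_le : beta <= E / 4 by rewrite /beta /zo_sqr_bias -/m /E; lra.
have C_def' : C = 8 * Num.sqrt (m * A) / Num.sqrt Tt%:R * (2 * kappa1 * Dtilde + H / Dtilde)
    + ((16 * kappa2 + 1) * W + 8 * H) * m / Tt%:R by rewrite C_def /W mulrA.
have k2_1 : 1 <= kappa2 by rewrite kappa2_def le_max lexx orbT.
have k1_1 : 1 <= kappa1 by rewrite kappa1_def le_max lexx orbT.
have C0 : 0 < C.
  rewrite C_def' ltr_wpDl//.
    apply: mulr_ge0; first by rewrite divr_ge0 ?sqrtr_ge0// mulr_ge0 ?sqrtr_ge0.
    apply: addr_ge0; last by rewrite divr_ge0 ?(ltW H0) ?(ltW Dtilde_gt0).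
    by rewrite mulr_ge0 ?(ltW Dtilde_gt0)//; lra.
  rewrite divr_gt0// mulr_gt0// ltr_wpDl ?mulr_gt0//.
  by rewrite mulr_ge0//; lra.
have T_largeR : Tt%:R <= 2 * B%:R * T%:R :> R by rewrite -!natrM ler_nat.
have Q_le := run_constant_le bb1 om3 m5 A0 Dtilde_gt0 tau1 (ltW H0) W0 (_ : 1 <= B%:R)
  (_ : 0 < T%:R) B_ge B_lt T_largeR E0 E_le V_le beta_le kappa1_def k2_1 C_def'.
have {}Q_le := Q_le _ _; rewrite ler1n ltr0n in Q_le.
have {}Q_le := Q_le B0 T0.
(* Stepsizes and block probabilities are constant, so the output weight is the same at every index
   and its value at 0 serves for all. *)
pose q : R := out_pmf (fun=> b%:R^-1) L (fun=> (2 * Lhat)^-1) (Ordinal T0).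
have Phistar_le' x : prod_set X x -> Phistar <= f x + block_sum chi x.
  by move=> Xx; rewrite -Phi_def; exact: Phistar_le.
have Q0 : 0 < 2 * b%:R * omegaL * C by rewrite !mulr_gt0//; lra.
apply: (two_phase_tail X_closed X_convex F_borel chi_closed_convex Phistar_le'
  phi_differentiable phi_strongly_convex Lf_gt0 A1 A2 A3 Lhat0 LLhat x1_X mu0 T0 B0 N_gt0
  cndgP idx_law (q := q) out_law z_law u_law zpost_law upost_law independent
  xstar_measurable _ _ Q0 l0).
- move=> w; have [i xi imin] := xstar_argmin w.
  exists i => [|j]; first by rewrite xi xbar_def.
  by have := imin j; rewrite !Gpost_def !xbar_def.
- by rewrite HE.
have N0 : 0 < N%:R :> R by rewrite ltr0n.
have := post_constant_le omegaL C tau0 W0 (ltW (_ : 0 < b%:R)) (ltW m0) N0 l0 A0 E_le V_le beta_le.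
rewrite (_ : 3 * W = 3 * DPhi ^+ 2 * Lf ^+ 2); last by rewrite /W; ring.
by rewrite (_ : W = DPhi ^+ 2 * Lf ^+ 2); [apply; lra|rewrite /W; ring].
Qed.
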